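(* Let $p>1$ and let $f(t)=t^p$ for $t\ge 0$. For a bounded convex set $\Omega\subset\mathbb{R}^2$ whose boundary $\partial\Omega$ is a closed curve of class $W^{2,p}$, set $E_f(\partial\Omega)=\int_{\partial\Omega} f(\kappa(s))\,ds=\int_{\partial\Omega}\kappa(s)^p\,ds$, where $s$ is arc length and $\kappa\ge 0$ is the curvature of $\partial\Omega$. Then for every $a>0$, among all convex sets $\Omega$ of area $a$ with boundary of class $W^{2,p}$, the disc of area $a$ minimizes $E_f(\partial\Omega)$, and it is the only minimizer.
   Context: For a planar regular closed curve $\gamma$ parametrized by arc length, with unit tangent $\mathbf t=\gamma'$ and unit normal $\mathbf n$ chosen so that $(\mathbf t,\mathbf n)$ is positively oriented, the signed curvature is defined by $\mathbf t'(s)=\kappa(s)\mathbf n(s)$. For the counterclockwise-oriented boundary of a convex set, $\kappa\ge 0$. *)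

(* Defs.v *)
From HB Require Import structures.
From mathcomp Require Import all_boot all_order all_algebra.
From mathcomp Require Import all_classical all_reals all_analysis.
Set Implicit Arguments. Unset Strict Implicit. Unset Printing Implicit Defensive.
Import Order.TTheory GRing.Theory Num.Theory.
Import numFieldNormedType.Exports.
Local Open Scope classical_set_scope.
Local Open Scope ring_scope.

Section Defs.
Variable R : realType.
Notation mu := (@lebesgue_measure R).

Definition convex2 (O : set (R * R)) : Prop :=
  forall x y : R * R, O x -> O y -> forall t : R, 0 <= t <= 1 ->
    O ((1 - t) * x.1 + t * y.1, (1 - t) * x.2 + t * y.2).

Definition bounded2 (O : set (R * R)) : Prop :=
  exists M : R, forall z, O z -> `|z.1| <= M /\ `|z.2| <= M.

Definition bdry2 (O : set (R * R)) : set (R * R) := closure O `\` interior O.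

(* area = two-dimensional Lebesgue measure (of the closure; for a convex set
   the boundary is null, so this is the Lebesgue measure of the set) *)
Definition area2 (O : set (R * R)) : \bar R :=
  (mu \x mu)%E (closure O).

Definition cdisc (c : R * R) (r : R) : set (R * R) :=
  [set z | (z.1 - c.1) ^+ 2 + (z.2 - c.2) ^+ 2 <= r ^+ 2].

Definition W1p_on (p L : R) (d : R -> R) : Prop :=
  exists h : R -> R,
    measurable_fun `[0, L] h /\
    (\int[mu]_(x in `[0%R, L]) ((`|h x| `^ p)%:E) < +oo)%E /\
    forall s, 0 <= s <= L -> d s = d 0 + Rintegral mu `[0, s] h.

Definition W2p_closed_arclength (p L : R) (g1 g2 : R -> R) : Prop :=
  [/\ 0 < L,
      (forall s, g1 (s + L) = g1 s /\ g2 (s + L) = g2 s) /\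
      (forall s, derivable g1 s 1 /\ derivable g2 s 1),
      (forall s, (derive1 g1) s ^+ 2 + (derive1 g2) s ^+ 2 = 1),
      (forall s t, 0 <= s < L -> 0 <= t < L -> (g1 s, g2 s) = (g1 t, g2 t) -> s = t)
    & W1p_on p L (derive1 g1) /\ W1p_on p L (derive1 g2)].

(* signed curvature: t' = kappa n, with t = gamma', n = (-g2', g1') *)
Definition curv (g1 g2 : R -> R) (s : R) : R :=
  (derive1 g1) s * derive1 (derive1 g2) s - (derive1 g2) s * derive1 (derive1 g1) s.

Definition energy (p L : R) (g1 g2 : R -> R) : \bar R :=
  (\int[mu]_(s in `[0%R, L]) ((`|curv g1 g2 s| `^ p)%:E))%E.

Definition admissible (p a : R) (O : set (R * R)) (g1 g2 : R -> R) (L : R) : Prop :=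
  [/\ convex2 O, bounded2 O, area2 O = a%:E,
      bdry2 O = [set (g1 s, g2 s) | s in `[0, L]]
    & W2p_closed_arclength p L g1 g2].

End Defs.

(* Main.v *)
(**
Let psi be the tangent angle, so that d psi = kappa ds, let h be the support
function of the curve as a function of arc length, and let k = h' / kappa. A chord with
parallel tangents at its ends which halves the enclosed area A exists by
continuity; take the midpoint of that chord as origin. On either of the two
arcs, along which psi increases by pi, h takes equal values at the ends, so the
Wirtinger inequality bounds the integral of (h - c)^2 d psi by that of k^2 d psi
for every value c of h. Since the integral of (h^2 - k^2) d psi over an arc is
A, this reads pi c^2 - 2 l c + A <= 0, l being the integral of h d psi.
With A = pi r^2, the values of h / r lie between two reciprocal numbers, and
concavity of ln gives that the integral of ln (h / r) d psi is nonnegative.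

Integrating x^p >= x + (p - 1) (x ln y + x - y) at x = kappa r, y = h / r along
the curve, where the integrals of kappa and h are 2 pi and 2 A, gives
2 pi r as a lower bound for the integral of (kappa r)^p. Equality forces
kappa r = 1 and h = r almost everywhere, hence a circle.

The area enclosed by the parametrization is compared with the Lebesgue measure
of the convex set through the functions whose graphs bound the set above and below; an
inequality is enough, because the disc energy decreases with the area.
*)
From HB Require Import structures.
From mathcomp Require Import all_boot all_order all_algebra.
From mathcomp Require Import all_classical all_reals all_analysis.
From mathcomp Require Import measurable_realfun ring lra.
Require Import Defs.
Import Order.TTheory GRing.Theory Num.Theory.
Import numFieldNormedType.Exports.
Local Open Scope classical_set_scope.
Local Open Scope ring_scope.
Set Implicit Arguments. Unset Strict Implicit. Unset Printing Implicit Defensive.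

(** * Absolutely continuous functions on an interval *)

Section AbsolutelyContinuous.
Variable R : realType.
Notation mu := (@lebesgue_measure R).
Implicit Types (f g F G : R -> R) (a b c s L : R).

(** The curvature is only an L^p function and may vanish on intervals, so the tangent angle is not a
    coordinate on the curve. All functions stay functions of arc length with [kap] as a weight, and
    [k] is the tangential component of the position vector, which needs no division: the densities
    are h' = kap k and k' = 1 - kap h.

    Half turns are what give the Wirtinger constant 1 for every value c of h: gluing the ends of the
    arc, where h agrees, and cutting where h = c gives an interval of angle pi with h - c zero at
    both ends. On a whole turn with a single zero the constant would be 4. Halving the area gives
    both arcs the same constant A, hence roots of h / r with product 1.

    The boundary is only given as a simple closed curve. That it stays on one side of each tangent,
    that its curvature is nonnegative and that it turns by exactly 2 pi is derived from convexity
    and injectivity. *)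

Definition intble L f := mu.-integrable `[0, L] (EFin \o f).
Definition integ f a b : R := \int[mu]_(x in `[a, b]) f x.

Lemma intble_sub L f a b : intble L f -> 0 <= a -> b <= L ->
  mu.-integrable `[a, b] (EFin \o f).
Proof.
move=> fi a0 bL; apply: integrableS fi => //.
by apply: subset_itv; rewrite bnd_simp.
Qed.

Lemma intbleD L f g : intble L f -> intble L g -> intble L (fun x => f x + g x).
Proof. by move=> fi gi; exact: (integrableD _ fi gi). Qed.

Lemma intbleZ L f c : intble L f -> intble L (fun x => c * f x).
Proof. by move=> fi; exact: (@integrableZl _ _ _ mu `[0, L] (measurable_itv _) c _ fi). Qed.

Lemma intbleN L f : intble L f -> intble L (fun x => - f x).
Proof. by move=> fi; exact: (integrableN fi). Qed.

Lemma intbleB L f g : intble L f -> intble L g -> intble L (fun x => f x - g x).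
Proof. by move=> fi gi; apply: intbleD => //; exact: intbleN. Qed.

Lemma intble_norm L f : intble L f -> intble L (fun x => `|f x|).
Proof. exact: integrable_norm. Qed.

Lemma intble_cont L f : {within `[0, L], continuous f} -> intble L f.
Proof. by move=> cf; apply: continuous_compact_integrable => //; exact: segment_compact. Qed.

Lemma intble_cst L c : intble L (fun=> c).
Proof. by apply: intble_cont => x; exact: cvg_cst. Qed.

Lemma intbleM L f g : {within `[0, L], continuous g} -> intble L f ->
  intble L (fun x => g x * f x).
Proof.
move=> cg fi.
apply: (@integrableMr _ _ _ mu `[0, L] _ g (EFin \o f)) => //.
  by apply: subspace_continuous_measurable_fun.
have /compact_bounded := continuous_compact cg (@segment_compact _ 0 L).
move=> [M [Mr MP]]; exists M; split => // x /MP h y /= yL; apply: h; by exists y.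
Qed.

Lemma integ_cat f L a b c : intble L f -> 0 <= a -> a <= b -> b <= c -> c <= L ->
  integ f a c = integ f a b + integ f b c.
Proof.
move=> fi a0 ab bc cL; rewrite /integ.
have h := @Rintegral_itvB R f (BLeft a) (BRight c) b (intble_sub fi a0 cL).
rewrite addrC; apply/eqP; rewrite -subr_eq h ?bnd_simp//.
rewrite Rintegral_itv_obnd_cbnd//.
apply: integrableS (intble_sub fi a0 cL) => //.
by apply: subset_itv; rewrite bnd_simp.
Qed.

Lemma integ_nil f a : integ f a a = 0.
Proof. by rewrite /integ set_itv1 Rintegral_set1. Qed.

Lemma integD L f g a b : intble L f -> intble L g -> 0 <= a -> b <= L ->
  integ (fun x => f x + g x) a b = integ f a b + integ g a b.
Proof. by move=> fi gi a0 bL; rewrite /integ RintegralD//; exact: intble_sub a0 bL. Qed.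

Lemma integB L f g a b : intble L f -> intble L g -> 0 <= a -> b <= L ->
  integ (fun x => f x - g x) a b = integ f a b - integ g a b.
Proof. by move=> fi gi a0 bL; rewrite /integ RintegralB//; exact: intble_sub a0 bL. Qed.

Lemma integZ L f c a b : intble L f -> 0 <= a -> b <= L ->
  integ (fun x => c * f x) a b = c * integ f a b.
Proof. by move=> fi a0 bL; rewrite /integ RintegralZl//; exact: intble_sub a0 bL. Qed.

Lemma integN L f a b : intble L f -> 0 <= a -> b <= L ->
  integ (fun x => - f x) a b = - integ f a b.
Proof.
move=> fi a0 bL; rewrite -mulN1r -(integZ _ fi)//; congr integ.
by apply/funext => x; rewrite mulN1r.
Qed.

Lemma integ_cst a b c : a <= b -> integ (fun=> c) a b = c * (b - a).
Proof.
move=> ab; rewrite /integ Rintegral_cst//= lebesgue_measure_itv/=.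
rewrite lte_fin; case: ltP => //= ba.
by have -> : b = a; rewrite ?subrr//; apply/le_anti; rewrite ab ba.
Qed.

Lemma eq_integ f g a b : (forall x, a <= x <= b -> f x = g x) -> integ f a b = integ g a b.
Proof. by move=> fg; apply: eq_Rintegral => x; rewrite inE/= in_itv/=; exact: fg. Qed.

Lemma le_integ L f g a b : intble L f -> intble L g -> 0 <= a -> b <= L ->
  (forall x, a <= x <= b -> f x <= g x) -> integ f a b <= integ g a b.
Proof.
move=> fi gi a0 bL fg.
exact: (le_Rintegral _ (intble_sub fi a0 bL) (intble_sub gi a0 bL)).
Qed.

Lemma integ_ge0 f a b : (forall x, a <= x <= b -> 0 <= f x) -> 0 <= integ f a b.
Proof. by move=> f0; apply: Rintegral_ge0 => x; rewrite /= in_itv/=; exact: f0. Qed.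

Lemma le_norm_integ L f a b : intble L f -> 0 <= a -> b <= L ->
  `|integ f a b| <= integ (fun x => `|f x|) a b.
Proof. by move=> fi a0 bL; apply: le_normr_Rintegral => //; exact: intble_sub a0 bL. Qed.

Lemma ae_imply (P Q : R -> Prop) : (forall x, P x -> Q x) ->
  {ae mu, forall x, P x} -> {ae mu, forall x, Q x}.
Proof. by move=> PQ; apply: filterS; first exact: (ae_filter_ringOfSetsType mu). Qed.

Lemma ae_and (P Q : R -> Prop) : {ae mu, forall x, P x} -> {ae mu, forall x, Q x} ->
  {ae mu, forall x, P x /\ Q x}.
Proof. by apply: filterI; first exact: (ae_filter_ringOfSetsType mu). Qed.

(** The end points are left out because [abs_cont_derive] gives derivatives at interior points
    only. *)
Definition ae_on L (P : R -> Prop) := {ae mu, forall x, 0 < x < L -> P x}.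

Lemma ae_on_itv L (P : R -> Prop) : ae_on L P -> {ae mu, forall x, 0 <= x <= L -> P x}.
Proof.
move=> h.
have h0 (c : R) : {ae mu, forall x, x <> c}.
  exists [set c]; split => //; first exact: lebesgue_measure_set1.
  by move=> x /= /contrapT.
apply: ae_imply (ae_and h (ae_and (h0 0) (h0 L))) => x [h1 [x0 xL]] /andP[xx yy].
by apply: h1; rewrite !lt_neqAle xx yy !andbT; apply/andP; split; apply/eqP => // h2; apply: x0.
Qed.

Lemma ae_eq_integ L f g a b : intble L f -> intble L g -> 0 <= a -> b <= L ->
  ae_on L (fun x => f x = g x) -> integ f a b = integ g a b.
Proof.
move=> fi gi a0 bL /ae_on_itv h; rewrite /integ /Rintegral; congr fine.
apply: ae_eq_integral => //.
- by have /measurable_int := intble_sub fi a0 bL.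
- by have /measurable_int := intble_sub gi a0 bL.
- apply: ae_imply h => x h; rewrite /= in_itv/= => /andP[ax xb]; rewrite h//.
  by rewrite (le_trans a0 ax) (le_trans xb bL).
Qed.

(* Cousin's lemma *)
Lemma interval_chain (P : R -> R -> Prop) a b : a <= b ->
  (forall x y z, P x y -> P y z -> P x z) ->
  (forall x, a <= x <= b -> exists2 d, 0 < d & forall y z, a <= y -> z <= b ->
     x - d < y -> y <= x -> x <= z -> z < x + d -> P y z) ->
  P a b.
Proof.
move=> ab Ptr Ploc.
pose A := [set s | a <= s <= b /\ P a s].
have Aa : A a.
  split; first by rewrite lexx ab.
  by have [|d d0] := Ploc a; [rewrite lexx ab | apply; rewrite ?lexx//; lra].
have Aub : ubound A b by move=> s [/andP[]].
have hA : has_sup A by split; [exists a | exists b].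
pose s := sup A.
have as_ : a <= s by apply: ub_le_sup => //; exists b.
have sb : s <= b by apply: ge_sup => //; exists a.
have [|d d0 hd] := Ploc s; first by rewrite as_ sb.
have [s' [/andP[as' s'b] Ps'] ss'] := sup_adherent d0 hA.
have s's : s' <= s by apply: ub_le_sup => //; [exists b|split => //; rewrite as' s'b].
pose z := Num.min b (s + d / 2).
have zb : z <= b by rewrite ge_min lexx.
have sz : s <= z by rewrite le_min sb; lra.
have zd : z < s + d by rewrite gt_min; apply/orP; right; lra.
have Paz : P a z by apply: (Ptr _ s') => //; apply: hd => //.
have zs : z <= s.
  apply: ub_le_sup; first by exists b.
  by split => //; rewrite zb (le_trans as_ sz).
have zE : z = s by apply/le_anti; rewrite zs sz.
move: Paz; suff -> : z = b by [].
by move: zE; rewrite /z minEle; case: ifP => // _; lra.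
Qed.

(** The density is an explicit argument, determined only almost everywhere: the rules below compute
    it, and [abs_cont_ae] exchanges it. Values outside [0, L] do not matter. *)
Definition abs_cont L F f := intble L f /\ forall s, 0 <= s <= L -> F s = F 0 + integ f 0 s.

Lemma abs_cont_intble L F f : abs_cont L F f -> intble L f. Proof. by case. Qed.

Lemma abs_contB L F f a b : abs_cont L F f -> 0 <= a -> a <= b -> b <= L ->
  F b - F a = integ f a b.
Proof.
move=> [fi FE] a0 ab bL; rewrite FE ?(le_trans a0 ab)// (FE a) ?a0 ?(le_trans ab)//.
rewrite (integ_cat fi (lexx 0) a0 ab bL); ring.
Qed.

Lemma abs_cont_continuous L F f : 0 <= L -> abs_cont L F f -> {within `[0, L], continuous F}.
Proof.
move=> L0 [fi FE].
have h := parameterized_integral_continuous L0 fi.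
apply: (@subspace_eq_continuous _ _ _ (fun s => F 0 + integ f 0 s)).
  by move=> s; rewrite inE/= in_itv/= => /FE; rewrite /from_subspace => ->.
by move=> x; apply: continuousD; [exact: cvg_cst | exact: h].
Qed.

Lemma eq_abs_cont L F G f : (forall s, 0 <= s <= L -> F s = G s) -> 0 <= L ->
  abs_cont L F f -> abs_cont L G f.
Proof.
move=> FG L0 [fi FE]; split => // s hs.
by rewrite -!FG ?lexx ?L0// FE.
Qed.

Lemma abs_cont_ae L F f g : intble L g -> ae_on L (fun x => f x = g x) ->
  abs_cont L F f -> abs_cont L F g.
Proof.
move=> gi fg [fi FE]; split => // s hs; rewrite FE//.
by case/andP: hs => *; rewrite (ae_eq_integ fi gi).
Qed.

Lemma abs_contD L F G f g : abs_cont L F f -> abs_cont L G g ->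
  abs_cont L (fun x => F x + G x) (fun x => f x + g x).
Proof.
move=> [fi FE] [gi GE]; split; first exact: intbleD.
by move=> s hs; case/andP: (hs) => *; rewrite FE// GE// (integD fi gi)//; ring.
Qed.

Lemma abs_contZ L F f c : abs_cont L F f -> abs_cont L (fun x => c * F x) (fun x => c * f x).
Proof.
move=> [fi FE]; split; first exact: intbleZ.
by move=> s hs; case/andP: (hs) => *; rewrite FE// (integZ _ fi)//; ring.
Qed.

Lemma abs_contN L F f : abs_cont L F f -> abs_cont L (fun x => - F x) (fun x => - f x).
Proof.
move=> [fi FE]; split; first exact: intbleN.
by move=> s hs; case/andP: (hs) => *; rewrite FE// (integN fi)//; ring.
Qed.

Lemma abs_cont_cst L c : abs_cont L (fun=> c) (fun=> 0).
Proof.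
split; first exact: intble_cst.
by move=> s /andP[s0 _]; rewrite integ_cst// mul0r addr0.
Qed.

(* On a short interval the mean value theorem gives
   [phi (F z) - phi (F y) = phi' (F c) * \int f], and [phi' \o F] is nearly
   constant there; summing over a fine partition gives the chain rule. *)
Lemma abs_cont_comp L F f (phi dphi : R -> R) : 0 <= L -> abs_cont L F f ->
  (forall s, 0 <= s <= L -> is_derive (F s) 1 phi (dphi (F s))) ->
  {within `[0, L], continuous (dphi \o F)} ->
  abs_cont L (phi \o F) (fun s => dphi (F s) * f s).
Proof.
move=> L0 ac dp cd; have [fi FE] := ac.
have cF := abs_cont_continuous L0 ac.
have gi : intble L (fun s => dphi (F s) * f s) by apply: intbleM.
split => // b /andP[b0 bL].
suff small e : 0 < e ->
    `|phi (F b) - phi (F 0) - integ (fun s => dphi (F s) * f s) 0 b| <=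
    e * integ (fun x => `|f x|) 0 b.
  apply/eqP; rewrite addrC -subr_eq -subr_eq0 -normr_le0.
  set V := integ (fun x => `|f x|) 0 b in small; set X := `| _ | in small *.
  have V0 : 0 <= V by apply: integ_ge0.
  apply/ler_addgt0Pr => e e0; rewrite add0r.
  have e1 : 0 < e / (V + 1) by rewrite divr_gt0//; lra.
  apply: (le_trans (small _ e1)).
  rewrite mulrAC ler_pdivrMr; last by lra.
  by rewrite ler_pM2l//; lra.
move=> e0.
pose Q x y := [/\ 0 <= x, x <= y, y <= b &
    `|phi (F y) - phi (F x) - integ (fun s => dphi (F s) * f s) x y| <=
    e * integ (fun x => `|f x|) x y].
suff [] : Q 0 b by [].
apply: interval_chain => //.
  move=> x y z [x0 xy yb h1] [y0 yz zb h2]; split; rewrite ?(le_trans xy)//.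
  have zL := le_trans zb bL.
  rewrite (integ_cat gi x0 xy yz zL) (integ_cat (intble_norm fi) x0 xy yz zL) mulrDr.
  apply: le_trans (lerD h1 h2); apply: le_trans (ler_normD _ _).
  by rewrite le_eqVlt; apply/orP; left; apply/eqP; congr (`| _ |); ring.
move=> x /andP[x0 xb].
have xL : x \in `[0, L] by rewrite in_itv/= x0 (le_trans xb bL).
have [d d0 hd] : exists2 d, 0 < d & forall y, 0 <= y <= L -> `|x - y| < d ->
    `|dphi (F x) - dphi (F y)| < e / 2.
  move/subspace_continuousP : cd => /(_ x); rewrite /= xL => /(_ isT).
  move=> /cvgrPdist_lt /(_ (e / 2)) []; first by rewrite divr_gt0.
  by move=> d /= d0 hd; exists d => // y yL xy; apply: hd => //=; rewrite in_itv/= yL.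
exists d => // y z y0 zb xy yx xz zd.
have yz := le_trans yx xz.
have zL := le_trans zb bL.
split => //.
(* The mean value theorem for [phi] between [F y] and [F z] gives an intermediate value, which the
   intermediate value theorem for [F] pulls back to a parameter [c]; [F] itself need not be
   differentiable. *)
have [c [/andP[yc cz] cE]] : exists c, y <= c <= z /\
    phi (F z) - phi (F y) = dphi (F c) * (F z - F y).
  have cyz : {within `[y, z], continuous F}.
    apply: continuous_subspaceW cF; apply: subset_itv; rewrite bnd_simp//.
  have ivt v : Num.min (F y) (F z) <= v <= Num.max (F y) (F z) ->
      exists2 c, y <= c <= z & F c = v.
    by move=> /(IVT yz cyz)[c]; rewrite in_itv/= => ? ?; exists c.
  have dv v : Num.min (F y) (F z) <= v <= Num.max (F y) (F z) ->
      is_derive v 1 phi (dphi v).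
    move=> /ivt[c /andP[yc cz] <-]; apply: dp.
    by rewrite (le_trans y0 yc) (le_trans cz zL).
  have [Fyz|Fzy|Fyz] := ltgtP (F y) (F z).
  - have [||v] := @MVT _ phi dphi _ _ Fyz.
    + move=> v; rewrite in_itv/= => /andP[v1 v2]; apply: dv.
      by rewrite ge_min le_max (ltW v1) (ltW v2) orbT.
    + apply: derivable_within_continuous => v; rewrite in_itv/= => /andP[v1 v2].
      by have [] : is_derive v 1 phi (dphi v); first by apply: dv; rewrite ge_min le_max v1 v2 orbT.
    rewrite in_itv/= => /andP[v1 v2] vE.
    have [|c hc cv] := ivt v; first by rewrite ge_min le_max (ltW v1) (ltW v2) orbT.
    by exists c; split => //; rewrite vE cv.
  - have [||v] := @MVT _ phi dphi _ _ Fzy.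
    + move=> v; rewrite in_itv/= => /andP[v1 v2]; apply: dv.
      by rewrite ge_min le_max (ltW v1) (ltW v2) orbT.
    + apply: derivable_within_continuous => v; rewrite in_itv/= => /andP[v1 v2].
      by have [] : is_derive v 1 phi (dphi v); first by apply: dv; rewrite ge_min le_max v1 v2 orbT.
    rewrite in_itv/= => /andP[v1 v2] vE.
    have [|c hc cv] := ivt v; first by rewrite ge_min le_max (ltW v1) (ltW v2) orbT.
    exists c; split => //; rewrite cv -(opprB (F y)) -(opprB (phi (F y))) vE; ring.
  - exists y; rewrite lexx yz; split => //; rewrite Fyz; ring.
have close s : y <= s <= z -> `|dphi (F x) - dphi (F s)| < e / 2.
  move=> /andP[ys sz]; apply: hd; first by rewrite (le_trans y0 ys) (le_trans sz zL).
  by rewrite ltr_norml; lra.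
rewrite cE (abs_contB ac y0 yz zL) -(integZ _ fi y0 zL) -(integB (intbleZ _ fi) gi y0 zL).
have di : intble L (fun s => dphi (F c) * f s - dphi (F s) * f s).
  by apply: intbleB => //; exact: intbleZ.
apply: (le_trans (le_norm_integ di y0 zL)).
rewrite -(integZ _ (intble_norm fi) y0 zL).
apply: (le_integ (intble_norm di) (intbleZ _ (intble_norm fi)) y0 zL) => s hs.
rewrite -mulrBl normrM ler_wpM2r//.
have h1 := close s hs; have h2 := close c; rewrite yc cz in h2.
have -> : dphi (F c) - dphi (F s) = (dphi (F x) - dphi (F s)) - (dphi (F x) - dphi (F c)) by ring.
apply: le_trans (ler_normB _ _) _; have := h2 isT; lra.
Qed.

Lemma abs_cont_sqr L F f : 0 <= L -> abs_cont L F f ->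
  abs_cont L (fun x => F x ^+ 2) (fun x => 2 * F x * f x).
Proof.
move=> L0 ac.
apply: (@abs_cont_comp L F f (fun x => x ^+ 2) (fun x => 2 * x)) => //.
- move=> s _; apply: is_derive_eq.
  by rewrite /GRing.scale/=; ring.
- by move=> x; apply: (@continuousM _ (subspace `[0, L]) (fun=> 2) F); [exact: cvg_cst | exact: (abs_cont_continuous L0 ac)].
Qed.

(** Polarization: F G is half of (F + G) ^ 2 - F ^ 2 - G ^ 2, so the product rule reduces to the
    chain rule for the square. *)
Lemma abs_contM L F G f g : 0 <= L -> abs_cont L F f -> abs_cont L G g ->
  abs_cont L (fun x => F x * G x) (fun x => f x * G x + F x * g x).
Proof.
move=> L0 aF aG.
have h := abs_contZ (2^-1) (abs_contD (abs_cont_sqr L0 (abs_contD aF aG))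
   (abs_contN (abs_contD (abs_cont_sqr L0 aF) (abs_cont_sqr L0 aG)))).
have -> : (fun x => f x * G x + F x * g x) = (fun x => 2^-1 *
  (2 * (F x + G x) * (f x + g x) + - (2 * F x * f x + 2 * G x * g x))).
  by apply/funext => x; field.
by apply: eq_abs_cont h => // s _; field.
Qed.

Lemma abs_cont_C1 L F f : 0 <= L -> (forall x : R, is_derive x 1 F (f x)) ->
  {within `[0, L], continuous f} -> abs_cont L F f.
Proof.
move=> L0 dF cf.
have aid : abs_cont L (fun x => x) (fun=> 1).
  split; first exact: intble_cst.
  by move=> s /andP[s0 _]; rewrite integ_cst//; ring.
have := @abs_cont_comp L _ _ F f L0 aid (fun s _ => dF s) cf.
by under [X in abs_cont _ _ X]eq_fun do rewrite mulr1.
Qed.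

(** Lebesgue differentiation for the density extended by zero, whose primitive agrees with [F - F 0]
    near every interior point. *)
Lemma abs_cont_derive L F f : abs_cont L F f -> ae_on L (fun s => is_derive s 1 F (f s)).
Proof.
move=> [fi FE].
pose f0 := f \_ `[0, L].
have fiT : mu.-integrable setT (EFin \o f0).
  rewrite /f0 -restrict_EFin; apply/(integrable_restrict _ _ _ _).1 => //.
  by rewrite setTI.
have fy (y : R) : mu.-integrable [set` Interval (BLeft 0) (BRight y)] (EFin \o f0).
  exact: integrableS fiT.
have loc : locally_integrable [set: R] f0 by apply: open_integrable_locally => //; exact: openT.
apply: ae_imply (FTC1 fy loc) => s h /andP[s0 sL].
have [|d1 d2] := h; first by rewrite lte_fin.
have fsE : f0 s = f s by rewrite /f0 patchE mem_set//= in_itv/= !ltW.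
rewrite -fsE.
set G := (fun x => _) in d1 d2.
have dG : is_derive s 1 G (f0 s) by split; [exact: d1|rewrite -derive1E; exact: d2].
have dG' : is_derive s 1 (fun x => F 0 + G x) (f0 s) by rewrite -[f0 s]add0r; exact: is_deriveD.
apply: near_eq_is_derive dG'.
near=> x.
have x0L : 0 < x < L by near: x; apply: near_in_itvoo; rewrite in_itv/= s0 sL.
rewrite (FE x); last by case/andP: x0L => x0 xL; rewrite (ltW x0) (ltW xL).
congr (_ + _); apply: eq_Rintegral => y; rewrite inE/= in_itv/= => /andP[y0 yx].
by rewrite /f0 patchE mem_set//= in_itv/= y0; case/andP: x0L => ? /ltW /(le_trans yx).
Unshelve. all: by end_near. Qed.

End AbsolutelyContinuous.

(** * Wirtinger inequality on half turns *)

Section Wirtinger.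
Variable R : realType.
Implicit Types (f g F G : R -> R) (a b c s L : R).

Definition clamp a b s : R := Num.max a (Num.min s b).

Lemma clamp_id a b s : a <= s <= b -> clamp a b s = s.
Proof. by rewrite /clamp => /andP[h1 h2]; rewrite (min_idPl h2) (max_idPr h1). Qed.

Lemma clamp_itv a b s : a <= b -> a <= clamp a b s <= b.
Proof. by move=> ab; rewrite /clamp le_max lexx ge_max ab ge_min lexx orbT. Qed.

(** The chain rule is stated on all of [0, L], while [riccati l] is regular only at the angles met
    on one piece; freezing the angle outside the piece reconciles the two. *)
Lemma abs_cont_clamp L F f a b : 0 <= a -> a <= b -> b <= L -> abs_cont L F f ->
  abs_cont L (F \o clamp a b) (f \_ `[a, b]).
Proof.
move=> a0 ab bL ac; have [fi FE] := ac; split.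
  rewrite /intble -restrict_EFin; apply/(integrable_restrict _ _ _ _).1 => //.
  apply: integrableS (intble_sub fi a0 bL) => //; exact: measurableI.
move=> s /andP[s0 sL] /=.
have -> : clamp a b 0 = a.
  by rewrite /clamp; apply/max_idPl; rewrite ge_min a0.
have -> : integ (f \_ `[a, b]) 0 s = integ f a (Num.min s b).
  rewrite /integ -Rintegral_mkcondr; congr Rintegral.
  apply/seteqP; split => x /=; rewrite !in_itv/= le_min.
    by move=> [/andP[_ ->] /andP[-> ->]].
  by move=> /and3P[ax xs xb]; rewrite xs ax xb (le_trans a0 ax).
have [as_|sa] := leP a (Num.min s b).
  rewrite /clamp (max_idPr as_) -(abs_contB ac a0 as_) ?subrKC//.
  by rewrite ge_min sL.
rewrite /clamp (max_idPl (ltW sa)) /integ set_itv_ge ?Rintegral_set0 ?addr0//.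
by rewrite bnd_simp -ltNge.
Qed.

(** The logarithmic derivative of v = cos (l (x - pi / 2)), a solution of v'' = - l ^ 2 v; hence the
    Riccati equation w' = - (l ^ 2 + w ^ 2). For 0 < l < 1 the function v has no zero on [0, pi]. *)
Definition riccati (l : R) (x : R) : R := - l * tan (l * (x - pi / 2)).

Lemma riccati_cos (l x : R) : 0 < l < 1 -> 0 <= x <= pi -> 0 < cos (l * (x - pi / 2)).
Proof.
move=> /andP[l0 l1] /andP[x0 xpi]; apply: cos_gt0_pihalf.
have p0 : 0 < pi / 2 :> R by rewrite divr_gt0// pi_gt0.
have {}xpi : x - pi / 2 <= pi / 2 by rewrite lerBlDr -splitr.
have {}x0 : - (pi / 2) <= x - pi / 2 by lra.
move: (x - pi / 2) (pi / 2) x0 xpi p0 => v q v0 vq q0.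
by apply/andP; split; nra.
Qed.

Lemma is_derive_riccati (l x : R) : 0 < l < 1 -> 0 <= x <= pi ->
  is_derive x 1 (riccati l) (- (l ^+ 2 + riccati l x ^+ 2)).
Proof.
move=> hl hx; have c0 := riccati_cos hl hx.
have dt := is_derive_tan (lt0r_neq0 c0).
have da : is_derive x 1 (fun x : R => l * (x - pi / 2)) l.
  by apply: is_derive_eq; rewrite /GRing.scale/=; ring.
have dc := is_derive1_comp (f := tan) (g := fun x : R => l * (x - pi / 2)).
have := is_deriveZ (- l) (dc _ _ _ dt da).
rewrite /GRing.scale/= cos2_tan2 ?lt0r_neq0//.
rewrite /riccati; set t := tan _.
have -> : - (l ^+ 2 + (- l * t) ^+ 2) = - l * ((1 + t ^+ 2) * l) by ring.
by [].
Qed.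

Definition turn (kap : R -> R) (s : R) : R := integ kap 0 s.

Variables (L : R) (kap h k : R -> R).
Hypothesis L0 : 0 <= L.
Hypothesis kap0 : forall s, 0 <= kap s.
Hypothesis kapi : intble L kap.
Hypothesis hE : abs_cont L h (fun s => kap s * k s).
Hypothesis kE : abs_cont L k (fun s => 1 - kap s * h s).
Local Notation psi := (turn kap).

Lemma abs_cont_turn : abs_cont L psi kap.
Proof. by split => // s _; rewrite /turn integ_nil add0r. Qed.

Lemma turn_le a b : 0 <= a -> a <= b -> b <= L -> psi a <= psi b.
Proof.
move=> a0 ab bL; rewrite -subr_ge0 (abs_contB abs_cont_turn)//.
exact: integ_ge0.
Qed.

(* Completing the square: with [w] the Riccati function along the arc and
   [u = h - c], the integrand exceeds the derivative of [u ^+ 2 * w] by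
   [(k - u * w) ^+ 2 * kap]. Taking [l < 1] keeps [w] finite at the ends. *)
Lemma wirtinger_piece a b c phi l : 0 <= a -> a <= b -> b <= L -> 0 < l < 1 ->
  0 <= psi a + phi -> psi b + phi <= pi ->
  (h b - c) ^+ 2 * riccati l (psi b + phi) - (h a - c) ^+ 2 * riccati l (psi a + phi)
  <= integ (fun s => (k s ^+ 2 - l ^+ 2 * (h s - c) ^+ 2) * kap s) a b.
Proof.
move=> a0 ab bL hl ha hb.
have rng s : 0 <= psi (clamp a b s) + phi <= pi.
  have /andP[h1 h2] := clamp_itv s ab.
  rewrite (le_trans ha) ?lerD2r ?turn_le//=; last exact: le_trans h2 bL.
  by rewrite (le_trans _ hb)// lerD2r turn_le// (le_trans a0).
pose P s := psi (clamp a b s) + phi.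
have aP : abs_cont L P (fun s => (kap \_ `[a, b]) s + 0).
  by apply: abs_contD; [exact: (abs_cont_clamp a0 ab bL abs_cont_turn)|exact: abs_cont_cst].
pose dw := fun x => - (l ^+ 2 + riccati l x ^+ 2).
have cP := abs_cont_continuous L0 aP.
have aw : abs_cont L (riccati l \o P) (fun s => dw (P s) * ((kap \_ `[a, b]) s + 0)).
  apply: (@abs_cont_comp _ L P _ (riccati l) dw L0 aP).
    by move=> s _; exact: is_derive_riccati (rng s).
  move=> s; apply: (@continuous_comp (subspace `[0, L]) _ _ P dw); first exact: cP.
  have cr : {for P s, continuous (riccati l)}.
    apply: differentiable_continuous; apply/derivable1_diffP.
    by have [] := is_derive_riccati hl (rng s).
  apply: continuousN; apply: continuousD; first exact: cvg_cst.
  by apply: continuousM.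
have aU : abs_cont L (fun s => (h s - c) ^+ 2) (fun s => 2 * (h s - c) * (kap s * k s + - 0)).
  by apply: abs_cont_sqr => //; apply: abs_contD => //; apply: abs_contN; exact: abs_cont_cst.
have := abs_contB (abs_contM L0 aU aw) a0 ab bL.
rewrite /= /P !clamp_id ?lexx ?ab// => ->.
have iz : intble L (fun s => (k s ^+ 2 - l ^+ 2 * (h s - c) ^+ 2) * kap s).
  apply: intbleM => //.
  have ck := abs_cont_continuous L0 (abs_cont_sqr L0 kE).
  have cu := abs_cont_continuous L0 (abs_contZ (l ^+ 2) aU).
  by move=> s; apply: (@continuousB _ _ (subspace `[0, L]) (fun s => k s ^+ 2)); [exact: ck | exact: cu].
apply: (le_integ (abs_cont_intble (abs_contM L0 aU aw)) iz a0 bL) => s sab.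
rewrite /P /= clamp_id// patchE mem_set/= ?in_itv//= /dw.
set w := riccati _ _; set u := h s - c.
rewrite -subr_ge0.
have -> : (k s ^+ 2 - l ^+ 2 * u ^+ 2) * kap s -
   (2 * u * (kap s * k s - 0) * w + u ^+ 2 * (- (l ^+ 2 + w ^+ 2) * (kap s + 0))) =
   (k s - u * w) ^+ 2 * kap s by ring.
by rewrite mulr_ge0 ?sqr_ge0.
Qed.

End Wirtinger.

(** * Gluing the ends of a half turn *)

Section Arcs.
Variable R : realType.
Implicit Types (a b c s t x l m : R) (F G : R -> R).
Variables (L : R) (kap h k : R -> R).
Hypothesis L0 : 0 <= L.
Hypothesis kap0 : forall s, 0 <= kap s.
Hypothesis kapi : intble L kap.
Hypothesis hE : abs_cont L h (fun s => kap s * k s).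
Hypothesis kE : abs_cont L k (fun s => 1 - kap s * h s).
Local Notation psi := (turn kap).
Let bonn (l c : R) := fun s : R => (k s ^+ 2 - l ^+ 2 * (h s - c) ^+ 2) * kap s.

Let cont_sub F G : {within `[0, L], continuous F} -> {within `[0, L], continuous G} ->
  {within `[0, L], continuous (fun s : R => F s - G s)}.
Proof. by move=> cF cG s; apply: (@continuousB _ _ (subspace `[0, L]) F G); [exact: cF|exact: cG]. Qed.

Let ch := abs_cont_continuous L0 hE.

Let ck2 := abs_cont_continuous L0 (abs_cont_sqr L0 kE).

Let ibonn l c : intble L (bonn l c).
Proof.
apply: intbleM => //; apply: cont_sub => //.
exact: (abs_cont_continuous L0 (abs_contZ (l ^+ 2) (abs_cont_sqr L0 (abs_contD hE (abs_contN (abs_cont_cst L c)))))).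
Qed.

Let psi_le a b : 0 <= a -> a <= b -> b <= L -> psi a <= psi b.
Proof. exact: turn_le. Qed.

(** With [x] as phase origin and the ends [s], [t] glued, the arc becomes one interval of phases
    from 0 to pi that starts and ends at [x]. The boundary terms vanish at [x], where h equals the
    constant [h x], and cancel at the seam, since h s = h t and the phases psi s + pi - psi x and
    psi t - psi x coincide. *)
Lemma half_arc_inner s t x l : 0 <= s -> t <= L -> s <= x <= t -> 0 < l < 1 ->
  psi t = psi s + pi -> h s = h t -> 0 <= integ (bonn l (h x)) s t.
Proof.
move=> s0 tL /andP[sx xt] hl pst hst.
rewrite (integ_cat (ibonn l (h x)) s0 sx xt tL).
have x0 := le_trans s0 sx; have xL := le_trans xt tL.
have m1 := psi_le s0 sx xL; have m2 := psi_le x0 xt tL.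
have h1 := @wirtinger_piece R L kap h k L0 kap0 kapi hE kE s x (h x) (pi - psi x) l s0 sx xL hl ltac:(lra) ltac:(lra).
have h2 := @wirtinger_piece R L kap h k L0 kap0 kapi hE kE x t (h x) (- psi x) l x0 xt tL hl ltac:(lra) ltac:(lra).
apply: (le_trans _ (lerD h1 h2)).
have -> : psi t + - psi x = psi s + (pi - psi x) by rewrite pst; ring.
rewrite hst; set w := riccati _ _; set w' := riccati _ _; set w'' := riccati _ _.
by rewrite le_eqVlt; apply/orP; left; apply/eqP; ring.
Qed.

(** The same gluing for the arc through the base point of the parametrization: there is a second
    seam, at L and 0, and so three pieces. The shifts of psi are chosen so that the phase runs
    continuously from 0 to pi along the pieces, from [x] back to [x]. *)
Lemma half_arc_outer s t x l : 0 <= s -> s <= t -> t <= L ->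
  (0 <= x <= s \/ t <= x <= L) -> 0 < l < 1 ->
  psi t = psi s + pi -> psi L = pi + pi -> h s = h t -> h 0 = h L ->
  0 <= integ (bonn l (h x)) 0 s + integ (bonn l (h x)) t L.
Proof.
move=> s0 st tL hx hl pst pL hst h0L.
have p0 : psi 0 = 0 by rewrite /turn integ_nil.
have sL := le_trans st tL; have t0 := le_trans s0 st.
case: hx => /andP[x1 x2].
- have xL := le_trans x2 sL.
  rewrite (integ_cat (ibonn l (h x)) (lexx 0) x1 x2 sL).
  have m1 := psi_le x1 x2 sL; have m2 := psi_le (lexx 0) x1 xL.
  have m3 := psi_le t0 tL (lexx L).
  have h1 := @wirtinger_piece R L kap h k L0 kap0 kapi hE kE _ _ (h x) (- psi x) l x1 x2 sL hl ltac:(lra) ltac:(lra).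
  have h2 := @wirtinger_piece R L kap h k L0 kap0 kapi hE kE _ _ (h x) (- pi - psi x) l t0 tL (lexx L) hl ltac:(lra) ltac:(lra).
  have h3 := @wirtinger_piece R L kap h k L0 kap0 kapi hE kE _ _ (h x) (pi - psi x) l (lexx 0) x1 xL hl ltac:(lra) ltac:(lra).
  apply: (le_trans _ (lerD (lerD h3 h1) h2)).
  have -> : psi t + (- pi - psi x) = psi s + - psi x by rewrite pst; ring.
  have -> : psi L + (- pi - psi x) = psi 0 + (pi - psi x) by rewrite p0 pL; ring.
  rewrite hst h0L.
  set w := riccati _ _; set w' := riccati _ _; set w'' := riccati _ _; set w3 := riccati _ _.
  by rewrite le_eqVlt; apply/orP; left; apply/eqP; ring.
- have x0 := le_trans t0 x1.
  rewrite (integ_cat (ibonn l (h x)) t0 x1 x2 (lexx L)).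
  have m1 := psi_le t0 x1 x2; have m2 := psi_le x0 x2 (lexx L).
  have m3 := psi_le (lexx 0) s0 sL.
  have h1 := @wirtinger_piece R L kap h k L0 kap0 kapi hE kE _ _ (h x) (- psi x) l x0 x2 (lexx L) hl ltac:(lra) ltac:(lra).
  have h2 := @wirtinger_piece R L kap h k L0 kap0 kapi hE kE _ _ (h x) (pi + pi - psi x) l (lexx 0) s0 sL hl ltac:(lra) ltac:(lra).
  have h3 := @wirtinger_piece R L kap h k L0 kap0 kapi hE kE _ _ (h x) (pi - psi x) l t0 x1 x2 hl ltac:(lra) ltac:(lra).
  apply: (le_trans _ (lerD h2 (lerD h3 h1))).
  have -> : psi t + (pi - psi x) = psi s + (pi + pi - psi x) by rewrite pst; ring.
  have -> : psi L + - psi x = psi 0 + (pi + pi - psi x) by rewrite p0 pL; ring.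
  rewrite hst h0L.
  set w := riccati _ _; set w' := riccati _ _; set w'' := riccati _ _; set w3 := riccati _ _.
  by rewrite le_eqVlt; apply/orP; left; apply/eqP; ring.
Qed.

(** For m > 1 the condition puts y between the roots m - q and m + q, which are reciprocal. The
    chord of ln between T and 1 / T has opposite end values, hence vanishes at the midpoint m and
    has slope [ln T / q]; concavity puts ln above it. For m <= 1 no y other than 1 is possible. *)
Lemma ln_chord (m : R) : exists al : R, forall y, 0 < y -> y ^+ 2 - 2 * m * y + 1 <= 0 ->
  al * (y - m) <= ln y.
Proof.
have [m1|m1] := leP m 1.
  exists 0 => y y0 hy; rewrite mul0r ln_ge0//.
  have : (y - 1) ^+ 2 <= 0 by nra.
  rewrite -subr_ge0; set v := y - 1 => v2.
  have /eqP : v ^+ 2 = 0 by apply/le_anti; rewrite v2 sqr_ge0.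
  by rewrite sqrf_eq0 => /eqP ->.
pose q := Num.sqrt (m ^+ 2 - 1).
have q2 : q ^+ 2 = m ^+ 2 - 1 by rewrite sqr_sqrtr//; nra.
have q0 : 0 < q by rewrite sqrtr_gt0; nra.
pose T := m + q.
have T1 : 1 < T by rewrite /T; lra.
have Tm : T * (m - q) = 1 by rewrite /T; nra.
have TV : T^-1 = m - q by apply: (mulfI (lt0r_neq0 (lt_trans ltr01 T1))); rewrite divff ?Tm//; lra.
exists (ln T / q) => y y0 hy.
have yq : (y - m) ^+ 2 <= q ^+ 2 by rewrite q2; nra.
have [y1 y2] : m - q <= y /\ y <= m + q.
  by move: yq; rewrite -[X in X <= _]real_normK ?num_real// ler_pXn2r ?nnegrE ?(ltW q0)// ler_norml; lra.
have mq0 : 0 < m - q by rewrite -TV invr_gt0; lra.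
pose t := (y - (m - q)) / (2 * q).
have t0 : 0 <= t by rewrite divr_ge0//; lra.
have t1 : t <= 1 by rewrite ler_pdivrMr; lra.
have := @concave_ln R (Itv01 t0 t1) T (m - q) (lt_trans ltr01 T1) mq0.
rewrite !convRE/= /unstable.onem.
have -> : t * T + (1 - t) * (m - q) = y by rewrite /t /T; field; lra.
rewrite -TV lnV ?posrE; last by lra.
have -> : t * ln T + (1 - t) * - ln T = ln T / q * (y - m) by rewrite /t; field; lra.
by [].
Qed.

End Arcs.

(** * Range and logarithmic mean of the support function on a half turn *)

Section ArcKey.
Variable R : realType.
Implicit Types (s t x l m : R) (f g F G : R -> R).
Variables (L : R) (kap h k : R -> R).
Hypothesis L0 : 0 <= L.
Hypothesis kap0 : forall s, 0 <= kap s.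
Hypothesis kapi : intble L kap.
Hypothesis hE : abs_cont L h (fun s => kap s * k s).
Hypothesis kE : abs_cont L k (fun s => 1 - kap s * h s).
Variables a b c d : R.
Hypotheses (a0 : 0 <= a) (ab : a <= b) (bc : b <= c) (cd : c <= d) (dL : d <= L).

(** A half turn through the base point of the parametrization occupies two parameter intervals,
    [0, s] and [t, L]. The other half turn fits the same pattern with a degenerate first interval
    [s, s]. *)
Let J f := integ f a b + integ f c d.
Let arc x := a <= x <= b \/ c <= x <= d.
Let bL : b <= L. Proof. exact: le_trans (le_trans bc cd) dL. Qed.
Let c0 : 0 <= c. Proof. exact: le_trans (le_trans a0 ab) bc. Qed.

Let JD f g : intble L f -> intble L g -> J (fun s => f s + g s) = J f + J g.
Proof. by move=> fi gi; rewrite /J !(integD fi gi)//; ring. Qed.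

Let JZ (r : R) f : intble L f -> J (fun s => r * f s) = r * J f.
Proof. by move=> fi; rewrite /J !(integZ _ fi)//; ring. Qed.

Let leJ f g : intble L f -> intble L g -> (forall x, arc x -> f x <= g x) -> J f <= J g.
Proof.
move=> fi gi fg; rewrite /J; apply: lerD; apply: (le_integ fi gi) => // x hx; apply: fg;
  [by left | by right].
Qed.

Let ih : intble L (fun s => h s * kap s).
Proof. by apply: intbleM => //; exact: abs_cont_continuous L0 hE. Qed.

Let ih2 : intble L (fun s => h s ^+ 2 * kap s).
Proof. by apply: intbleM => //; exact: abs_cont_continuous L0 (abs_cont_sqr L0 hE). Qed.

Let ik2 : intble L (fun s => k s ^+ 2 * kap s).
Proof. by apply: intbleM => //; exact: abs_cont_continuous L0 (abs_cont_sqr L0 kE). Qed.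

Variable A : R.
Hypothesis A0 : 0 < A.
Hypothesis Jkap : J kap = pi.
Hypothesis JA : J (fun s => h s ^+ 2 * kap s) - J (fun s => k s ^+ 2 * kap s) = A.
Hypothesis h0 : forall x, arc x -> 0 <= h x.
Hypothesis Jw : forall x l, arc x -> 0 < l < 1 ->
  0 <= J (fun s => (k s ^+ 2 - l ^+ 2 * (h s - h x) ^+ 2) * kap s).

Let lam := J (fun s => h s * kap s).

(* For [l] close to 1, [Jw] reads [J ((h - h x) ^+ 2 * kap) <= J (k ^+ 2 * kap)];
   expanding the square and using [JA] gives the inequality. *)
Lemma arc_quadratic x : arc x -> pi * h x ^+ 2 - 2 * lam * h x + A <= 0.
Proof.
move=> hx; set e := h x.
pose K := J (fun s => k s ^+ 2 * kap s).
pose H := J (fun s => h s ^+ 2 * kap s).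
pose Q := H + (- 2 * e) * lam + e ^+ 2 * pi.
have K0 : 0 <= K by rewrite addr_ge0// integ_ge0// => s _; rewrite mulr_ge0 ?sqr_ge0.
have lQ l : 0 < l < 1 -> l ^+ 2 * Q <= K.
  move=> hl; have := Jw hx hl.
  have -> : (fun s => (k s ^+ 2 - l ^+ 2 * (h s - h x) ^+ 2) * kap s) =
    (fun s => k s ^+ 2 * kap s + (- l ^+ 2) * (h s ^+ 2 * kap s +
      ((- 2 * e) * (h s * kap s) + e ^+ 2 * kap s))).
    by apply/funext => s; rewrite /e; ring.
  have i1 : intble L (fun s => (- 2 * e) * (h s * kap s)) by exact: intbleZ.
  have i2 : intble L (fun s => e ^+ 2 * kap s) by exact: intbleZ.
  have i3 := intbleD i1 i2; have i4 := intbleD ih2 i3.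
  have i5 := intbleZ (- l ^+ 2) i4.
  rewrite (JD ik2 i5) (JZ _ i4) (JD ih2 i3) (JD i1 i2) (JZ _ ih) (JZ _ kapi).
  rewrite Jkap -/lam -/K -/H /Q; set v := l ^+ 2; lra.
have QK : Q <= K.
  rewrite leNgt; apply/negP => KQ.
  have Q0 : 0 < Q by exact: le_lt_trans KQ.
  pose rho := K / Q.
  have KE : K = rho * Q by rewrite /rho mulfVK ?lt0r_neq0.
  have r0 : 0 <= rho by rewrite divr_ge0// ltW.
  have r1 : rho < 1 by rewrite ltr_pdivrMr ?mul1r.
  (* The square of (1 + rho) / 2 exceeds rho by the square of (1 - rho) / 2, so this l contradicts
     [lQ]. *)
  have hl : 0 < (1 + rho) / 2 < 1 by lra.
  have := lQ _ hl; rewrite KE ler_pM2r//; nra.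
move: JA; rewrite -/K -/H => AE.
by move: QK; rewrite /Q; lra.
Qed.

(** At a zero of h the quadratic inequality would read A <= 0. Positivity is what makes ln (h / r)
    meaningful. *)
Lemma arc_pos x : arc x -> 0 < h x.
Proof.
move=> hx; rewrite lt_neqAle h0// andbT; apply/eqP => hE0.
by have := arc_quadratic hx; rewrite -hE0 expr0n/= !mulr0 => h1; have A1 := A0; lra.
Qed.

Lemma continuous_ln_on f : {within `[0, L], continuous f} ->
  (forall x, 0 <= x <= L -> 0 < f x) -> {within `[0, L], continuous (@ln R \o f)}.
Proof.
move=> /subspace_continuousP cf f0; apply/subspace_continuousP => x xL.
have fx : 0 < f x by apply: f0; move: xL; rewrite /= in_itv.
apply: (cvg_comp _ _ (cf x xL)).
exact: continuous_ln.
Qed.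

(* By [arc_quadratic] the values of [h / r] lie between the roots of
   [y ^+ 2 - 2 * m * y + 1], whose product is 1; [ln] lies above its chord
   there, and the chord has mean zero for [kap]. *)
Lemma arc_entropy (r : R) : 0 < r -> pi * r ^+ 2 = A ->
  (forall x, 0 <= x <= L -> 0 < h x) ->
  0 <= J (fun s => ln (h s / r) * kap s).
Proof.
move=> r0 rA hpos.
have p0 := pi_gt0 R.
pose m := lam / (pi * r).
have [al alP] := ln_chord m.
have iln : intble L (fun s => ln (h s / r) * kap s).
  apply: (intbleM _ kapi); apply: (@continuous_ln_on (fun s => h s / r)).
    have -> : (fun s => h s / r) = (fun s => r^-1 * h s) by apply/funext => s; rewrite mulrC.
    exact: (abs_cont_continuous L0 (abs_contZ r^-1 hE)).
  by move=> x hx; rewrite divr_gt0// hpos.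
have i1 := intbleZ (al / r) ih; have i2 := intbleZ (- al * m) kapi.
have -> : 0 = J (fun s => al / r * (h s * kap s) + (- al * m) * kap s) :> R.
  rewrite (JD i1 i2) (JZ _ ih) (JZ _ kapi) Jkap -/lam /m.
  by move: (@pi R) p0 => P p0; field; rewrite !lt0r_neq0.
apply: (leJ (intbleD i1 i2) iln) => x hx.
have hxp := arc_pos hx.
have -> : al / r * (h x * kap x) + - al * m * kap x = al * (h x / r - m) * kap x by ring.
apply: ler_wpM2r => //; apply: alP; first exact: divr_gt0.
have -> : (h x / r) ^+ 2 - 2 * m * (h x / r) + 1 =
   (pi * h x ^+ 2 - 2 * lam * h x + A) / A.
  by rewrite -rA /m; move: (@pi R) p0 => P p0; field; rewrite !lt0r_neq0.
by rewrite pmulr_lle0 ?invr_gt0// arc_quadratic.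
Qed.

End ArcKey.

(** * Tangent angle and bisecting chords *)

Section Angle.
Variable R : realType.
Implicit Types (a b c s t x l m : R) (f g F G : R -> R).

Lemma circle_angle (c s : R) : c ^+ 2 + s ^+ 2 = 1 ->
  exists th, [/\ 0 <= th <= pi + pi, c = cos th & s = sin th].
Proof.
move=> cs.
have c1 : -1 <= c <= 1.
  by rewrite -ler_norml -(@ler_pXn2r _ 2%N)// ?nnegrE// real_normK ?num_real// expr1n; nra.
have sE : Num.sqrt (1 - c ^+ 2) = `|s| by rewrite -cs addrAC subrr add0r sqrtr_sqr.
have r1 := acos_ge0 c1; have r2 := acos_lepi c1.
have [s0|s0] := leP 0 s.
  exists (acos c); rewrite acosK ?in_itv// sin_acos// sE ger0_norm//; split => //.
  by rewrite r1/= (le_trans r2)// lerDl ltW// pi_gt0.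
exists (- acos c + pi + pi).
rewrite !cosDpi !sinDpi !opprK cosN sinN acosK ?in_itv// sin_acos// sE ltr0_norm// opprK.
by split => //; move: (acos c) (pi) r1 r2 => u P *; apply/andP; split; lra.
Qed.

Lemma continuous_clamp F a b : a <= b -> {within `[a, b], continuous F} ->
  continuous (F \o clamp a b).
Proof.
move=> ab /subspace_continuousP cF x.
have cl : continuous (clamp a b).
  change (continuous ((fun=> a) \max (id \min (fun=> b)) : R -> R)) => z.
  apply: continuous_max; first exact: cvg_cst.
  by apply: continuous_min; [exact: cvg_id | exact: cvg_cst].
have mem z : `[a, b]%classic (clamp a b z) by rewrite /= in_itv/= clamp_itv.
have hx := mem x.
apply: cvg_trans (cF _ hx).
apply: (@cvg_comp _ _ _ (clamp a b) F _ (within `[a, b] (nbhs (clamp a b x)))); last exact: cvg_id.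
move=> U /= hU.
have h : nbhs x (clamp a b @^-1` [set t | `[a, b]%classic t -> U t]) := cl x _ hU.
change (nbhs x (clamp a b @^-1` U)).
by apply: filterS h => z hz; exact: hz (mem z).
Qed.

Variables (L : R) (kap tx ty : R -> R).
Hypothesis L0 : 0 <= L.
Hypothesis kapi : intble L kap.
Hypothesis txE : abs_cont L tx (fun s => - (kap s * ty s)).
Hypothesis tyE : abs_cont L ty (fun s => kap s * tx s).
Local Notation psi := (turn kap).

(** Rotating the tangent back by the angle [th + psi s] gives a vector whose two components have
    density zero, so it stays equal to (1, 0). *)
Lemma tangent_angle th : tx 0 = cos th -> ty 0 = sin th ->
  forall s, 0 <= s <= L -> tx s = cos (th + psi s) /\ ty s = sin (th + psi s).
Proof.
move=> tx0 ty0.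
have aA : abs_cont L (fun s => th + psi s) (fun s => 0 + kap s).
  by apply: abs_contD; [exact: abs_cont_cst|exact: abs_cont_turn].
have cA := abs_cont_continuous L0 aA.
have aC : abs_cont L (cos \o (fun s => th + psi s)) (fun s => - sin (th + psi s) * (0 + kap s)).
  apply: (@abs_cont_comp _ L _ _ cos (fun x => - sin x) L0 aA) => // s.
  apply: (@continuous_comp (subspace `[0, L]) _ _ _ (fun x => - sin x)); first exact: cA.
  by apply: continuousN; exact: continuous_sin.
have aS : abs_cont L (sin \o (fun s => th + psi s)) (fun s => cos (th + psi s) * (0 + kap s)).
  apply: (@abs_cont_comp _ L _ _ sin cos L0 aA) => // s.
  apply: (@continuous_comp (subspace `[0, L]) _ _ _ cos); first exact: cA.
  exact: continuous_cos.
have [_ h1] := abs_contD (abs_contM L0 txE aC) (abs_contM L0 tyE aS).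
have [_ h2] := abs_contD (abs_contM L0 tyE aC) (abs_contN (abs_contM L0 txE aS)).
move=> s hs; move: (h1 s hs) (h2 s hs).
have psi0 : psi 0 = 0 by rewrite /turn integ_nil.
rewrite /= psi0 addr0 tx0 ty0.
set f1 := (f in integ f 0 s) => e1; set f2 := (f in integ f 0 s); move: e1.
have -> : f1 = fun=> 0 by apply/funext => z; rewrite /f1/=; ring.
have -> : f2 = fun=> 0 by apply/funext => z; rewrite /f2/=; ring.
have /andP[s0 sL] := hs.
rewrite !integ_cst// !mul0r !addr0 -!expr2 cos2Dsin2.
rewrite (mulrC (sin th)) subrr.
set C := cos _; set S := sin _ => e1 e2.
have u : C ^+ 2 + S ^+ 2 = 1 by exact: cos2Dsin2.
split.
  have -> : tx s = C * (tx s * C + ty s * S) - S * (ty s * C - tx s * S).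
    by rewrite -[LHS]mulr1 -u; ring.
  by rewrite e1 e2; ring.
have -> : ty s = S * (tx s * C + ty s * S) + C * (ty s * C - tx s * S).
  by rewrite -[LHS]mulr1 -u; ring.
by rewrite e1 e2; ring.
Qed.

End Angle.

Lemma continuous_pair (T U V : topologicalType) (f : T -> U) (g : T -> V) :
  continuous f -> continuous g -> continuous (fun x => (f x, g x)).
Proof. by move=> cf cg x; exact: (cvg_pair (cf x) (cg x)). Qed.

Lemma closed_inf_mem (R : realType) (S : set R) :
  S !=set0 -> has_lbound S -> closed S -> S (inf S).
Proof.
move=> S0 Slb cS; apply: cS => U /nbhs_ballP[e /= e0 hU].
have [y Sy ye] := inf_adherent e0 (conj S0 Slb).
exists y; split => //; apply: hU; rewrite /ball/= distrC ger0_norm.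
  by rewrite ltrBlDl.
by rewrite subr_ge0; exact: ge_inf.
Qed.

(** * A continuous path of parameter pairs at a fixed angle *)

Section BisectingPair.
Variable R : realType.
Implicit Types (s t w : R).
Variables (L : R) (psi : R -> R) (D : R -> R -> R) (A P : R).
Hypothesis L0 : 0 <= L.
Hypothesis P0 : 0 < P.
Hypothesis psiC : continuous psi.
Hypothesis psi_le : forall s t, s <= t -> psi s <= psi t.
Hypothesis psi0 : psi 0 = 0.
Hypothesis psiL : psi L = P + P.
Hypothesis DC : continuous (fun z : R * R => D z.1 z.2).
Hypothesis Dsym : forall t, 0 <= t <= L -> D 0 t + D t L = 0.

(* [sm w] is the smallest [s >= 0] with [psi (w - s) <= psi s + P]; the pairs
   [(sm w, w - sm w)] form a continuous path of pairs at angle [P], even when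
   [psi] has flat parts. *)
Let B w := [set s | 0 <= s /\ psi (w - s) <= psi s + P].
Let sm w := inf (B w).

Let B_lb w : has_lbound (B w). Proof. by exists 0 => s []. Qed.

Let B_closed w : closed (B w).
Proof.
have -> : B w = [set s | 0 <= s] `&` [set s | psi (w - s) - psi s <= P].
  by apply/seteqP; split => s /= [? h]; split => //; move: h; rewrite lerBlDl.
apply: closedI; first exact: closed_ge.
apply: (@preimage_closed _ _ (fun s => psi (w - s) - psi s) [set y | y <= P]); last exact: closed_le.
move=> s _; apply: continuousB; last exact: psiC.
apply: (@continuous_comp _ _ _ (fun s => w - s) psi); last exact: psiC.
by apply: continuousB; [exact: cvg_cst|exact: cvg_id].
Qed.

Let B_ex w : B w !=set0.
Proof.
exists (Num.max 0 w); split; first by rewrite le_max lexx.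
have h : w - Num.max 0 w <= 0 by rewrite subr_le0 le_max lexx orbT.
have h1 := psi_le h; have h2 : 0 <= Num.max 0 w by rewrite le_max lexx.
have h3 := psi_le h2; rewrite psi0 in h1 h3; have := P0; lra.
Qed.

Let smP w : B w (sm w).
Proof.
exact: closed_inf_mem (B_ex w) (B_lb w) (@B_closed w).
Qed.

Let sm_lb w s : B w s -> sm w <= s.
Proof. by move=> h; apply: ge_inf. Qed.

Let sm_le w w' : w <= w' -> sm w <= sm w'.
Proof.
move=> ww; apply: sm_lb; have [h1 h2] := smP w'; split => //.
by apply: le_trans h2; apply: psi_le; rewrite lerD2r.
Qed.

(** Shifting [w] and the candidate by d leaves their difference unchanged and can only raise the
    right-hand side. With monotonicity this makes [sm] nonexpansive, hence continuous. *)
Let sm_lip w d : 0 <= d -> sm (w + d) <= sm w + d.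
Proof.
move=> d0; apply: sm_lb; have [h1 h2] := smP w; split; first exact: addr_ge0.
have -> : w + d - (sm w + d) = w - sm w by ring.
by apply: (le_trans h2); rewrite lerD2r psi_le// lerDl.
Qed.

Let sm_cont : continuous sm.
Proof.
move=> w; apply/cvgrPdist_lt => e e0; near=> z.
have zw : `|w - z| < e by near: z; exact: cvgr_dist_lt.
apply: le_lt_trans zw.
have key u v : u <= v -> `|sm v - sm u| <= `|v - u|.
  move=> uv; rewrite !ger0_norm ?subr_ge0 ?sm_le//.
  have h : 0 <= v - u by rewrite subr_ge0.
  by have := sm_lip u h; rewrite subrKC; lra.
by have [wz|/ltW zw] := leP w z; [rewrite distrC (distrC w)|]; exact: key.
Unshelve. all: by end_near. Qed.

Let tz := inf [set s | 0 <= s /\ P <= psi s].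

Let tzP : 0 <= tz /\ P <= psi tz.
Proof.
have cl : closed [set s | 0 <= s /\ P <= psi s].
  have -> : [set s | 0 <= s /\ P <= psi s] = [set s | 0 <= s] `&` [set s | P <= psi s] by [].
  apply: closedI; first exact: closed_ge.
  apply: (@preimage_closed _ _ psi [set y | P <= y]); last exact: closed_ge.
  by move=> s _; exact: psiC.
apply: (closed_inf_mem _ _ cl); last by exists 0 => s [].
by exists L; split => //; rewrite psiL; have := P0; lra.
Qed.

Let tz_lb s : 0 <= s -> P <= psi s -> tz <= s.
Proof. by move=> h1 h2; apply: ge_inf; [exists 0 => z []|]. Qed.

Let tzL : tz <= L.
Proof. by apply: tz_lb => //; rewrite psiL; have := P0; lra. Qed.

Let below s : 0 <= s -> s < tz -> psi s < P.
Proof. by move=> s0 st; rewrite ltNge; apply/negP => /(tz_lb s0); rewrite leNgt st. Qed.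

Let left_limit (f : R -> R) s : continuous f -> 0 < s ->
  (forall z, 0 <= z -> z < s -> 0 <= f z) -> 0 <= f s.
Proof.
move=> cf s0 h; rewrite leNgt; apply/negP => fs.
have /cvgrPdist_lt /(_ (- f s)) := cf s.
rewrite oppr_gt0 fs => /(_ isT) [d /= d0 hd].
pose z := s - Num.min (s / 2) (d / 2).
have m0 : 0 < Num.min (s / 2) (d / 2) by rewrite lt_min !divr_gt0.
have m1 : Num.min (s / 2) (d / 2) <= s / 2 by rewrite ge_min lexx.
have m2 : Num.min (s / 2) (d / 2) <= d / 2 by rewrite ge_min lexx orbT.
have zs : `|s - z| < d by rewrite /z opprB subrKC gtr0_norm//; lra.
have := hd z zs; rewrite ltr_norml => /andP[h1 h2].
have : 0 <= f z by apply: h; rewrite /z; lra.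
lra.
Qed.

Let psi_tz : psi tz = P.
Proof.
have [t0 tP] := tzP; apply/le_anti; rewrite tP andbT.
have [<-|nt] := eqVneq 0 tz; first by rewrite psi0 ltW.
have {}t0 : 0 < tz by rewrite lt_neqAle nt.
rewrite -subr_ge0; apply: (@left_limit (fun s => P - psi s)) => //.
  by move=> s; apply: continuousB; [exact: cvg_cst|exact: psiC].
by move=> z z0 zt; rewrite subr_ge0 ltW// below.
Qed.

(** Below the minimal s the defining inequality fails, so a left limit gives the reverse one. If the
    minimum is 0, the assumption [tz <= w] supplies it instead. *)
Let sm_psi w : tz <= w -> psi (w - sm w) = psi (sm w) + P.
Proof.
move=> tw; have [s0 sB] := smP w; apply/le_anti; rewrite sB/=.
have [<-|ns] := eqVneq 0 (sm w).
  by rewrite psi0 add0r subr0 -psi_tz psi_le.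
have {}s0 : 0 < sm w by rewrite lt_neqAle ns.
rewrite -subr_ge0; apply: (@left_limit (fun s => psi (w - s) - (psi s + P))) => //.
  move=> s; apply: (@continuousB _ _ _ (fun s => psi (w - s)) (fun s => psi s + P)).
    apply: (@continuous_comp _ _ _ (fun s => w - s) psi); last exact: psiC.
    by apply: continuousB; [exact: cvg_cst|exact: cvg_id].
  by apply: continuousD; [exact: psiC|exact: cvg_cst].
move=> z z0 zs; rewrite subr_ge0 leNgt; apply/negP => /ltW h.
by have := sm_lb (conj z0 h); rewrite leNgt zs.
Qed.

(** The path indexed by w = s + t runs from the pair (0, tz) to the pair (tz, L), where [tz] is the
    first parameter at angle P. By [Dsym] the two values of D are opposite, so D vanishes in
    between. Constancy of psi beyond L serves to show that t stays at most L. *)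
Lemma bisecting_pair : (forall s, L <= s -> psi s = P + P) ->
  exists s t, [/\ 0 <= s, s <= t, t <= L, psi t = psi s + P & D s t = 0].
Proof.
move=> psi_top.
have [tz0 _] := tzP.
have sm1 : sm tz = 0.
  apply/le_anti; rewrite (smP tz).1 andbT; apply: sm_lb; split => //.
  by rewrite subr0 psi_tz psi0 add0r.
have sm2 : sm (tz + L) = tz.
  apply/le_anti/andP; split.
    by apply: sm_lb; split => //; rewrite addrC addKr psi_tz psiL.
  rewrite leNgt; apply/negP => h; have [s0 sB] := smP (tz + L).
  have h1 := below s0 h; move: sB; rewrite psi_top; last by lra.
  lra.
pose f w := D (sm w) (w - sm w).
have cf : continuous f.
  move=> w; apply: (@continuous_comp _ _ _ (fun w => (sm w, w - sm w)) (fun z => D z.1 z.2)); last exact: DC.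
  apply: continuous_pair; first exact: sm_cont.
  by move=> z; apply: continuousB; [exact: cvg_id|exact: sm_cont].
have f1 : f tz = D 0 tz by rewrite /f sm1 subr0.
have f2 : f (tz + L) = D tz L by rewrite /f sm2 addrC addKr.
have f12 : f tz + f (tz + L) = 0 by rewrite f1 f2; apply: Dsym; rewrite tz0 tzL.
have hab : tz <= tz + L by rewrite lerDl.
have hv : Num.min (f tz) (f (tz + L)) <= 0 <= Num.max (f tz) (f (tz + L)).
  by rewrite ge_min le_max; lra.
have [w] := IVT hab (continuous_subspaceT cf) hv.
rewrite in_itv/= => /andP[w1 w2] fw.
have e := sm_psi w1; have [s0 _] := smP w.
exists (sm w), (w - sm w); split => //.
  rewrite leNgt; apply/negP => /ltW/psi_le; rewrite e; have := P0; lra.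
have [//|tL] := leP (w - sm w) L.
have := psi_top _ (ltW tL); rewrite e => e2.
have h : P <= psi (sm w) by lra.
have := tz_lb s0 h; lra.
Qed.

End BisectingPair.

(** * The inequality for convex curves *)

Section Pointwise.
Variable R : realType.
Implicit Types x y p : R.

(* Convexity of the power and [ln (y / x) <= y / x - 1]; with [x = kap * r] and
   [y = h / r] the integral of the left-hand side along a curve is known up to
   the term [ln y * x]. *)
Lemma powR_tangent p x y : 1 < p -> 0 <= x -> 0 < y ->
  x + (p - 1) * (ln y * x + x - y) <= x `^ p.
Proof.
move=> p1; rewrite le_eqVlt => /orP[/eqP<-|x0] y0.
  by rewrite mulr0 !add0r (le_trans _ (powR_ge0 _ _))// mulrN oppr_le0 mulr_ge0//; lra.
have -> : x `^ p = x * expR ((p - 1) * ln x).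
  by rewrite /powR gt_eqF// -{2}(lnK (x0 : x \is Num.pos)) -expRD; congr expR; ring.
have h1 := expR_ge1Dx ((p - 1) * ln x).
have h2 := expR_ge1Dx (ln y - ln x).
rewrite expRB !lnK ?posrE// in h2.
have h3 : x * (1 + (ln y - ln x)) <= y by rewrite mulrC -ler_pdivlMr.
apply: (@le_trans _ _ (x * (1 + (p - 1) * ln x))); last by rewrite ler_pM2l.
by move: (ln y) (ln x) h3 => u v h3; nra.
Qed.

(** The bound rests on 1 + u <= exp u at two places, strict unless u = 0. Equality in the first
    gives ln x = 0, and what remains is ln y = y - 1, so y = 1. At x = 0 the right-hand side is
    negative. *)
Lemma powR_tangent_eq p x y : 1 < p -> 0 <= x -> 0 < y ->
  x `^ p = x + (p - 1) * (ln y * x + x - y) -> x = 1 /\ y = 1.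
Proof.
move=> p1; rewrite le_eqVlt => /orP[/eqP<-|x0] y0.
  rewrite mulr0 !add0r powR0; last by rewrite gt_eqF//; lra.
  by move/eqP; rewrite eq_sym mulf_eq0 oppr_eq0 => /orP[/eqP|/eqP] ?; lra.
have -> : x `^ p = x * expR ((p - 1) * ln x).
  by rewrite /powR gt_eqF// -{2}(lnK (x0 : x \is Num.pos)) -expRD; congr expR; ring.
have h2 := expR_ge1Dx (ln y - ln x).
rewrite expRB !lnK ?posrE// in h2.
have h3 : x * (1 + (ln y - ln x)) <= y by rewrite mulrC -ler_pdivlMr.
have [l0|l0] := eqVneq (ln x) 0.
  have x1 : x = 1 by apply/eqP; rewrite -ln_eq0// l0.
  rewrite x1 ln1 mulr0 expR0 !mulr1 => e; split => //.
  have e2 : ln y + 1 - y = 0.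
    by apply/eqP; have /eqP : (p - 1) * (ln y + 1 - y) = 0 by [lra]; rewrite mulf_eq0 => /orP[/eqP ?|//]; lra.
  have [//|y1] := eqVneq y 1.
  have ly : ln y != 0 by rewrite ln_eq0.
  have := expR_gt1Dx ly; rewrite lnK ?posrE//; lra.
have l1 : (p - 1) * ln x != 0 by rewrite mulf_neq0// gt_eqF//; lra.
have h1 := expR_gt1Dx l1.
have h4 : x * (1 + (p - 1) * ln x) < x * expR ((p - 1) * ln x) by rewrite ltr_pM2l.
move=> e; rewrite e in h4; exfalso; move: (ln y) (ln x) h3 h4 => u v h3 h4; nra.
Qed.

End Pointwise.

Section AeTools.
Variable R : realType.
Notation mu := (@lebesgue_measure R).

Lemma integ_eq0_ae (L : R) (f : R -> R) : intble L f -> (forall s, 0 <= s <= L -> 0 <= f s) ->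
  integ f 0 L = 0 -> ae_on L (fun s => f s = 0).
Proof.
move=> fi f0 If.
have mf : measurable_fun `[0, L] (EFin \o f) by exact: measurable_int fi.
have Z : (\int[mu]_(x in `[0%R, L]) `|(EFin \o f) x|)%E = 0%E.
  have fin : (\int[mu]_(x in `[0%R, L]) (f x)%:E)%E \is a fin_num by exact: integrable_fin_num.
  transitivity (\int[mu]_(x in `[0%R, L]) (f x)%:E)%E.
    by apply: eq_integral => x; rewrite inE/= in_itv/= => hx; rewrite ger0_norm ?f0.
  by rewrite -(fineK fin); congr EFin.
have [/(_ Z) h _] := ae_eq_integral_abs mu (measurable_itv _) mf.
apply: ae_imply h => s hs /andP[s0 sL].
have [] : (f s)%:E = 0%E by apply: hs; rewrite /= in_itv/= !ltW.
by [].
Qed.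

Lemma ae_on_ex (L : R) (P : R -> Prop) : 0 < L -> ae_on L P -> exists s, 0 < s < L /\ P s.
Proof.
move=> L0 [N [mN N0 sub]]; apply: contrapT => nex.
have : (mu `]0%R, L[ <= mu N)%E.
  apply: le_measure; rewrite ?inE//.
  move=> s; rewrite /= in_itv/= => hs; apply: sub => /= h.
  by apply: nex; exists s; split => //; exact: h.
by rewrite N0 lebesgue_measure_itv/= lte_fin L0 sube0 leNgt lte_fin L0.
Qed.

End AeTools.

(** * The sharp energy bound in terms of the enclosed area *)

Section CurveInequality.
Variable R : realType.
Implicit Types (s t u : R).
Variables (p L : R) (kap x y tx ty : R -> R).
Hypothesis p1 : 1 < p.
Hypothesis L0 : 0 < L.
Hypothesis kap0 : forall s, 0 <= kap s.
Hypothesis kapi : intble L kap.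
Hypothesis xE : abs_cont L x tx.
Hypothesis yE : abs_cont L y ty.
Hypothesis txE : abs_cont L tx (fun s => - (kap s * ty s)).
Hypothesis tyE : abs_cont L ty (fun s => kap s * tx s).
Hypothesis unit : forall s, tx s ^+ 2 + ty s ^+ 2 = 1.
Hypotheses (xL : x L = x 0) (yL : y L = y 0) (txL : tx L = tx 0) (tyL : ty L = ty 0).
Local Notation psi := (turn kap).
Hypothesis psiL : psi L = pi + pi.
Hypothesis supp : forall s u, 0 <= s <= L -> 0 <= u <= L ->
  0 <= tx s * (y u - y s) - ty s * (x u - x s).

Let Lge : 0 <= L. Proof. exact: ltW. Qed.

Definition signed_area : R := 2^-1 * integ (fun s => x s * ty s - y s * tx s) 0 L.

(* support function and tangential component of the curve seen from [(ox, oy)] *)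
Let hh ox oy s := (x s - ox) * ty s - (y s - oy) * tx s.
Let kk ox oy s := (x s - ox) * tx s + (y s - oy) * ty s.

Let hhE ox oy : abs_cont L (hh ox oy) (fun s => kap s * kk ox oy s).
Proof.
have ax := abs_contD xE (abs_contN (abs_cont_cst L ox)).
have ay := abs_contD yE (abs_contN (abs_cont_cst L oy)).
have := abs_contD (abs_contM Lge ax tyE) (abs_contN (abs_contM Lge ay txE)).
congr abs_cont; apply/funext => s; rewrite /kk; ring.
Qed.

Let kkE ox oy : abs_cont L (kk ox oy) (fun s => 1 - kap s * hh ox oy s).
Proof.
have ax := abs_contD xE (abs_contN (abs_cont_cst L ox)).
have ay := abs_contD yE (abs_contN (abs_cont_cst L oy)).
have := abs_contD (abs_contM Lge ax txE) (abs_contM Lge ay tyE).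
congr abs_cont; apply/funext => s; rewrite /hh -(unit s); ring.
Qed.

Let itx : intble L tx. Proof. exact: abs_cont_intble xE. Qed.
Let ity : intble L ty. Proof. exact: abs_cont_intble yE. Qed.

Let icross : intble L (fun s => x s * ty s - y s * tx s).
Proof. by apply: intbleB; apply: intbleM => //; [exact: abs_cont_continuous Lge xE | exact: abs_cont_continuous Lge yE]. Qed.

Let Ihh ox oy s t : 0 <= s -> s <= t -> t <= L ->
  integ (hh ox oy) s t = integ (fun s => x s * ty s - y s * tx s) s t
    - ox * (y t - y s) + oy * (x t - x s).
Proof.
move=> s0 st tL.
have -> : hh ox oy = (fun s => (x s * ty s - y s * tx s) + (- ox * ty s + oy * tx s)).
  by apply/funext => u; rewrite /hh; ring.
have i1 : intble L (fun s => - ox * ty s) by exact: intbleZ.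
have i2 : intble L (fun s => oy * tx s) by exact: intbleZ.
rewrite (integD icross (intbleD i1 i2))// (integD i1 i2)// (integZ _ ity)// (integZ _ itx)//.
by rewrite (abs_contB xE)// (abs_contB yE)//; ring.
Qed.

(** Seen from the base point of the curve, h is nonnegative with integral twice the area. Area zero
    would force h = 0 almost everywhere, so k would grow at unit rate and could not return to its
    initial value after the length L. *)
Lemma signed_area_gt0 : 0 < signed_area.
Proof.
pose h := hh (x 0) (y 0); pose k := kk (x 0) (y 0).
have h0 s : 0 <= s <= L -> 0 <= h s.
  move=> hs; have := supp hs (_ : 0 <= (0 : R) <= L); rewrite lexx Lge => /(_ isT).
  by rewrite /h /hh; congr (0 <= _); ring.
have Ih : integ h 0 L = 2 * signed_area by rewrite Ihh// xL yL /signed_area; field.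
have hi : intble L h by apply: intble_cont; exact: abs_cont_continuous Lge (hhE _ _).
have A0 : 0 <= signed_area by have := integ_ge0 h0; rewrite Ih pmulr_rge0.
rewrite lt_neqAle A0 andbT; apply/eqP => A0E.
have aeh : ae_on L (fun s => h s = 0) by apply: integ_eq0_ae => //; rewrite Ih -A0E mulr0.
have [_ /(_ L)] : abs_cont L k (fun=> 1).
  apply: abs_cont_ae (kkE (x 0) (y 0)); first exact: intble_cst.
  by apply: ae_imply aeh => s hs /hs; rewrite -/h => ->; rewrite mulr0 subr0.
rewrite lexx Lge integ_cst// /k /kk xL yL txL tyL => /(_ isT) e.
by have := L0; lra.
Qed.

Let flip s t : 0 <= s <= L -> 0 <= t <= L -> psi t = psi s + pi ->
  tx t = - tx s /\ ty t = - ty s.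
Proof.
move=> hs ht e.
have [th [_ c0 s0]] := circle_angle (unit 0).
have ta := tangent_angle Lge kapi txE tyE c0 s0.
have [-> ->] := ta t ht; have [-> ->] := ta s hs.
by rewrite e addrA cosDpi sinDpi.
Qed.

(* a chord with parallel tangents that halves the enclosed area *)
Let pair : exists s t, [/\ 0 <= s, s <= t, t <= L, psi t = psi s + pi &
  integ (fun s => x s * ty s - y s * tx s) s t - (x s * y t - y s * x t) = signed_area].
Proof.
pose cl := clamp 0 L.
pose Q s := integ (fun s => x s * ty s - y s * tx s) 0 s.
have QE : abs_cont L Q (fun s => x s * ty s - y s * tx s).
  by split => // s _; rewrite /Q integ_nil add0r.
have cc F f : abs_cont L F f -> continuous (F \o cl).
  by move=> aF; apply: continuous_clamp => //; exact: abs_cont_continuous Lge aF.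
have cx := cc _ _ xE; have cy := cc _ _ yE; have cQ := cc _ _ QE.
have cpsi := cc _ _ (abs_cont_turn kapi).
have clE s : 0 <= s <= L -> cl s = s by exact: clamp_id.
(* Arc integral minus chord determinant is twice the area of the segment cut off, so a zero of D is
   a chord halving the area. Clamping extends the data as constants beyond 0 and L. *)
pose D s t := ((Q \o cl) t - (Q \o cl) s) -
   ((x \o cl) s * (y \o cl) t - (y \o cl) s * (x \o cl) t) - signed_area.
have c1 (F : R -> R) : continuous F -> continuous (fun z : R * R => F z.1).
  by move=> cF z; apply: continuous_comp; [exact: cvg_fst|exact: cF].
have c2 (F : R -> R) : continuous F -> continuous (fun z : R * R => F z.2).
  by move=> cF z; apply: continuous_comp; [exact: cvg_snd|exact: cF].
have cB (F G : R * R -> R) : continuous F -> continuous G -> continuous (fun z => F z - G z).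
  by move=> cF cG z; apply: continuousB; [exact: cF|exact: cG].
have cM (F G : R * R -> R) : continuous F -> continuous G -> continuous (fun z => F z * G z).
  by move=> cF cG z; apply: continuousM; [exact: cF|exact: cG].
have cD : continuous (fun z : R * R => D z.1 z.2).
  have c3 := cB _ _ (c2 _ cQ) (c1 _ cQ).
  have c4 := cB _ _ (cM _ _ (c1 _ cx) (c2 _ cy)) (cM _ _ (c1 _ cy) (c2 _ cx)).
  have c5 : continuous (fun _ : R * R => signed_area) by move=> z; exact: cvg_cst.
  exact: cB (cB _ _ c3 c4) c5.
have L00 : 0 <= L <= L by rewrite lexx Lge.
have h00 : 0 <= (0 : R) <= L by rewrite lexx Lge.
have [|||||s [t [s0 st tL e1 e2]]] := @bisecting_pair R L (psi \o cl) D pi Lge (pi_gt0 R) cpsi _ _ _ cD.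
- move=> s t st; have /andP[a1 a2] := clamp_itv s Lge; have /andP[b1 b2] := clamp_itv t Lge.
  apply: (turn_le kap0 kapi) => //.
  by rewrite /clamp ge_max !le_max lexx/=; apply/orP; right; rewrite le_min !ge_min st lexx orbT.
- by rewrite /= clE// /turn integ_nil.
- by rewrite /= clE.
- move=> t ht; rewrite /D /= !clE// xL yL.
  have -> : Q L = 2 * signed_area by rewrite /Q /signed_area; field.
  have -> : Q 0 = 0 by rewrite /Q integ_nil.
  by ring.
- move=> s Ls; rewrite /= /cl /clamp (min_idPr Ls) (max_idPr _)//.
have hs : 0 <= s <= L by rewrite s0 (le_trans st).
have ht : 0 <= t <= L by rewrite tL (le_trans s0).
exists s, t; move: e1 e2; rewrite /D /= !clE// => e1 e2; split => //.
by rewrite -(abs_contB QE)//; apply/eqP; rewrite -subr_eq0 e2.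
Qed.

Lemma curve_inequality (r : R) : 0 < r -> pi * r ^+ 2 = signed_area ->
  intble L (fun s => kap s `^ p) ->
  2 * pi * r <= integ (fun s => (kap s * r) `^ p) 0 L /\
  (integ (fun s => (kap s * r) `^ p) 0 L = 2 * pi * r ->
   exists ox oy, forall s, 0 <= s <= L -> x s = ox + r * ty s /\ y s = oy - r * tx s).
Proof.
move=> r0 rA ikp.
have [s [t [s0 st tL pst eA]]] := pair.
have sL := le_trans st tL; have t0 := le_trans s0 st.
have hs : 0 <= s <= L by rewrite s0.
have ht : 0 <= t <= L by rewrite t0.
have [ftx fty] := flip hs ht pst.
have in1 u : s <= u <= s \/ s <= u <= t -> 0 <= u <= L.
  by case=> /andP[u1 u2]; rewrite (le_trans s0 u1) (le_trans u2).
have in2 u : 0 <= u <= s \/ t <= u <= L -> 0 <= u <= L.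
  by case=> /andP[u1 u2]; [rewrite u1 (le_trans u2)|rewrite u2 (le_trans t0)].
(* From the midpoint the chord ends are opposite vectors, and so are their tangents; hence h and k
   take equal values at s and t. This glues the ends of each arc and removes the boundary term of h
   k in [parts]. *)
pose ox := (x s + x t) / 2; pose oy := (y s + y t) / 2.
pose h := hh ox oy; pose k := kk ox oy.
have hE : abs_cont L h (fun s => kap s * k s) by exact: hhE.
have kE : abs_cont L k (fun s => 1 - kap s * h s) by exact: kkE.
have hst : h s = h t by rewrite /h /hh ftx fty /ox /oy; field.
have kst : k s = k t by rewrite /k /kk ftx fty /ox /oy; field.
have h0L : h 0 = h L by rewrite /h /hh xL yL txL tyL.
have k0L : k 0 = k L by rewrite /k /kk xL yL txL tyL.
have hge u : 0 <= u <= L -> 0 <= h u.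
  move=> hu.
  suff -> : h u = 2^-1 * ((tx u * (y s - y u) - ty u * (x s - x u)) + (tx u * (y t - y u) - ty u * (x t - x u))).
    by rewrite mulr_ge0// addr_ge0// supp.
  by rewrite /h /hh /ox /oy; field.
(* The origin lies on the chord, so the integral of h over the arc is twice the area of the segment
   cut off, and that segment is half of the total. *)
have Ih1 : integ h s t = signed_area.
  by rewrite Ihh// -eA /ox /oy; field.
have ih : intble L h by apply: intble_cont; exact: abs_cont_continuous Lge hE.
have IhL : integ h 0 L = 2 * signed_area.
  by rewrite Ihh// xL yL /signed_area; field.
have Ih2 : integ h 0 s + integ h t L = signed_area.
  move: IhL; rewrite (integ_cat ih (lexx 0) s0 sL (lexx L)) (integ_cat ih s0 st tL (lexx L)) Ih1; lra.
have ih2 : intble L (fun s => h s ^+ 2 * kap s).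
  by apply: intbleM => //; exact: abs_cont_continuous Lge (abs_cont_sqr Lge hE).
have ik2 : intble L (fun s => k s ^+ 2 * kap s).
  by apply: intbleM => //; exact: abs_cont_continuous Lge (abs_cont_sqr Lge kE).
have parts a b : 0 <= a -> a <= b -> b <= L ->
    h b * k b - h a * k a = integ (fun s => k s ^+ 2 * kap s) a b + integ h a b - integ (fun s => h s ^+ 2 * kap s) a b.
  move=> a0 ab bL; have aP := abs_contM Lge hE kE.
  rewrite (abs_contB aP)// -(integD ik2 ih)// -(integB (intbleD ik2 ih) ih2)//.
  by apply: eq_integ => z _; ring.
have A0 := signed_area_gt0.
have p0 : psi 0 = 0 by rewrite /turn integ_nil.
have Ik a b : 0 <= a -> a <= b -> b <= L -> integ kap a b = psi b - psi a.
  by move=> *; rewrite (abs_contB (abs_cont_turn kapi)).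
have J1 : integ kap s s + integ kap s t = pi by rewrite integ_nil Ik// pst; ring.
have J2 : integ kap 0 s + integ kap t L = pi by rewrite !Ik// pst psiL p0; ring.
have K1 : (integ (fun s => h s ^+ 2 * kap s) s s + integ (fun s => h s ^+ 2 * kap s) s t) -
     (integ (fun s => k s ^+ 2 * kap s) s s + integ (fun s => k s ^+ 2 * kap s) s t) = signed_area.
  by rewrite !integ_nil !add0r -Ih1; have := parts s t s0 st tL; rewrite hst kst; lra.
have K2 : (integ (fun s => h s ^+ 2 * kap s) 0 s + integ (fun s => h s ^+ 2 * kap s) t L) -
     (integ (fun s => k s ^+ 2 * kap s) 0 s + integ (fun s => k s ^+ 2 * kap s) t L) = signed_area.
  rewrite -Ih2; have := parts 0 s (lexx 0) s0 sL; have := parts t L t0 tL (lexx L).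
  by rewrite h0L k0L hst kst; lra.
have W1 u l : s <= u <= s \/ s <= u <= t -> 0 < l < 1 ->
    0 <= integ (fun s => (k s ^+ 2 - l ^+ 2 * (h s - h u) ^+ 2) * kap s) s s +
         integ (fun s => (k s ^+ 2 - l ^+ 2 * (h s - h u) ^+ 2) * kap s) s t.
  move=> hu hl; rewrite integ_nil add0r.
  apply: (half_arc_inner Lge kap0 kapi hE kE s0 tL _ hl pst hst).
  by case: hu => // /andP[-> /le_trans]; apply.
have W2 u l : 0 <= u <= s \/ t <= u <= L -> 0 < l < 1 ->
    0 <= integ (fun s => (k s ^+ 2 - l ^+ 2 * (h s - h u) ^+ 2) * kap s) 0 s +
         integ (fun s => (k s ^+ 2 - l ^+ 2 * (h s - h u) ^+ 2) * kap s) t L.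
  move=> hu hl.
  exact: (half_arc_outer Lge kap0 kapi hE kE s0 st tL hu hl pst psiL hst h0L).
have H1 u : s <= u <= s \/ s <= u <= t -> 0 <= h u.
  by move=> /in1 /hge.
have H2 u : 0 <= u <= s \/ t <= u <= L -> 0 <= h u.
  by move=> /in2 /hge.
have hpos u : 0 <= u <= L -> 0 < h u.
  move=> /andP[u0 uL].
  have [us|su] := leP u s.
    by apply: (arc_pos Lge kap0 kapi hE kE (lexx 0) s0 st tL (lexx L) A0 J2 K2 H2 W2); left; rewrite u0.
  have [ut|tu] := leP u t.
    by apply: (arc_pos Lge kap0 kapi hE kE s0 (lexx s) (lexx s) st tL A0 J1 K1 H1 W1); right; rewrite ut ltW.
  by apply: (arc_pos Lge kap0 kapi hE kE (lexx 0) s0 st tL (lexx L) A0 J2 K2 H2 W2); right; rewrite uL ltW.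
have E1 := arc_entropy Lge kap0 kapi hE kE s0 (lexx s) (lexx s) st tL A0 J1 K1 H1 W1 r0 rA hpos.
have E2 := arc_entropy Lge kap0 kapi hE kE (lexx 0) s0 st tL (lexx L) A0 J2 K2 H2 W2 r0 rA hpos.
rewrite integ_nil add0r in E1.
have iln : intble L (fun s => ln (h s / r) * kap s).
  apply: (intbleM _ kapi); apply: (@continuous_ln_on _ _ (fun s => h s / r)).
    have -> : (fun s => h s / r) = (fun s => r^-1 * h s) by apply/funext => u; rewrite mulrC.
    exact: (abs_cont_continuous Lge (abs_contZ r^-1 hE)).
  by move=> u hu; rewrite divr_gt0// hpos.
set lnk := (fun s => ln (h s / r) * kap s) in E1 E2 iln.
pose E := integ lnk 0 L.
have EE : 0 <= E.
  rewrite /E (integ_cat iln (lexx 0) s0 sL (lexx L)) (integ_cat iln s0 st tL (lexx L)).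
  by rewrite addrCA addr_ge0.
pose low s := kap s * r + (p - 1) * (ln (h s / r) * (kap s * r) + kap s * r - h s / r).
have ilow : intble L low /\ integ low 0 L = 2 * pi * r + (p - 1) * r * E.
  have lowE : low = (fun s => (p * r) * kap s + (((p - 1) * r) * lnk s + (- (p - 1) / r) * h s)).
    by apply/funext => u; rewrite /low /lnk; ring.
  have i1 := intbleZ (p * r) kapi; have i2 := intbleZ ((p - 1) * r) iln.
  have i3 := intbleZ (- (p - 1) / r) ih.
  rewrite lowE; split; first by apply: intbleD => //; exact: intbleD.
  rewrite (integD i1 (intbleD i2 i3))// (integD i2 i3)// (integZ _ kapi)// (integZ _ iln)// (integZ _ ih)//.
  have -> : integ kap 0 L = pi + pi by exact: psiL.
  rewrite -/E IhL -rA; move: (@pi R) => P; field.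
  by rewrite gt_eqF.
have [il IlE] := ilow.
have ip : intble L (fun s => (kap s * r) `^ p).
  have -> : (fun s => (kap s * r) `^ p) = (fun s => r `^ p * kap s `^ p).
    by apply/funext => u; rewrite powRM ?(ltW r0)// mulrC.
  exact: intbleZ.
have low_le u : 0 <= u <= L -> low u <= (kap u * r) `^ p.
  move=> hu; apply: powR_tangent => //; first by rewrite mulr_ge0// ltW.
  by rewrite divr_gt0// hpos.
have pr : 0 < (p - 1) * r by rewrite mulr_gt0//; have := p1; lra.
have prE : 0 <= (p - 1) * r * E by rewrite mulr_ge0// ltW.
have le1 : integ low 0 L <= integ (fun s => (kap s * r) `^ p) 0 L by apply: (le_integ il ip).
split; first by rewrite IlE in le1; lra.
move=> eqE.
have aeD : ae_on L (fun s => (kap s * r) `^ p - low s = 0).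
  apply: integ_eq0_ae; first exact: intbleB.
    by move=> u hu; rewrite subr_ge0 low_le.
  by rewrite (integB ip il)//; apply/eqP; rewrite subr_eq0 eq_le le1 andbT eqE IlE lerDl.
have ae1 : ae_on L (fun s => kap s * r = 1 /\ h s = r).
  apply: ae_imply aeD => u hu hu2; have uL : 0 <= u <= L by case/andP: hu2 => *; rewrite !ltW.
  have /subr0_eq := hu hu2.
  move/powR_tangent_eq; rewrite divr_gt0 ?hpos ?mulr_ge0 ?(ltW r0)// => /(_ p1 isT isT) [e1 e2].
  by split => //; rewrite -[LHS](divfK (lt0r_neq0 r0)) e2 mul1r.
(* Since kap h = 1 almost everywhere, k has density zero and is constant. Then h has the constant
   density k / r, and h L = h 0 forces k = 0, so h is the constant r. *)
have kc u : 0 <= u <= L -> k u = k 0.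
  have [_ H] : abs_cont L k (fun=> 0).
    apply: abs_cont_ae kE; first exact: intble_cst.
    by apply: ae_imply ae1 => v hv /hv [e1 e2]; rewrite e2 e1 subrr.
  by move=> hu; rewrite H// integ_cst ?mul0r ?addr0//; case/andP: hu.
have hL u : 0 <= u <= L -> h u = h 0 + k 0 / r * u.
  have [_ H] : abs_cont L h (fun=> k 0 / r).
    apply: abs_cont_ae hE; first exact: intble_cst.
    apply: ae_imply ae1 => v hv hv2; have [e1 e2] := hv hv2.
    rewrite kc; last by case/andP: hv2 => *; rewrite !ltW.
    by apply: (mulIf (lt0r_neq0 r0)); rewrite mulrAC e1 mul1r divfK ?gt_eqF.
  by move=> hu; rewrite H// integ_cst ?subr0//; case/andP: hu.
have k00 : k 0 = 0.
  have := hL L; rewrite lexx Lge -h0L => /(_ isT)/eqP.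
  rewrite -subr_eq0 opprD addNKr oppr_eq0 !mulf_eq0 invr_eq0 (gt_eqF L0) (gt_eqF r0) !orbF.
  by move/eqP.
have hr u : 0 <= u <= L -> h u = r.
  move=> hu; have [v [hv [_ e]]] := ae_on_ex L0 ae1.
  rewrite -e hL// k00 !mul0r addr0 (hL v) ?k00 ?mul0r ?addr0//.
  by case/andP: hv => *; rewrite !ltW.
exists ox, oy => u hu.
have e1 := hr u hu; have e2 := kc u hu; rewrite k00 in e2.
split.
  have -> : x u = ox + (h u * ty u + k u * tx u).
    rewrite /h /k /hh /kk.
    by transitivity (ox + (x u - ox) * (tx u ^+ 2 + ty u ^+ 2)); [rewrite unit|]; ring.
  by rewrite e1 e2; ring.
have -> : y u = oy + (k u * ty u - h u * tx u).
  rewrite /h /k /hh /kk.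
  by transitivity (oy + (y u - oy) * (tx u ^+ 2 + ty u ^+ 2)); [rewrite unit|]; ring.
by rewrite e1 e2; ring.
Qed.

End CurveInequality.

(** * Convex sets and their boundary curves *)

Section ConvexPlane.
Variable R : realType.
Implicit Types (A B C P Q z q : R * R) (O : set (R * R)).

(** Twice the signed area of the triangle with vertices q, A, B. *)
Definition det A B q : R :=
  (A.1 - q.1) * (B.2 - q.2) - (A.2 - q.2) * (B.1 - q.1).

Lemma continuous_det (f g h : R * R -> R * R) :
  continuous f -> continuous g -> continuous h ->
  continuous (fun z => det (f z) (g z) (h z)).
Proof.
move=> cf cg ch z; rewrite /det.
have c1 (k : R * R -> R * R) : continuous k -> {for z, continuous (fun z => (k z).1)}.
  by move=> ck; apply: continuous_comp; [exact: ck|exact: cvg_fst].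
have c2 (k : R * R -> R * R) : continuous k -> {for z, continuous (fun z => (k z).2)}.
  by move=> ck; apply: continuous_comp; [exact: ck|exact: cvg_snd].
have cB (F G : R * R -> R) : {for z, continuous F} -> {for z, continuous G} ->
  {for z, continuous (fun z => F z - G z)} by move=> cF cG; exact: continuousB cF cG.
have cM (F G : R * R -> R) : {for z, continuous F} -> {for z, continuous G} ->
  {for z, continuous (fun z => F z * G z)} by move=> cF cG; exact: continuousM cF cG.
exact: cB (cM _ _ (cB _ _ (c1 _ cf) (c1 _ ch)) (cB _ _ (c2 _ cg) (c2 _ ch)))
  (cM _ _ (cB _ _ (c2 _ cf) (c2 _ ch)) (cB _ _ (c1 _ cg) (c1 _ ch))).
Qed.

Lemma near_pos (T : topologicalType) (f : T -> R) (x : T) :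
  {for x, continuous f} -> 0 < f x -> \forall z \near x, 0 < f z.
Proof. by move=> cf fx; exact: (cvgr_gt _ cf). Qed.

Lemma convex3 O A B C (a b c : R) : convex2 O -> O A -> O B -> O C ->
  0 < a -> 0 < b -> 0 < c ->
  O ((a * A.1 + b * B.1 + c * C.1) / (a + b + c),
     (a * A.2 + b * B.2 + c * C.2) / (a + b + c)).
Proof.
move=> cO OA OB OC a0 b0 c0.
have s1 : 0 < b + c by exact: addr_gt0.
have s2 : 0 < a + b + c by rewrite !addr_gt0.
have OBC := cO _ _ OB OC (c / (b + c)).
have h1 : 0 <= c / (b + c) <= 1.
  by rewrite (divr_ge0 (ltW c0) (ltW s1))/= ler_pdivrMr//; lra.
have h2 : 0 <= (b + c) / (a + b + c) <= 1.
  by rewrite (divr_ge0 (ltW s1) (ltW s2))/= ler_pdivrMr//; lra.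
have := cO _ _ OA (OBC h1) _ h2; rewrite /=.
have f (u v w : R) : (1 - (b + c) / (a + b + c)) * u +
   (b + c) / (a + b + c) * ((1 - c / (b + c)) * v + c / (b + c) * w) =
   (a * u + b * v + c * w) / (a + b + c).
  by field; rewrite !gt_eqF.
by rewrite !f.
Qed.

(** Divided by their sum, the three determinants at a point are its barycentric coordinates; they
    stay positive near q, where every point is then a convex combination of the vertices. *)
Lemma triangle_interior_in O A B C q : convex2 O -> O A -> O B -> O C ->
  0 < det A B q -> 0 < det B C q -> 0 < det C A q -> interior O q.
Proof.
move=> cO OA OB OC h1 h2 h3.
have cc (P : R * R) : continuous (fun _ : R * R => P) by move=> z; exact: cvg_cst.
have ci : continuous (fun z : R * R => z) by move=> z; exact: cvg_id.
have n1 := near_pos (continuous_det (cc A) (cc B) ci (x := q)) h1.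
have n2 := near_pos (continuous_det (cc B) (cc C) ci (x := q)) h2.
have n3 := near_pos (continuous_det (cc C) (cc A) ci (x := q)) h3.
apply: filterS (filterI n1 (filterI n2 n3)) => z [z1 [z2 z3]].
have s0 : 0 < det B C z + det C A z + det A B z by apply: addr_gt0; [apply: addr_gt0|].
have := convex3 cO OA OB OC z2 z3 z1.
suff -> : ((det B C z * A.1 + det C A z * B.1 + det A B z * C.1) / (det B C z + det C A z + det A B z),
  (det B C z * A.2 + det C A z * B.2 + det A B z * C.2) / (det B C z + det C A z + det A B z)) = z by [].
move: (s0); rewrite /det => s1; rewrite [RHS]surjective_pairing.
by congr pair; field; rewrite gt_eqF//; move: s1; congr (0 < _); ring.
Qed.

(* strict orientation is an open condition, so the vertices may lie in the closure *)
Lemma triangle_interior O A B C q : convex2 O ->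
  closure O A -> closure O B -> closure O C ->
  0 < det A B q -> 0 < det B C q -> 0 < det C A q -> interior O q.
Proof.
move=> cO OA OB OC h1 h2 h3.
have cc (P : R * R) : continuous (fun _ : R * R => P) by move=> z; exact: cvg_cst.
have ci : continuous (fun z : R * R => z) by move=> z; exact: cvg_id.
have n1 := near_pos (continuous_det ci (cc B) (cc q) (x := A)) h1.
have n2 := near_pos (continuous_det (cc C) ci (cc q) (x := A)) h3.
have [A' [OA' [a1 a2]]] := OA _ (filterI n1 n2).
have n3 := near_pos (continuous_det (cc A') ci (cc q) (x := B)) a1.
have n4 := near_pos (continuous_det ci (cc C) (cc q) (x := B)) h2.
have [B' [OB' [b1 b2]]] := OB _ (filterI n3 n4).
have n5 := near_pos (continuous_det (cc B') ci (cc q) (x := C)) b2.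
have n6 := near_pos (continuous_det ci (cc A') (cc q) (x := C)) a2.
have [C' [OC' [c1 c2]]] := OC _ (filterI n5 n6).
exact: (triangle_interior_in cO OA' OB' OC').
Qed.

Lemma convex2_closure O : convex2 O -> convex2 (closure O).
Proof.
move=> cO P Q cP cQ t t01 U /nbhs_ballP[e /= e0 hU].
have [P' [OP' [p1 p2]]] := cP _ (nbhsx_ballx P e e0).
have [Q' [OQ' [q1 q2]]] := cQ _ (nbhsx_ballx Q e e0).
exists ((1 - t) * P'.1 + t * Q'.1, (1 - t) * P'.2 + t * Q'.2); split; first exact: cO.
apply: hU; move: t01 => /andP[t0 t1].
have est (a b c d : R) : `|a - c| < e -> `|b - d| < e ->
    `|(1 - t) * a + t * b - ((1 - t) * c + t * d)| < e.
  move=> h1 h2.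
  have -> : (1 - t) * a + t * b - ((1 - t) * c + t * d) = (1 - t) * (a - c) + t * (b - d) by ring.
  apply: (le_lt_trans (ler_normD _ _)); rewrite !normrM (ger0_norm t0) (@ger0_norm _ (1 - t)) ?subr_ge0//.
  move: `|a - c| `|b - d| h1 h2 => u v h1 h2.
  apply: (@le_lt_trans _ _ (Num.max u v)); last by rewrite gt_max h1.
  have h3 : u <= Num.max u v by rewrite le_max lexx.
  have h4 : v <= Num.max u v by rewrite le_max lexx orbT.
  by move: (Num.max u v) h3 h4 => m h3 h4; nra.
by split; apply: est.
Qed.

Lemma derive_sign (f : R -> R) (s d : R) : is_derive s 1 f d -> f s = 0 -> 0 < d ->
  exists2 e, 0 < e & forall t, `|t - s| < e -> (s < t -> 0 < f t) /\ (t < s -> f t < 0).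
Proof.
move=> [df fd] fs d0.
have /cvgrPdist_lt /(_ d d0) : h^-1 *: (f (h *: 1 + s) - f s) @[h --> 0^'] --> d.
  by rewrite -fd; exact: df.
move=> [e /= e0 he]; exists e => // t ts.
have key : t != s -> `|d - (t - s)^-1 * f t| < d.
  move=> tns; have := he (t - s); rewrite /= sub0r normrN ts => /(_ isT).
  rewrite subr_eq0 => /(_ tns); rewrite scaler1 subrK fs subr0.
  by rewrite /GRing.scale/=.
split=> h.
  have := key (negbT (gt_eqF h)); rewrite ltr_norml => /andP[_ k].
  have : 0 < (t - s)^-1 * f t by lra.
  by rewrite pmulr_rgt0// invr_gt0 subr_gt0.
have := key (negbT (lt_eqF h)); rewrite ltr_norml => /andP[_ k].
have : 0 < (t - s)^-1 * f t by lra.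
by rewrite nmulr_rgt0// invr_lt0 subr_lt0.
Qed.

(** * Tangent lines at boundary points are supporting lines *)

Section OneSided.
Variables (O : set (R * R)) (x y : R -> R) (s tx ty r : R).
Hypothesis cO : convex2 O.
Hypothesis r0 : 0 < r.
Hypothesis dx : is_derive s 1 x tx.
Hypothesis dy : is_derive s 1 y ty.
Hypothesis mem : forall t, `|t - s| < r -> closure O (x t, y t).
Hypothesis nint : ~ interior O (x s, y s).
Let side P := tx * (P.2 - y s) - ty * (P.1 - x s).

Let dside (a b : R) : is_derive s 1 (fun t => a * (y t - y s) - b * (x t - x s)) (a * ty - b * tx).
Proof. by apply: is_derive_eq; rewrite /GRing.scale/=; ring. Qed.

(** The curve point at s would lie inside the triangle formed by P, Q and a nearby curve point,
    taken just after or just before s according to the sign of the determinant; but it is not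
    interior. *)
Let half_case P Q : closure O P -> closure O Q -> 0 < side P -> side Q < 0 ->
  det P Q (x s, y s) != 0 -> False.
Proof.
move=> OP OQ sP sQ dPQ; apply: nint.
have h1 : 0 < (Q.1 - x s) * ty - (Q.2 - y s) * tx by move: sQ; rewrite /side; lra.
have h2 : 0 < - (P.1 - x s) * ty - - (P.2 - y s) * tx by move: sP; rewrite /side; lra.
have [|e1 e10 he1] := derive_sign (dside (Q.1 - x s) (Q.2 - y s)) _ h1.
  by rewrite !subrr !mulr0 subrr.
have [|e2 e20 he2] := derive_sign (dside (- (P.1 - x s)) (- (P.2 - y s))) _ h2.
  by rewrite !subrr !mulr0 subrr.
pose e := Num.min r (Num.min e1 e2) / 2.
have m0 : 0 < Num.min r (Num.min e1 e2) by rewrite !lt_min r0 e10 e20.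
have e0 : 0 < e by rewrite divr_gt0.
have em : e < Num.min r (Num.min e1 e2) by rewrite /e; lra.
have /and3P[er ee1 ee2] : [&& e < r, e < e1 & e < e2] by move: em; rewrite !lt_min.
have ns1 : `|s + e - s| = e by rewrite addrAC subrr add0r gtr0_norm.
have ns2 : `|s - e - s| = e by rewrite addrAC subrr add0r normrN gtr0_norm.
have se : s < s + e by rewrite ltrDl.
have es : s - e < s by rewrite gtrBl.
case: (ltgtP 0 (det P Q (x s, y s))) => [dp|dn|d0]; last by rewrite -d0 eqxx in dPQ.
- have [q1 _] := he1 (s + e) (ltac:(by rewrite ns1)).
  have [q2 _] := he2 (s + e) (ltac:(by rewrite ns1)).
  have OA : closure O (x (s + e), y (s + e)) by apply: mem; rewrite ns1.
  apply: (triangle_interior cO OP OQ OA dp); rewrite /det/=.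
    by move: (q1 se); congr (0 < _); ring.
  by move: (q2 se); congr (0 < _); ring.
- have [_ q1] := he1 (s - e) (ltac:(by rewrite ns2)).
  have [_ q2] := he2 (s - e) (ltac:(by rewrite ns2)).
  have OA : closure O (x (s - e), y (s - e)) by apply: mem; rewrite ns2.
  apply: (triangle_interior cO OQ OP OA).
  + by rewrite -oppr_lt0; move: dn; congr (_ < 0); rewrite /det/=; ring.
  + by rewrite /det/= -oppr_lt0; move: (q2 es); congr (_ < 0); ring.
  + by rewrite /det/= -oppr_lt0; move: (q1 es); congr (_ < 0); ring.
Qed.

(** If P, Q and the curve point are collinear the triangle degenerates. Replacing P by its midpoint
    with a nearby curve point keeps it on the left of the tangent and breaks the collinearity. *)
Lemma tangent_one_sided P Q : closure O P -> closure O Q ->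
  0 < tx * (P.2 - y s) - ty * (P.1 - x s) ->
  tx * (Q.2 - y s) - ty * (Q.1 - x s) < 0 -> False.
Proof.
move=> OP OQ sP sQ.
have [d0|dn] := eqVneq (det P Q (x s, y s)) 0; last exact: half_case OP OQ sP sQ dn.
have h1 : 0 < (Q.1 - x s) * ty - (Q.2 - y s) * tx by lra.
have [|e1 e10 he1] := derive_sign (dside (Q.1 - x s) (Q.2 - y s)) _ h1.
  by rewrite !subrr !mulr0 subrr.
have cside : {for s, continuous (fun t => side P + side (x t, y t))}.
  have cx : {for s, continuous x} by apply: differentiable_continuous; apply/derivable1_diffP; case: dx.
  have cy : {for s, continuous y} by apply: differentiable_continuous; apply/derivable1_diffP; case: dy.
  rewrite /side/=; apply: continuousD; first exact: cvg_cst.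
  by apply: continuousB; (apply: continuousM; first exact: cvg_cst);
    (apply: continuousB; last exact: cvg_cst).
have /(near_pos cside) : 0 < side P + side (x s, y s).
  by rewrite {2}/side/= !subrr !mulr0 subrr addr0.
move=> /nbhs_ballP[e2 /= e20 he2].
pose e := Num.min r (Num.min e1 e2) / 2.
have m0 : 0 < Num.min r (Num.min e1 e2) by rewrite !lt_min r0 e10 e20.
have e0 : 0 < e by rewrite divr_gt0.
have em : e < Num.min r (Num.min e1 e2) by rewrite /e; lra.
have /and3P[er ee1 ee2] : [&& e < r, e < e1 & e < e2] by move: em; rewrite !lt_min.
have ns1 : `|s + e - s| = e by rewrite addrAC subrr add0r gtr0_norm.
have se : s < s + e by rewrite ltrDl.
have [/(_ se) q1 _] := he1 (s + e) (ltac:(by rewrite ns1)).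
have q2 : 0 < side P + side (x (s + e), y (s + e)).
  by apply: he2; rewrite /ball/= distrC ns1.
have OA : closure O (x (s + e), y (s + e)) by apply: mem; rewrite ns1.
have h12 : 0 <= (2^-1 : R) <= 1 by lra.
have OM := convex2_closure cO OP OA h12.
apply: (half_case OM OQ _ sQ).
  set M := (_, _); have -> : side M = (side P + side (x (s + e), y (s + e))) / 2.
    by rewrite /side /M /=; field.
  by rewrite divr_gt0.
set M := (_, _); have -> : det M Q (x s, y s) = 2^-1 * (det P Q (x s, y s) -
   ((Q.1 - x s) * (y (s + e) - y s) - (Q.2 - y s) * (x (s + e) - x s))).
  by rewrite /det /M /=; field.
by rewrite d0 sub0r mulf_neq0// oppr_eq0 gt_eqF.
Qed.

End OneSided.

End ConvexPlane.

Section DeriveTools.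
Variable R : realType.
Implicit Types (s t u a b r d e v : R).

Lemma is_derive_unique (f : R -> R) (s d d' : R) :
  is_derive s 1 f d -> is_derive s 1 f d' -> d = d'.
Proof. by move=> [_ <-] [_ <-]. Qed.

Lemma derive_min0 (f : R -> R) (s d r : R) : is_derive s 1 f d -> f s = 0 ->
  0 < r -> (forall t, `|t - s| < r -> 0 <= f t) -> d = 0.
Proof.
move=> df fs r0 h.
case: (ltgtP d 0) => // d0; exfalso.
- have dg : is_derive s 1 (fun t : R => - f t) (- d) by exact: is_deriveN.
  have [||e e0 he] := derive_sign dg; rewrite ?fs ?oppr0 ?oppr_gt0//.
  pose u := Num.min e r / 2.
  have m0 : 0 < Num.min e r by rewrite lt_min e0.
  have um : u < Num.min e r by rewrite /u; lra.
  have u0 : 0 < u by rewrite /u; lra.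
  have /andP[ue ur] : (u < e) && (u < r) by move: um; rewrite lt_min.
  have n : `|s + u - s| = u by rewrite addrAC subrr add0r gtr0_norm.
  have [h1 _] := he (s + u) (ltac:(by rewrite n)).
  have := h (s + u); rewrite n => /(_ ur).
  have /h1 : s < s + u by rewrite ltrDl.
  by rewrite oppr_gt0 leNgt => ->.
- have [//|e e0 he] := derive_sign df _ d0.
  pose u := Num.min e r / 2.
  have m0 : 0 < Num.min e r by rewrite lt_min e0.
  have um : u < Num.min e r by rewrite /u; lra.
  have u0 : 0 < u by rewrite /u; lra.
  have /andP[ue ur] : (u < e) && (u < r) by move: um; rewrite lt_min.
  have n : `|s - u - s| = u by rewrite addrAC subrr add0r normrN gtr0_norm.
  have [_ h1] := he (s - u) (ltac:(by rewrite n)).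
  have := h (s - u); rewrite n => /(_ ur).
  have /h1 : s - u < s by rewrite gtrBl.
  by rewrite leNgt => ->.
Qed.

Lemma MVT_derive (f df : R -> R) (a b : R) : a < b ->
  (forall t : R, is_derive t 1 f (df t)) ->
  exists t, a < t < b /\ f b - f a = df t * (b - a).
Proof.
move=> ab d; have [|t] := @MVT R f df a b ab (fun t _ => d t).
  by apply: derivable_within_continuous => z _; case: (d z).
by rewrite in_itv/= => tab e; exists t.
Qed.

End DeriveTools.

(** * The set lies on the same side of all tangents *)

Section Orientation.
Variable R : realType.
Implicit Types (s t u a b r d e v : R).
Variables (O : set (R * R)) (x y tx ty f1 f2 : R -> R) (L : R).
Hypothesis cO : convex2 O.
Hypothesis L0 : 0 < L.
Hypothesis dx : forall s : R, is_derive s 1 x (tx s).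
Hypothesis dy : forall s : R, is_derive s 1 y (ty s).
Hypothesis unit : forall s, tx s ^+ 2 + ty s ^+ 2 = 1.
Hypothesis perx : forall s, x (s + L) = x s.
Hypothesis pery : forall s, y (s + L) = y s.
Hypothesis bd : forall s, 0 <= s <= L ->
  closure O (x s, y s) /\ ~ interior O (x s, y s).
Hypothesis txE : abs_cont L tx f1.
Hypothesis tyE : abs_cont L ty f2.

Let c s (P : R * R) := tx s * (P.2 - y s) - ty s * (P.1 - x s).

(** Periodicity extends membership beyond [0, L], so that the two-sided neighbourhoods in
    [tangent_one_sided] are available at the end parameters too. *)
Let mem t : - L < t -> t < L + L -> closure O (x t, y t).
Proof.
move=> t1 t2; have [t0|t0] := ltP t 0.
  by rewrite -perx -pery; apply: (bd _).1; apply/andP; split; lra.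
have [tL|Lt] := leP t L; first by apply: (bd _).1; rewrite t0.
by rewrite -(subrK L t) perx pery; apply: (bd _).1; apply/andP; split; lra.
Qed.

Let sided s P Q : 0 <= s <= L -> closure O P -> closure O Q -> 0 < c s P -> c s Q < 0 -> False.
Proof.
move=> /andP[s0 sL] OP OQ.
apply: (tangent_one_sided cO L0 (dx s) (dy s) _ (bd _).2 OP OQ); last by rewrite s0.
by move=> t; rewrite ltr_norml => /andP[t1 t2]; apply: mem; lra.
Qed.

(** If the closure lay on the tangent line at s, the normal coordinate of the curve would vanish
    throughout; Rolle's theorem for the tangential coordinate then gives a tangent with no component
    in either direction, against unit speed. *)
Let nondeg s : 0 <= s <= L -> exists P, closure O P /\ c s P != 0.
Proof.
move=> hs; apply: contrapT => nex.
have z t : 0 <= t <= L -> c s (x t, y t) = 0.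
  move=> ht; apply/eqP; apply: contrapT => /negP ne; apply: nex.
  by exists (x t, y t); split => //; exact: (bd ht).1.
have dk t : is_derive t 1 (fun t : R => tx s * x t + ty s * y t) (tx s * tx t + ty s * ty t).
  by have := dx t; have := dy t => d1 d2; apply: is_derive_eq; rewrite /GRing.scale/=; ring.
have [t [/andP[t0 tL]]] := MVT_derive L0 dk.
rewrite -[L in x L]add0r -[L in y L]add0r perx pery subrr => /esym/eqP.
rewrite mulf_eq0 subr0 (gt_eqF L0) orbF => /eqP e1.
have dc : is_derive t 1 (fun t : R => c s (x t, y t)) (tx s * ty t - ty s * tx t).
  by have := dx t; have := dy t => d1 d2; apply: is_derive_eq; rewrite /GRing.scale/=; ring.
have e2 : tx s * ty t - ty s * tx t = 0.
  apply: (derive_min0 dc (r := Num.min t (L - t))).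
  - by apply: z; rewrite !ltW.
  - by rewrite lt_min t0 subr_gt0.
  - move=> u; rewrite lt_min => /andP[/ltr_normlP[u1 u2] /ltr_normlP[u3 u4]].
    by rewrite z//; apply/andP; split; lra.
have := unit s; have := unit t.
move: (tx s) (ty s) (tx t) (ty t) e1 e2 => a b a' b' e1 e2 h1 h2.
have : (a * a' + b * b') ^+ 2 + (a * b' - b * a') ^+ 2 = 1.
  transitivity ((a ^+ 2 + b ^+ 2) * (a' ^+ 2 + b' ^+ 2)); first by ring.
  by rewrite h1 h2 mulr1.
by rewrite e1 e2 !expr0n/= addr0 => /esym/eqP; rewrite oner_eq0.
Qed.

(** A point P of the closure off the tangent line at one parameter stays on its side of the nearby
    tangents, and by [sided] it decides the side of the whole set. The side is thus locally
    constant, and [interval_chain] makes it constant. *)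
Lemma orientation :
  (forall s P, 0 <= s <= L -> closure O P -> 0 <= tx s * (P.2 - y s) - ty s * (P.1 - x s)) \/
  (forall s P, 0 <= s <= L -> closure O P -> tx s * (P.2 - y s) - ty s * (P.1 - x s) <= 0).
Proof.
have Lge := ltW L0.
pose S s := forall P, closure O P -> 0 <= c s P.
have T s : 0 <= s <= L -> ~ S s -> forall P, closure O P -> c s P <= 0.
  move=> hs nS P OP; rewrite leNgt; apply/negP => cP; apply: nS => Q OQ.
  by rewrite leNgt; apply/negP => cQ; exact: (sided hs OP OQ).
have cont P : {within `[0, L], continuous (fun s => c s P)}.
  have ax : abs_cont L x tx.
    by apply: abs_cont_C1 => //; exact: abs_cont_continuous Lge txE.
  have ay : abs_cont L y ty.
    by apply: abs_cont_C1 => //; exact: abs_cont_continuous Lge tyE.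
  have a1 := abs_contM Lge txE (abs_contD (abs_cont_cst L P.2) (abs_contN ay)).
  have a2 := abs_contM Lge tyE (abs_contD (abs_cont_cst L P.1) (abs_contN ax)).
  exact: (abs_cont_continuous Lge (abs_contD a1 (abs_contN a2))).
have loc P s : 0 <= s <= L -> c s P != 0 -> exists2 d, 0 < d &
    forall t, 0 <= t <= L -> `|s - t| < d -> `|c s P - c t P| < `|c s P|.
  move=> hs cs; have sL : s \in `[0, L] by rewrite in_itv.
  move/subspace_continuousP : (cont P) => /(_ s sL) /cvgrPdist_lt /(_ `|c s P|).
  rewrite normr_gt0 cs => /(_ isT)[d /= d0 hd].
  by exists d => // t ht st; apply: hd => //=; rewrite in_itv/= ht.
have key : forall s, 0 <= s <= L -> (S 0 <-> S s).
  move=> s /andP[s0 sL].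
  apply: (@interval_chain R (fun u v => S u <-> S v) 0 s s0).
    by move=> u v w [a b] [a' b']; split; [move/a/a'|move/b'/b].
  move=> u /andP[u0 us]; have hu : 0 <= u <= L by rewrite u0 (le_trans us).
  have [P [OP cP]] := nondeg hu.
  have [d d0 hd] := loc P u hu cP.
  have same t : 0 <= t <= L -> `|u - t| < d -> (S u <-> S t).
    move=> ht ut; have := hd t ht ut => h.
    have [cp|cn] : 0 < c u P \/ c u P < 0 by case: (ltgtP (c u P) 0) cP => //; [right|left].
      have ct : 0 < c t P by move: h; rewrite (gtr0_norm cp) ltr_norml; lra.
      split=> _ Q OQ; rewrite leNgt; apply/negP => cQ.
        exact: (sided ht OP OQ ct cQ).
      exact: (sided hu OP OQ cp cQ).
    have ct : c t P < 0 by move: h; rewrite (ltr0_norm cn) ltr_norml; lra.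
    by split=> /(_ P OP); rewrite leNgt ?cn ?ct.
  exists d => // v w v0 ws uv vu uw wu.
  have h1 : S u <-> S v.
    by apply: same; [rewrite v0 (le_trans vu) ?(le_trans us)|rewrite ger0_norm ?subr_ge0//; lra].
  have h2 : S u <-> S w.
    by apply: same; [rewrite (le_trans u0)// (le_trans ws)|rewrite distrC ger0_norm ?subr_ge0//; lra].
  by split=> /h1 || split; [move/h1/h2|move/h2/h1].
have [S0|nS0] := pselect (S 0).
  by left=> s P hs OP; have [/(_ S0) h _] := key s hs; exact: h.
right=> s P hs OP; apply: (T s hs _ P OP) => Ss; apply: nS0.
by have [_ /(_ Ss)] := key s hs.
Qed.

End Orientation.

(** * Total turning of a simple convex curve *)

Section Turning.
Variable R : realType.
Implicit Types (s t u a b r d e v : R).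
Variables (K : set (R * R)) (x y tx ty f1 f2 : R -> R) (L : R).
Hypothesis L0 : 0 < L.
Hypothesis dx : forall s : R, is_derive s 1 x (tx s).
Hypothesis dy : forall s : R, is_derive s 1 y (ty s).
Hypothesis unit : forall s, tx s ^+ 2 + ty s ^+ 2 = 1.
Hypotheses (xL : x L = x 0) (yL : y L = y 0) (txL : tx L = tx 0) (tyL : ty L = ty 0).
Hypothesis inj : forall s t, 0 <= s < L -> 0 <= t < L -> x s = x t -> y s = y t -> s = t.
Hypothesis supp : forall s u, 0 <= s <= L -> 0 <= u <= L ->
  0 <= tx s * (y u - y s) - ty s * (x u - x s).

Section Density.
Hypothesis txE : abs_cont L tx f1.
Hypothesis tyE : abs_cont L ty f2.
Let k1 s := tx s * f2 s - ty s * f1 s.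
Let Lge : 0 <= L. Proof. exact: ltW. Qed.

(** With negative curvature at s the tangent turns right just after s, and by the mean value theorem
    the curve passes to the right of its tangent line at s, against [supp]. *)
Let k1_pos s : 0 < s < L -> is_derive s 1 tx (f1 s) -> is_derive s 1 ty (f2 s) -> 0 <= k1 s.
Proof.
move=> /andP[s0 sL] d1 d2; rewrite leNgt; apply/negP => kn.
have dg : is_derive s 1 (fun t : R => - (tx s * ty t - ty s * tx t)) (- k1 s).
  by apply: is_derive_eq; rewrite /k1 /GRing.scale/=; ring.
have [||e e0 he] := derive_sign dg; rewrite ?oppr_gt0//; first by ring.
pose u := Num.min e (L - s) / 2.
have m0 : 0 < Num.min e (L - s) by rewrite lt_min e0 subr_gt0.
have um : u < Num.min e (L - s) by rewrite /u; lra.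
have u0 : 0 < u by rewrite /u; lra.
have /andP[ue ur] : (u < e) && (u < L - s) by move: um; rewrite lt_min.
have su : s < s + u by rewrite ltrDl.
have df t : is_derive t 1 (fun t : R => tx s * (y t - y s) - ty s * (x t - x s)) (tx s * ty t - ty s * tx t).
  by have := dx t; have := dy t => d1' d2'; apply: is_derive_eq; rewrite /GRing.scale/=; ring.
have [t [/andP[st tu]]] := MVT_derive su df.
rewrite !subrr !mulr0 subrr subr0 addrAC subrr add0r => e1.
have hs : 0 <= s <= L by rewrite !ltW.
have hu : 0 <= s + u <= L by apply/andP; split; lra.
have := supp hs hu; rewrite e1 leNgt => /negP; apply.
have [h _] := he t (ltac:(rewrite gtr0_norm; lra)).
have := h st; rewrite oppr_gt0 => h'.
by rewrite nmulr_rlt0.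
Qed.

(** Unit speed makes the derivative of the tangent orthogonal to it almost everywhere, hence a
    multiple of the normal. The absolute value of that multiple differs from it on a null set only
    and is nonnegative at every parameter. *)
Lemma curvature_density : exists kap : R -> R,
  [/\ forall s, 0 <= kap s, intble L kap,
      abs_cont L tx (fun s => - (kap s * ty s)), abs_cont L ty (fun s => kap s * tx s)
    & ae_on L (fun s => kap s = tx s * f2 s - ty s * f1 s)].
Proof.
have i1 := abs_cont_intble txE; have i2 := abs_cont_intble tyE.
have cx := abs_cont_continuous Lge txE; have cy := abs_cont_continuous Lge tyE.
have ik : intble L k1 by apply: intbleB; exact: intbleM.
have ia := intble_norm ik.
have aek : ae_on L (fun s => `|k1 s| = k1 s /\ (f1 s = - (`|k1 s| * ty s) /\ f2 s = `|k1 s| * tx s)).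
  apply: ae_imply (ae_and (abs_cont_derive txE) (abs_cont_derive tyE)) => s [h1 h2] hs.
  have d1 := h1 hs; have d2 := h2 hs.
  have kE : `|k1 s| = k1 s by rewrite ger0_norm// k1_pos.
  split => //; rewrite kE.
  have du : is_derive s 1 (fun t => tx t ^+ 2 + ty t ^+ 2) (2 * (tx s * f1 s + ty s * f2 s)).
    by apply: is_derive_eq; rewrite /GRing.scale/=; ring.
  have d0 : is_derive s 1 (fun t => tx t ^+ 2 + ty t ^+ 2) 0.
    have -> : (fun t => tx t ^+ 2 + ty t ^+ 2) = (fun=> 1) by apply/funext => t; exact: unit.
    exact: is_derive_cst.
  have e0 : tx s * f1 s + ty s * f2 s = 0.
    by apply/eqP; have /eqP := is_derive_unique du d0; rewrite mulf_eq0 pnatr_eq0.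
  split.
    have -> : f1 s = f1 s * (tx s ^+ 2 + ty s ^+ 2) by rewrite unit mulr1.
    rewrite /k1; have -> : f1 s * (tx s ^+ 2 + ty s ^+ 2) = tx s * (tx s * f1 s + ty s * f2 s) - (tx s * f2 s - ty s * f1 s) * ty s by ring.
    by rewrite e0; ring.
  have -> : f2 s = f2 s * (tx s ^+ 2 + ty s ^+ 2) by rewrite unit mulr1.
  rewrite /k1; have -> : f2 s * (tx s ^+ 2 + ty s ^+ 2) = ty s * (tx s * f1 s + ty s * f2 s) + (tx s * f2 s - ty s * f1 s) * tx s by ring.
  by rewrite e0; ring.
exists (fun s => `|k1 s|); split => //.
- apply: abs_cont_ae txE; last by apply: ae_imply aek => s h /h [_ []].
  have -> : (fun s => - (`|k1 s| * ty s)) = (fun s => - (ty s * `|k1 s|)).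
    by apply/funext => s; rewrite mulrC.
  by apply: intbleN; apply: intbleM.
- apply: abs_cont_ae tyE; last by apply: ae_imply aek => s h /h [_ []].
  have -> : (fun s => `|k1 s| * tx s) = (fun s => tx s * `|k1 s|).
    by apply/funext => s; rewrite mulrC.
  exact: intbleM.
- by apply: ae_imply aek => s h /h [].
Qed.

End Density.

Variable kap : R -> R.
Hypothesis kap0 : forall s, 0 <= kap s.
Hypothesis kapi : intble L kap.
Hypothesis txK : abs_cont L tx (fun s => - (kap s * ty s)).
Hypothesis tyK : abs_cont L ty (fun s => kap s * tx s).
Local Notation psi := (turn kap).
Let Lge : 0 <= L. Proof. exact: ltW. Qed.
Let psi0 : psi 0 = 0. Proof. by rewrite /turn integ_nil. Qed.
Let psi_le a b : 0 <= a -> a <= b -> b <= L -> psi a <= psi b.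
Proof. exact: turn_le. Qed.

Let ivt v : 0 <= v <= psi L -> exists s, 0 <= s <= L /\ psi s = v.
Proof.
move=> /andP[v0 vL].
have cpsi := abs_cont_continuous Lge (abs_cont_turn kapi).
have hv : Num.min (psi 0) (psi L) <= v <= Num.max (psi 0) (psi L).
  by rewrite ge_min le_max psi0 v0 vL orbT.
have [s] := IVT Lge cpsi hv.
by rewrite in_itv/= => hs e; exists s.
Qed.

Let angle : exists th, forall s, 0 <= s <= L ->
  tx s = cos (th + psi s) /\ ty s = sin (th + psi s).
Proof.
have [th [_ c0 s0]] := circle_angle (unit 0).
by exists th; exact: tangent_angle.
Qed.

Let psiL_gt0 : 0 < psi L.
Proof.
rewrite lt_neqAle -{2}psi0 psi_le// andbT; apply/eqP => e.
have z s : 0 <= s <= L -> psi s = 0.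
  move=> /andP[s0 sL]; apply/le_anti/andP; split.
    by have := psi_le s0 sL (lexx L); rewrite -e.
  by have := psi_le (lexx 0) s0 sL; rewrite psi0.
have [th h] := angle.
have h0 : 0 <= (0 : R) <= L by rewrite lexx Lge.
have c s : 0 <= s <= L -> tx s = tx 0 /\ ty s = ty 0.
  by move=> hs; have [-> ->] := h s hs; have [-> ->] := h 0 h0; rewrite (z s hs) psi0.
have [s [/andP[s0 sL]]] := MVT_derive L0 dx.
have [t [/andP[t0 tL]]] := MVT_derive L0 dy.
rewrite xL yL !subrr subr0 => /esym/eqP + /esym/eqP.
rewrite !mulf_eq0 (gt_eqF L0) !orbF (c s _).1 ?(c t _).2 ?ltW//= => /eqP e1 /eqP e2.
by have := unit 0; rewrite e1 e2 expr0n/= addr0 => /eqP; rewrite eq_sym oner_eq0.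
Qed.

Let cos_psiL : cos (psi L) = 1.
Proof.
have [th h] := angle.
have h0 : 0 <= (0 : R) <= L by rewrite lexx Lge.
have hL : 0 <= L <= L by rewrite lexx Lge.
have -> : psi L = (th + psi L) - (th + psi 0) by rewrite psi0; ring.
rewrite cosB -(h L hL).1 -(h L hL).2 -(h 0 h0).1 -(h 0 h0).2 txL tyL -!expr2.
exact: unit.
Qed.

(* At a point of positive curvature the tangent line meets the curve only there,
   so a second point with the same tangent would contradict injectivity. *)
Let psiL_le : psi L <= pi + pi.
Proof.
rewrite leNgt; apply/negP => gt.
(* Half of the excess over one turn: a parameter with angle at most [w] has a partner one full turn
   later that still comes before L. *)
pose w := (psi L - (pi + pi)) / 2.
have p0 := pi_gt0 R.
have w0 : 0 < w by rewrite divr_gt0// subr_gt0.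
have wE : psi L = w + w + (pi + pi) by rewrite /w; field.
have [s' [/andP[s'0 s'L] s'w]] : exists s, 0 <= s <= L /\ psi s = w.
  by apply: ivt; rewrite ltW//= wE; lra.
have [s [hs [ks [d1 d2]]]] : exists s, 0 < s < s' /\
    (kap s != 0 /\ (is_derive s 1 tx (- (kap s * ty s)) /\ is_derive s 1 ty (kap s * tx s))).
  apply: contrapT => nex.
  have aez : ae_on s' (fun s => kap s = 0).
    apply: ae_imply (ae_and (abs_cont_derive txK) (abs_cont_derive tyK)) => s [h1 h2] hs.
    apply/eqP; apply: contrapT => /negP ks; apply: nex; exists s; split => //; split => //.
    by case/andP: hs => a b; split; [apply: h1|apply: h2]; rewrite a (lt_le_trans b).
  have : psi s' = 0.
    rewrite /turn (@ae_eq_integ _ s' _ (fun=> 0)) ?integ_cst ?mul0r//; last exact: intble_cst.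
    exact: (intble_sub kapi).
  by rewrite s'w => e; move: w0; rewrite e ltxx.
have /andP[s0 ss'] := hs.
have sL : s < L by exact: lt_le_trans s'L.
have psw : psi s <= w by rewrite -s'w; exact: psi_le (ltW s0) (ltW ss') s'L.
have ps0 : 0 <= psi s by rewrite -psi0; exact: psi_le (lexx 0) (ltW s0) (ltW sL).
have [t [/andP[t0 tL] tE]] : exists t, 0 <= t <= L /\ psi t = psi s + (pi + pi).
  by apply: ivt; apply/andP; split; lra.
have tL' : t < L.
  by rewrite lt_neqAle tL andbT; apply/eqP => e; move: tE; rewrite e wE; lra.
have hs1 : 0 <= s <= L by rewrite !ltW.
have ht1 : 0 <= t <= L by rewrite t0.
have [th h] := angle.
have [etx ety] : tx t = tx s /\ ty t = ty s.
  have [-> ->] := h t ht1; have [-> ->] := h s hs1.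
  by rewrite tE addrA -mulr2n cosD2pi sinD2pi.
have e1 : tx s * (y t - y s) - ty s * (x t - x s) = 0.
  apply/le_anti; rewrite supp// andbT.
  by have := supp ht1 hs1; rewrite etx ety; lra.
(* The signed distance of the point at t from the tangent line at u is nonnegative and vanishes at u
   = s, so its derivative is zero there. That derivative is minus [kap s] times the tangential
   component of the chord, and [kap s] is not 0. *)
have dg : is_derive s 1 (fun u : R => tx u * (y t - y u) - ty u * (x t - x u))
    (- kap s * (tx s * (x t - x s) + ty s * (y t - y s))).
  by have := dx s; have := dy s => d3 d4; apply: is_derive_eq; rewrite /GRing.scale/=; ring.
have e2 : tx s * (x t - x s) + ty s * (y t - y s) = 0.
  apply/eqP; have /eqP : - kap s * (tx s * (x t - x s) + ty s * (y t - y s)) = 0.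
    apply: (derive_min0 dg e1 (r := Num.min s (L - s))); first by rewrite lt_min s0 subr_gt0.
    move=> u; rewrite lt_min => /andP[/ltr_normlP[u1 u2] /ltr_normlP[u3 u4]].
    by apply: supp => //; apply/andP; split; lra.
  by rewrite mulf_eq0 oppr_eq0 (negbTE ks).
have ex : x t - x s = 0.
  transitivity (tx s * (tx s * (x t - x s) + ty s * (y t - y s)) - ty s * (tx s * (y t - y s) - ty s * (x t - x s))).
    by rewrite -[LHS]mulr1 -(unit s); ring.
  by rewrite e1 e2; ring.
have ey : y t - y s = 0.
  transitivity (ty s * (tx s * (x t - x s) + ty s * (y t - y s)) + tx s * (tx s * (y t - y s) - ty s * (x t - x s))).
    by rewrite -[LHS]mulr1 -(unit s); ring.
  by rewrite e1 e2; ring.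
have := inj (s := t) (t := s); rewrite t0 tL' ltW//= sL => /(_ isT isT (subr0_eq ex) (subr0_eq ey)).
by move=> e; move: tE; rewrite e; lra.
Qed.

(** The tangent closes up, so cos (psi L) = 1, while psi L is positive and at most one turn.
    Strictly below one turn, 1 - cos (psi L) = 2 sin (psi L / 2) ^ 2 would be positive. *)
Lemma total_turning : psi L = pi + pi.
Proof.
apply/le_anti; rewrite psiL_le/= leNgt; apply/negP => lt.
have h : 0 < psi L / 2 < pi.
  by apply/andP; split; [exact: divr_gt0|rewrite ltr_pdivrMr//; lra].
have := sin_gt0_pi h => s0.
have : cos (psi L) = 1 - 2 * sin (psi L / 2) ^+ 2.
  set q := psi L / 2; have -> : psi L = q + q by rewrite /q; field.
  by rewrite cosD -!expr2 cos2sin2; ring.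
rewrite cos_psiL => e.
have : 0 < sin (psi L / 2) ^+ 2 by rewrite exprn_gt0.
lra.
Qed.

End Turning.

(** * Area of plane convex bodies *)

Section Region.
Variable R : realType.
Notation mu := (@lebesgue_measure R).
Implicit Types (K : set (R * R)) (l u : R -> R) (x X Y : R).

Definition region K x0 x1 l u : Prop :=
  [/\ x0 <= x1, continuous l, continuous u,
      (forall X, x0 <= X <= x1 -> l X <= u X)
    & forall X Y, K (X, Y) <-> x0 <= X <= x1 /\ l X <= Y <= u X].

Lemma continuous_sub (f g : R -> R) : continuous f -> continuous g ->
  continuous (fun s => f s - g s).
Proof. by move=> cf cg s; apply: continuousB; [exact: cf|exact: cg]. Qed.

Lemma region_area K x0 x1 l u : region K x0 x1 l u ->
  (mu \x mu)%E K = (integ (fun s => u s - l s) x0 x1)%:E.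
Proof.
move=> [x01 cl cu lu Kdef].
have ci : mu.-integrable `[x0, x1] (EFin \o (fun s => u s - l s)).
  apply: continuous_compact_integrable; first exact: segment_compact.
  exact/continuous_subspaceT/continuous_sub.
rewrite /integ /Rintegral fineK; last exact: integrable_fin_num.
rewrite /product_measure1/= [RHS]integral_mkcond.
apply: eq_integral => X _ /=; rewrite patchE.
case: ifPn => hX.
  have {}hX : x0 <= X <= x1 by move: hX; rewrite inE/= in_itv.
  have -> : xsection K X = `[l X, u X]%classic.
    apply/seteqP; split => Y; rewrite /xsection/= inE in_itv/=.
      by move/Kdef => [].
    by move=> h; apply/Kdef.
  rewrite lebesgue_measure_itv/= lte_fin; case: ltP => // h.
  by have -> : u X = l X; [apply/le_anti; rewrite h lu|rewrite subrr].
have -> : xsection K X = set0.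
  apply/seteqP; split => Y //; rewrite /xsection/= inE => /Kdef[hX' _].
  by move: hX; rewrite notin_setE/= in_itv/=.
exact: measure0.
Qed.

Lemma closed_bounded_compact K : closed K -> bounded2 K -> compact K.
Proof.
move=> cK [M hM].
apply: (@subclosed_compact _ K (`[- M, M]%classic `*` `[- M, M]%classic)) => //.
  by apply: compact_setX; exact: segment_compact.
move=> z /hM [h1 h2]; split; rewrite /= in_itv/= -ler_norml//.
Qed.

Section Lower.
Variable K : set (R * R).
Hypothesis cK : closed K.
Hypothesis bK : bounded2 K.
Hypothesis vK : convex2 K.
Variables x0 x1 : R.
Hypothesis x01 : x0 <= x1.
Hypothesis slice : forall X, x0 <= X <= x1 -> exists Y, K (X, Y).

Let l0 X := inf [set Y | K (X, Y)].

Let l0P X : x0 <= X <= x1 -> K (X, l0 X) /\ forall Y, K (X, Y) -> l0 X <= Y.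
Proof.
move=> hX; have [M hM] := bK.
have lb : has_lbound [set Y | K (X, Y)].
  by exists (- M) => Y /hM [_]; rewrite /= ler_norml => /andP[].
split; last by move=> Y hY; exact: ge_inf.
apply: (@closed_inf_mem R [set Y | K (X, Y)]) => //.
  by have [Y hY] := slice hX; exists Y.
apply: (@preimage_closed _ _ (fun Y : R => (X, Y)) K) => // Y _.
by apply: (@continuous_pair R R R (fun=> X) id) => z; [exact: cvg_cst|exact: cvg_id].
Qed.

(** The segment from the boundary point over Xs to the one over E lies in the set, so the lower
    boundary runs below it; this bounds [l0] from above near Xs on the side of E. *)
Let upper_side Xs E (e : R) : x0 <= Xs <= x1 -> x0 <= E <= x1 -> 0 < e ->
  exists2 d, 0 < d & forall X, `|X - Xs| < d ->
    (Xs <= X <= E) || (E <= X <= Xs) -> l0 X < l0 Xs + e.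
Proof.
move=> hXs hE e0; have [M hM] := bK.
have [EX|EX] := eqVneq E Xs.
  exists 1 => // X _; rewrite EX => /orP[|] /andP[a b];
    have -> : X = Xs by apply/le_anti; rewrite a b.
  - by rewrite ltrDl.
  - by rewrite ltrDl.
have M0 : 0 <= M by have [h _] := hM _ (l0P hXs).1; exact: le_trans (normr_ge0 _) h.
have n0 : 0 < `|E - Xs| by rewrite normr_gt0 subr_eq0.
exists (e * `|E - Xs| / (2 * M + 1)).
  by rewrite divr_gt0// ?mulr_gt0//; lra.
move=> X Xd side.
pose t := (X - Xs) / (E - Xs).
have t0 : 0 <= t.
  case/orP: side => /andP[a b]; first by rewrite divr_ge0//; lra.
  by rewrite /t -mulrNN -invrN divr_ge0//; lra.
have tn : t = `|X - Xs| / `|E - Xs| by rewrite -normf_div ger0_norm.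
have t1 : t <= 1.
  by rewrite tn ler_pdivrMr// mul1r; case/orP: side => /andP[a b];
    [rewrite !ger0_norm ?subr_ge0//; lra | rewrite !ler0_norm ?subr_le0//; lra].
have t01 : 0 <= t <= 1 by rewrite t0.
have := vK (l0P hXs).1 (l0P hE).1 t01; rewrite /=.
have -> : (1 - t) * Xs + t * E = X.
  have EX' : E - Xs != 0 by rewrite subr_eq0.
  by rewrite /t; field.
have hX : x0 <= X <= x1.
  by case/andP: (hXs) => p1 p2; case/andP: (hE) => p3 p4; case/orP: side => /andP[a b]; apply/andP; split; lra.
move=> /(l0P hX).2 h; apply: (le_lt_trans h).
have [_ h1] := hM _ (l0P hXs).1; have [_ h2] := hM _ (l0P hE).1.
move: h1 h2; rewrite /= !ler_norml => /andP[h1 h1'] /andP[h2 h2'].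
have te : t * (2 * M + 1) < e.
  rewrite tn mulrAC ltr_pdivrMr// -ltr_pdivlMr//; last by lra.
have -> : (1 - t) * l0 Xs + t * l0 E = l0 Xs + t * (l0 E - l0 Xs) by ring.
rewrite ltrD2l; apply: le_lt_trans te.
by apply: ler_wpM2l => //; lra.
Qed.

Lemma lower_boundary : exists l : R -> R, [/\ continuous l,
  (forall X, x0 <= X <= x1 -> K (X, l X)) &
  forall X Y, x0 <= X <= x1 -> K (X, Y) -> l X <= Y].
Proof.
exists (l0 \o clamp x0 x1); split; first last.
- by move=> X Y hX hY; rewrite /= clamp_id//; exact: (l0P hX).2.
- by move=> X hX; rewrite /= clamp_id//; exact: (l0P hX).1.
apply: continuous_clamp => //; apply/subspace_continuousP => Xs /= hXs.
have {}hXs : x0 <= Xs <= x1 by move: hXs; rewrite in_itv.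
apply/cvgrPdist_lt => e e0.
have h0 : x0 <= x0 <= x1 by rewrite lexx.
have h1 : x0 <= x1 <= x1 by rewrite lexx x01.
have [d1 d10 H1] := upper_side hXs h0 e0.
have [d2 d20 H2] := upper_side hXs h1 e0.
(* Lower semicontinuity comes from compactness: the part of K at height at most [l0 Xs - e] projects
   onto a closed set of abscissas that misses Xs. *)
pose C := K `&` [set z | z.2 <= l0 Xs - e].
have cC : compact C.
  apply: closed_bounded_compact; last by have [M hM] := bK; exists M => z [/hM].
  apply: closedI => //; apply: (@preimage_closed _ _ snd [set Y | Y <= l0 Xs - e]).
    by move=> z _; exact: cvg_snd.
  exact: closed_le.
have cl : closed (fst @` C).
  apply: compact_closed; first exact: Rhausdorff.
  by apply: continuous_compact => //; apply: continuous_subspaceT => z; exact: cvg_fst.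
have nXs : (~` (fst @` C)) Xs.
  move=> [[X Y] [KXY /= hY] /= XE]; move: KXY; rewrite XE => /(l0P hXs).2.
  lra.
have /open_nbhs_nbhs n3 : open_nbhs Xs (~` (fst @` C)) by split => //; exact: closed_openC.
apply: filterS (filterI n3 (filterI (nbhsx_ballx Xs d1 d10) (nbhsx_ballx Xs d2 d20))) => X [c3 [b1 b2]] /=.
rewrite in_itv/= => hX.
have b1' : `|X - Xs| < d1 by rewrite distrC.
have b2' : `|X - Xs| < d2 by rewrite distrC.
have up : l0 X < l0 Xs + e.
  have [XX|XX] := leP X Xs.
    by apply: H1 => //; case/andP: hX => -> _; rewrite XX orbT.
  by apply: H2 => //; case/andP: hX => _ ->; rewrite ltW.
have lo : l0 Xs - e < l0 X.
  rewrite ltNge; apply/negP => h; apply: c3; exists (X, l0 X) => //.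
  by split => //; exact: (l0P hX).1.
by rewrite ltr_norml; apply/andP; split; lra.
Qed.

End Lower.

(** Compactness gives the extreme abscissas, and convexity a nonempty section over each abscissa
    between them. The upper boundary comes from the lower boundary of the set mirrored in the
    horizontal axis. *)
Lemma convex_region K : closed K -> bounded2 K -> convex2 K -> K !=set0 ->
  exists x0 x1 l u, region K x0 x1 l u.
Proof.
move=> cK bK vK K0.
have cpK := closed_bounded_compact cK bK.
have cf : {within K, continuous (fst : R * R -> R)}.
  by apply: continuous_subspaceT => z; exact: cvg_fst.
have [P0 /set_mem KP0 min0] := compact_EVT_min K0 cpK cf.
have [P1 /set_mem KP1 max1] := compact_EVT_max K0 cpK cf.
have rng X Y : K (X, Y) -> P0.1 <= X <= P1.1.
  by move=> h; rewrite (min0 (X, Y))/= ?(max1 (X, Y))//=; exact: mem_set.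
have x01 : P0.1 <= P1.1 by apply: min0; exact: mem_set.
have slice X : P0.1 <= X <= P1.1 -> exists Y, K (X, Y).
  move=> /andP[h0 h1].
  have [e|ne] := eqVneq P0.1 P1.1.
    exists P0.2; have -> : X = P0.1 by apply/le_anti; rewrite h0 e h1.
    by rewrite -surjective_pairing.
  have d0 : 0 < P1.1 - P0.1 by rewrite subr_gt0 lt_neqAle ne.
  pose t := (X - P0.1) / (P1.1 - P0.1).
  have t01 : 0 <= t <= 1.
    by rewrite /t divr_ge0 ?subr_ge0//= ler_pdivrMr// mul1r lerD2r.
  have := vK _ _ KP0 KP1 t t01.
  have -> : (1 - t) * P0.1 + t * P1.1 = X by rewrite /t; field; rewrite gt_eqF.
  by move=> h; eexists; exact: h.
have [l [cl l1 l2]] := lower_boundary cK bK vK x01 slice.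
pose K' := [set z : R * R | K (z.1, - z.2)].
have cK' : closed K'.
  apply: (@preimage_closed _ _ (fun z : R * R => (z.1, - z.2)) K) => // z _.
  apply: (@continuous_pair _ _ _ fst (fun z => - z.2)) => w; first exact: cvg_fst.
  by apply: continuousN; exact: cvg_snd.
have bK' : bounded2 K'.
  by have [M hM] := bK; exists M => z /hM /=; rewrite normrN.
have vK' : convex2 K'.
  move=> P Q hP hQ t t01; have := vK _ _ hP hQ t t01.
  by rewrite /K' /=; congr (K (_, _)); ring.
have slice' X : P0.1 <= X <= P1.1 -> exists Y, K' (X, Y).
  by move=> /slice [Y h]; exists (- Y); rewrite /K'/= opprK.
have [u [cu u1 u2]] := lower_boundary cK' bK' vK' x01 slice'.
have u1' X : P0.1 <= X <= P1.1 -> K (X, - u X) by move=> /u1.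
have u2' X Y : P0.1 <= X <= P1.1 -> K (X, Y) -> Y <= - u X.
  by move=> hX h; rewrite lerNr; apply: u2 => //; rewrite /K'/= opprK.
exists P0.1, P1.1, l, (fun X => - u X); split => //.
- by move=> z; apply: continuousN; exact: cu.
- by move=> X hX; apply: l2 => //; exact: u1'.
move=> X Y; split.
  by move=> h; have hX := rng _ _ h; rewrite hX l2//= u2'.
move=> [hX /andP[h1 h2]].
have [e|ne] := eqVneq (l X) (- u X).
  by have -> : Y = l X; [apply/le_anti; rewrite h1 e h2|exact: l1].
have d0 : 0 < - u X - l X.
  by rewrite subr_gt0 lt_neqAle ne (le_trans h1).
pose t := (Y - l X) / (- u X - l X).
have t01 : 0 <= t <= 1.
  apply/andP; split; last by rewrite ler_pdivrMr// mul1r lerD2r.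
  by apply: divr_ge0; [rewrite subr_ge0|exact: ltW].
have := vK _ _ (l1 X hX) (u1' X hX) t t01; rewrite /=.
have -> : (1 - t) * X + t * X = X by ring.
by have -> : (1 - t) * l X + t * - u X = Y by rewrite /t; field; rewrite gt_eqF.
Qed.

End Region.

(** * Signed area of the curve against area between the graphs *)

Section EnclosedArea.
Variable R : realType.
Notation mu := (@lebesgue_measure R).
Implicit Types (f : R -> R) (a b c s t v z : R).

Lemma continuous_integrable f a b : continuous f -> mu.-integrable `[a, b] (EFin \o f).
Proof.
move=> cf; apply: continuous_compact_integrable; first exact: segment_compact.
exact: continuous_subspaceT.
Qed.

Lemma integ_split f c a b : continuous f -> c <= a -> a <= b -> integ f c b = integ f c a + integ f a b.
Proof.
move=> cf ca ab; rewrite /integ.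
have h := @Rintegral_itvB R f (BLeft c) (BRight b) a (continuous_integrable c b cf).
apply/eqP; rewrite addrC -subr_eq h ?bnd_simp//.
rewrite Rintegral_itv_obnd_cbnd//.
apply: integrableS (continuous_integrable c b cf) => //.
by apply: subset_itv; rewrite bnd_simp.
Qed.

Lemma is_derive_primitive f c z : continuous f -> c < z ->
  is_derive z 1 (fun t => integ f c t) (f z).
Proof.
move=> cf cz.
have zz : z < z + 1 by rewrite ltrDl.
have [d1 d2] := continuous_FTC1_closed zz (continuous_integrable c (z + 1) cf) cz (cf z).
by split; [exact: d1|rewrite -derive1E; exact: d2].
Qed.

Lemma cos_sign v (h := pi / 2 : R) :
  [/\ - h <= v <= h -> 0 <= cos v,
      h <= v <= h *+ 3 -> cos v <= 0,
      h *+ 3 <= v <= h *+ 5 -> 0 <= cos v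
    & h *+ 5 <= v <= h *+ 7 -> cos v <= 0].
Proof.
have piE : pi = h + h by rewrite -splitr.
have pos w : - h <= w <= h -> 0 <= cos w by exact: cos_ge0_pihalf.
have e1 : cos v = - cos (v - pi) by rewrite -cosDpi subrK.
have e2 : cos v = cos (v - pi - pi) by rewrite -[in LHS](subrK pi v) cosDpi -[in LHS](subrK pi (v - pi)) cosDpi opprK.
have e3 : cos v = - cos (v - pi - pi - pi) by rewrite e2 -[in LHS](subrK pi (v - pi - pi)) cosDpi.
split=> // /andP[h1 h2].
- by apply: pos; rewrite h1.
- by rewrite e1 oppr_le0 pos// piE; apply/andP; split; lra.
- by rewrite e2 pos// piE; apply/andP; split; lra.
- by rewrite e3 oppr_le0 pos// piE; apply/andP; split; lra.
Qed.

Variables (K : set (R * R)) (x0 x1 : R) (l u : R -> R).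
Hypothesis KE : region K x0 x1 l u.
Variables (L : R) (kap x y tx ty : R -> R).
Hypothesis L0 : 0 < L.
Hypothesis kap0 : forall s, 0 <= kap s.
Hypothesis kapi : intble L kap.
Hypothesis xE : abs_cont L x tx.
Hypothesis yE : abs_cont L y ty.
Hypothesis txE : abs_cont L tx (fun s => - (kap s * ty s)).
Hypothesis tyE : abs_cont L ty (fun s => kap s * tx s).
Hypothesis unit : forall s, tx s ^+ 2 + ty s ^+ 2 = 1.
Hypotheses (xL : x L = x 0) (yL : y L = y 0).
Local Notation psi := (turn kap).
Hypothesis psiL : psi L = pi + pi.
Hypothesis mem : forall s, 0 <= s <= L -> K (x s, y s).
Hypothesis suppK : forall s P, 0 <= s <= L -> K P ->
  0 <= tx s * (P.2 - y s) - ty s * (P.1 - x s).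

Let Lge : 0 <= L. Proof. exact: ltW. Qed.
Let x01 : x0 <= x1. Proof. by have [] := KE. Qed.
Let cl : continuous l. Proof. by have [] := KE. Qed.
Let cu : continuous u. Proof. by have [] := KE. Qed.
Let lu z : x0 <= z <= x1 -> l z <= u z. Proof. by have [_ _ _ h _] := KE; exact: h. Qed.
Let Kdef z w : K (z, w) <-> x0 <= z <= x1 /\ l z <= w <= u z.
Proof. by have [] := KE. Qed.

Let rng s : 0 <= s <= L -> x0 <= x s <= x1.
Proof. by move=> /mem /Kdef []. Qed.

(** The primitives start strictly to the left of the body, so that they are differentiable at the
    abscissa x0 as well. *)
Let Prim f z := integ f (x0 - 1) z.

Let prim_comp f : continuous f -> abs_cont L (Prim f \o x) (fun s => f (x s) * tx s).
Proof.
move=> cf; apply: (@abs_cont_comp _ L x tx (Prim f) f Lge xE).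
  move=> s /rng /andP[h _]; apply: is_derive_primitive => //; lra.
by move=> s; apply: (@continuous_comp (subspace `[0, L]) _ _ x f);
  [exact: (abs_cont_continuous Lge xE)|exact: cf].
Qed.

(** The point of K at height [l (x s)] lies to the left of the tangent; with a rightward tangent
    this puts the curve point no higher. The factor [tx s] makes the equation trivial at vertical
    tangents, where the heights may differ. *)
Let lowerE s : 0 <= s <= L -> 0 <= tx s -> y s * tx s = l (x s) * tx s.
Proof.
move=> hs; rewrite le_eqVlt => /orP[/eqP<-|t0]; first by rewrite !mulr0.
congr (_ * _); apply/le_anti; have := mem hs; move/Kdef => [hx /andP[h1 _]].
rewrite h1 andbT.
have Kl : K (x s, l (x s)) by apply/Kdef; rewrite lexx lu.
have := suppK hs Kl; rewrite /= subrr mulr0 subr0 pmulr_rge0// subr_ge0.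
by [].
Qed.

Let upperE s : 0 <= s <= L -> tx s <= 0 -> y s * tx s = u (x s) * tx s.
Proof.
move=> hs; rewrite le_eqVlt => /orP[/eqP->|t0]; first by rewrite !mulr0.
congr (_ * _); apply/le_anti; have := mem hs; move/Kdef => [hx /andP[_ h1]].
rewrite h1 /=.
have Kl : K (x s, u (x s)) by apply/Kdef; rewrite lexx lu.
have := suppK hs Kl; rewrite /= subrr mulr0 subr0 nmulr_rge0// subr_le0.
by [].
Qed.

Let sub a b s : 0 <= a -> b <= L -> a <= s <= b -> 0 <= s <= L.
Proof. by move=> a0 bL /andP[h1 h2]; rewrite (le_trans a0) ?(le_trans h2). Qed.

Let piece_l a b : 0 <= a -> a <= b -> b <= L -> (forall s, a <= s <= b -> 0 <= tx s) ->
  integ (fun s => y s * tx s) a b = Prim l (x b) - Prim l (x a).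
Proof.
move=> a0 ab bL h; rewrite -[RHS]/((Prim l \o x) b - (Prim l \o x) a).
rewrite (abs_contB (prim_comp cl))//; apply: eq_integ => s hs.
by apply: lowerE; [exact: sub hs|exact: h].
Qed.

Let piece_u a b : 0 <= a -> a <= b -> b <= L -> (forall s, a <= s <= b -> tx s <= 0) ->
  integ (fun s => y s * tx s) a b = Prim u (x b) - Prim u (x a).
Proof.
move=> a0 ab bL h; rewrite -[RHS]/((Prim u \o x) b - (Prim u \o x) a).
rewrite (abs_contB (prim_comp cu))//; apply: eq_integ => s hs.
by apply: upperE; [exact: sub hs|exact: h].
Qed.

Let W z := Prim u z - Prim l z.
Let A := integ (fun s => u s - l s) x0 x1.

Let cul : continuous (fun s => u s - l s).
Proof. exact: continuous_sub. Qed.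

Let W_diff a b : x0 <= a -> a <= b -> W b - W a = integ (fun s => u s - l s) a b.
Proof.
move=> xa ab.
have xa' : x0 - 1 <= a by lra.
rewrite /W /Prim (integ_split cu xa' ab) (integ_split cl xa' ab).
rewrite [RHS]/integ RintegralB//; try exact: continuous_integrable.
by rewrite -/(integ u a b) -/(integ l a b); ring.
Qed.

(** Increments of W from left to right are areas of vertical strips of the body: nonnegative and at
    most the whole. *)
Let W_le a b : x0 <= a <= x1 -> x0 <= b <= x1 -> W a - W b <= A.
Proof.
move=> /andP[a0 a1] /andP[b0 b1].
have pos c d : x0 <= c -> d <= x1 -> 0 <= integ (fun s => u s - l s) c d.
  move=> h1 h2; apply: integ_ge0 => s /andP[s1 s2]; rewrite subr_ge0 lu//.
  by rewrite (le_trans h1)// (le_trans s2).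
have [ba|ab] := leP b a.
  rewrite W_diff// /A (integ_split cul b0 b1) (integ_split cul ba a1).
  by have := pos x0 b (lexx _) b1; have := pos a x1 a0 (lexx _); lra.
have e := W_diff a0 (ltW ab); have h1 := pos a b a0 b1.
have h2 : 0 <= A by exact: pos.
lra.
Qed.

Let ivt v : 0 <= v <= psi L -> exists s, 0 <= s <= L /\ psi s = v.
Proof.
move=> /andP[v0 vL].
have cpsi := abs_cont_continuous Lge (abs_cont_turn kapi).
have psi0 : psi 0 = 0 by rewrite /turn integ_nil.
have hv : Num.min (psi 0) (psi L) <= v <= Num.max (psi 0) (psi L).
  by rewrite ge_min le_max psi0 v0 vL orbT.
have [s] := IVT Lge cpsi hv.
by rewrite in_itv/= => hs e; exists s.
Qed.

Let ixy : integ (fun s => x s * ty s) 0 L = - integ (fun s => y s * tx s) 0 L.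
Proof.
have i1 : intble L (fun s => x s * ty s).
  by apply: intbleM; [exact: abs_cont_continuous Lge xE|exact: abs_cont_intble yE].
have i2 : intble L (fun s => y s * tx s).
  by apply: intbleM; [exact: abs_cont_continuous Lge yE|exact: abs_cont_intble xE].
apply/eqP; rewrite -subr_eq0 opprK -(integD i1 i2)//; apply/eqP.
transitivity (x L * y L - x 0 * y 0); last by rewrite xL yL subrr.
rewrite (abs_contB (abs_contM Lge xE yE))//; apply: eq_integ => s _; ring.
Qed.

Let signed_areaE : signed_area L x y tx ty = - integ (fun s => y s * tx s) 0 L.
Proof.
have i1 : intble L (fun s => x s * ty s).
  by apply: intbleM; [exact: abs_cont_continuous Lge xE|exact: abs_cont_intble yE].
have i2 : intble L (fun s => y s * tx s).
  by apply: intbleM; [exact: abs_cont_continuous Lge yE|exact: abs_cont_intble xE].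
by rewrite /signed_area (integB i1 i2)// ixy; field.
Qed.

(* The curve runs along the lower boundary where [tx >= 0] and along the upper
   one where [tx <= 0]; cutting at the two points with vertical tangent, the sum of the
   increments of the primitives telescopes. *)
Lemma signed_area_le_region : signed_area L x y tx ty <= integ (fun s => u s - l s) x0 x1.
Proof.
rewrite signed_areaE -/A.
pose h : R := pi / 2.
have piE : pi = h + h by rewrite -splitr.
have h0 : 0 < h by rewrite divr_gt0// pi_gt0.
have psi0 : psi 0 = 0 by rewrite /turn integ_nil.
have psi_le a b : 0 <= a -> a <= b -> b <= L -> psi a <= psi b by exact: turn_le.
have lt_of a b : a <= L -> 0 <= b -> psi a < psi b -> a <= b.
  move=> aL b0 ab; rewrite leNgt; apply/negP => /ltW ba.
  by have := psi_le b a b0 ba aL; rewrite leNgt ab.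
have iy : intble L (fun s => y s * tx s).
  by apply: intbleM; [exact: abs_cont_continuous Lge yE|exact: abs_cont_intble xE].
have u0 := unit 0.
have ty1 : -1 <= ty 0 <= 1.
  by rewrite -ler_norml -(@ler_pXn2r _ 2%N)// ?nnegrE// real_normK ?num_real// expr1n; nra.
have cE : cos (asin (ty 0)) = `|tx 0|.
  by rewrite cos_asin// -u0 addrK sqrtr_sqr.
have sE : sin (asin (ty 0)) = ty 0 by rewrite asinK// in_itv.
have r1 := asin_geNpi2 ty1; have r2 := asin_lepi2 ty1.
(* The sign of [tx 0] decides whether the pieces are lower, upper, lower or upper, lower, upper. The
   start angle is taken in [-pi / 2, pi / 2] or in [pi / 2, 3 pi / 2], and at [al] and [be] the
   angle reaches the next odd multiples of pi / 2. *)
have [t0|t0] := leP 0 (tx 0).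
- have ta : forall s, 0 <= s <= L -> tx s = cos (asin (ty 0) + psi s) /\ ty s = sin (asin (ty 0) + psi s).
    by apply: tangent_angle => //; rewrite cE ger0_norm.
  move: (asin (ty 0)) r1 r2 ta => th; rewrite -/h => r1 r2 ta.
  have [al [/andP[al0 alL] alE]] : exists s, 0 <= s <= L /\ psi s = h - th.
    by apply: ivt; rewrite psiL piE; apply/andP; split; lra.
  have [be [/andP[be0 beL] beE]] : exists s, 0 <= s <= L /\ psi s = h *+ 3 - th.
    by apply: ivt; rewrite psiL piE; apply/andP; split; lra.
  have ab : al <= be by apply: lt_of => //; rewrite alE beE; lra.
  rewrite (integ_cat iy (lexx 0) al0 alL (lexx L)) (integ_cat iy al0 ab beL (lexx L)).
  rewrite piece_l//; last first.
    move=> s /andP[s1 s2]; rewrite (ta s _).1 ?s1 ?(le_trans s2)//.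
    have [c1 _ _ _] := cos_sign (th + psi s); apply: c1.
    by have := psi_le 0 s (lexx 0) s1 (le_trans s2 alL); have := psi_le s al s1 s2 alL;
      rewrite psi0 alE -/h => *; apply/andP; split; lra.
  rewrite piece_u//; last first.
    move=> s /andP[s1 s2]; have s0 := le_trans al0 s1; rewrite (ta s _).1 ?s0 ?(le_trans s2)//.
    have [_ c1 _ _] := cos_sign (th + psi s); apply: c1.
    by have := psi_le al s al0 s1 (le_trans s2 beL); have := psi_le s be s0 s2 beL;
      rewrite beE alE -/h => *; apply/andP; split; lra.
  rewrite piece_l//; last first.
    move=> s /andP[s1 s2]; have s0 := le_trans be0 s1; rewrite (ta s _).1 ?s0 ?s2//.
    have [_ _ c1 _] := cos_sign (th + psi s); apply: c1.
    by have := psi_le be s be0 s1 s2; have := psi_le s L s0 s2 (lexx L);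
      rewrite beE psiL piE -/h => *; apply/andP; split; lra.
  have := W_le (rng (s := al) _) (rng (s := be) _).
  rewrite al0 alL be0 beL => /(_ isT isT); rewrite /W xL; lra.
- have ta : forall s, 0 <= s <= L -> tx s = cos (pi - asin (ty 0) + psi s) /\ ty s = sin (pi - asin (ty 0) + psi s).
    apply: tangent_angle => //; rewrite addrC ?cosDpi ?sinDpi ?cosN ?sinN ?cE ?sE ?opprK//.
    by rewrite ltr0_norm// opprK.
  move: (asin (ty 0)) r1 r2 ta => th'; rewrite -/h => r1 r2.
  have : h <= pi - th' <= h *+ 3 by rewrite piE; apply/andP; split; lra.
  move: (pi - th') => th /andP[{}r1 {}r2] ta.
  have [al [/andP[al0 alL] alE]] : exists s, 0 <= s <= L /\ psi s = h *+ 3 - th.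
    by apply: ivt; rewrite psiL piE; apply/andP; split; lra.
  have [be [/andP[be0 beL] beE]] : exists s, 0 <= s <= L /\ psi s = h *+ 5 - th.
    by apply: ivt; rewrite psiL piE; apply/andP; split; lra.
  have ab : al <= be by apply: lt_of => //; rewrite alE beE; lra.
  rewrite (integ_cat iy (lexx 0) al0 alL (lexx L)) (integ_cat iy al0 ab beL (lexx L)).
  rewrite piece_u//; last first.
    move=> s /andP[s1 s2]; rewrite (ta s _).1 ?s1 ?(le_trans s2)//.
    have [_ c1 _ _] := cos_sign (th + psi s); apply: c1.
    by have := psi_le 0 s (lexx 0) s1 (le_trans s2 alL); have := psi_le s al s1 s2 alL;
      rewrite psi0 alE -/h => *; apply/andP; split; lra.
  rewrite piece_l//; last first.
    move=> s /andP[s1 s2]; have s0 := le_trans al0 s1; rewrite (ta s _).1 ?s0 ?(le_trans s2)//.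
    have [_ _ c1 _] := cos_sign (th + psi s); apply: c1.
    by have := psi_le al s al0 s1 (le_trans s2 beL); have := psi_le s be s0 s2 beL;
      rewrite beE alE -/h => *; apply/andP; split; lra.
  rewrite piece_u//; last first.
    move=> s /andP[s1 s2]; have s0 := le_trans be0 s1; rewrite (ta s _).1 ?s0 ?s2//.
    have [_ _ _ c1] := cos_sign (th + psi s); apply: c1.
    by have := psi_le be s be0 s1 s2; have := psi_le s L s0 s2 (lexx L);
      rewrite beE psiL piE -/h => *; apply/andP; split; lra.
  have := W_le (rng (s := be) _) (rng (s := al) _).
  rewrite al0 alL be0 beL => /(_ isT isT); rewrite /W xL; lra.
Qed.

End EnclosedArea.

(** * Discs *)

Section NonMeasurable.
Import HBNNSimple.
Variable R : realType.
Notation mu := (@lebesgue_measure R).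

(* [f] need not be measurable, so the comparison is made on the simple functions
   below [f], cut off on the null set. *)
Lemma ge0_le_integral_null (D N : set R) (f g : R -> \bar R) :
  (forall s, (0 <= f s)%E) -> (forall s, (0 <= g s)%E) ->
  measurable N -> mu N = 0%E -> (forall s, D s -> ~ N s -> (f s <= g s)%E) ->
  (\int[mu]_(s in D) f s <= \int[mu]_(s in D) g s)%E.
Proof.
move=> f0 g0 mN N0 fg.
rewrite integral_mkcond [leRHS]integral_mkcond !ge0_integralTE; try by move=> s; apply: erestrict_ge0.
apply: ge_ereal_sup => _ [h /= hf <-].
have mC : measurable (~` N) by exact: measurableC.
have -> : sintegral mu h = sintegral mu (proj_nnsfun h mC).
  rewrite -!integralT_nnsfun; apply: ge0_ae_eq_integral => //.
  - exact/measurable_EFinP.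
  - exact/measurable_EFinP.
  - by move=> s _; rewrite lee_fin.
  - by move=> s _; rewrite lee_fin.
  exists N; split => // s /= /not_implyP[_ ne]; apply: contrapT => nN; apply: ne.
  by rewrite /= mindicE mem_set ?mulr1.
apply: ereal_sup_ubound; exists (proj_nnsfun h mC) => // s /=.
rewrite mindicE; have [Ns|Ns] := pselect (N s).
  by rewrite memNset ?mulr0 ?erestrict_ge0//; apply.
rewrite mem_set// mulr1 (le_trans (hf s))//.
by rewrite !patchE; case: ifPn => // /set_mem Ds; exact: fg.
Qed.

(** The integrand of [energy] is built from iterated [derive1], which carries no information where
    the second derivative fails to exist; agreement almost everywhere has to suffice without
    measurability. *)
Lemma ge0_ae_eq_integral_any (D : set R) (f g : R -> \bar R) :
  (forall s, (0 <= f s)%E) -> (forall s, (0 <= g s)%E) ->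
  {ae mu, forall s, D s -> f s = g s} ->
  (\int[mu]_(s in D) f s = \int[mu]_(s in D) g s)%E.
Proof.
move=> f0 g0 [N [mN N0 sub]].
have eq s : D s -> ~ N s -> f s = g s.
  by move=> Ds Ns; apply: contrapT => ne; apply: Ns; apply: sub => /= /(_ Ds).
by apply/le_anti/andP; split; apply: (ge0_le_integral_null _ _ mN N0) => // s Ds Ns; rewrite eq.
Qed.

End NonMeasurable.

Section CosineOne.
Variable R : realType.
Implicit Types v : R.

Lemma cos_eq1 v : 0 <= v -> v < pi + pi -> cos v = 1 -> v = 0.
Proof.
move=> v0 v1 cv; apply/eqP; apply: contrapT => /negP vn.
have vp : 0 < v by rewrite lt_neqAle eq_sym vn.
have h : 0 < v / 2 < pi.
  by apply/andP; split; [exact: divr_gt0|rewrite ltr_pdivrMr//; lra].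
have s0 := sin_gt0_pi h.
have : cos v = 1 - 2 * sin (v / 2) ^+ 2.
  set q := v / 2; have -> : v = q + q by rewrite /q; field.
  by rewrite cosD -!expr2 cos2sin2; ring.
rewrite cv => e.
have : 0 < sin (v / 2) ^+ 2 by rewrite exprn_gt0.
lra.
Qed.

End CosineOne.

Lemma measurable_norm_powR (R : realType) (p : R) (D : set R) (h : R -> R) :
  measurable_fun D h -> measurable_fun D (fun s => (`|h s| `^ p)%:E).
Proof.
move=> mh; apply/measurable_EFinP.
apply: (measurableT_comp (f := (@powR R) ^~ p)); first exact: measurable_powR.
exact: measurableT_comp.
Qed.

(** * Area, boundary and energy of a disc *)

Section Disc.
Variable R : realType.
Notation mu := (@lebesgue_measure R).
Variable r : R.
Hypothesis r0 : 0 < r.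
Implicit Types (s t X Y : R).

Let rn : r != 0. Proof. exact: lt0r_neq0. Qed.

Let wid X := Num.sqrt (r ^+ 2 - X ^+ 2).

Let wid_cont : continuous wid.
Proof.
move=> X; apply: (@continuous_comp _ _ _ (fun X => r ^+ 2 - X ^+ 2) Num.sqrt); last exact: sqrt_continuous.
by apply: continuousB; [exact: cvg_cst|exact: exprn_continuous].
Qed.

Let disc := cdisc (0, 0) r.

Let discP X Y : disc (X, Y) <-> X ^+ 2 + Y ^+ 2 <= r ^+ 2.
Proof. by rewrite /disc /cdisc /= !subr0. Qed.

Lemma disc_convex : convex2 disc.
Proof.
move=> [a b] [c d] /discP h1 /discP h2 t /andP[t0 t1]; apply/discP => /=.
have h3 : ((1 - t) * a + t * c) ^+ 2 + ((1 - t) * b + t * d) ^+ 2 =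
  (1 - t) * (a ^+ 2 + b ^+ 2) + t * (c ^+ 2 + d ^+ 2) - t * (1 - t) * ((a - c) ^+ 2 + (b - d) ^+ 2) by ring.
rewrite h3.
have h4 : 0 <= t * (1 - t) * ((a - c) ^+ 2 + (b - d) ^+ 2).
  apply: mulr_ge0; last by apply: addr_ge0; exact: sqr_ge0.
  by apply: mulr_ge0 => //; lra.
move: (a ^+ 2 + b ^+ 2) (c ^+ 2 + d ^+ 2) (r ^+ 2) h1 h2 h4 => u v w h1 h2 h4.
have : (1 - t) * u <= (1 - t) * w by apply: ler_wpM2l => //; lra.
have : t * v <= t * w by apply: ler_wpM2l.
lra.
Qed.

Lemma disc_bounded : bounded2 disc.
Proof.
exists r => -[a b] /discP h /=.
by split; rewrite -(@ler_pXn2r _ 2%N)// ?nnegrE ?(ltW r0)// real_normK ?num_real//;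
  apply: le_trans h; rewrite ?lerDl ?lerDr sqr_ge0.
Qed.

Let qcont : continuous (fun z : R * R => z.1 ^+ 2 + z.2 ^+ 2).
Proof.
have c1 (f : R * R -> R) : continuous f -> continuous (fun z => f z ^+ 2).
  by move=> cf z; apply: (continuousM (cf z) (cf z)).
move=> z; apply: (@continuousD _ _ _ (fun z : R * R => z.1 ^+ 2) (fun z : R * R => z.2 ^+ 2)).
  by apply: (c1 (fun z => z.1)) => w; exact: cvg_fst.
by apply: (c1 (fun z => z.2)) => w; exact: cvg_snd.
Qed.

Lemma disc_closed : closed disc.
Proof.
have -> : disc = (fun z : R * R => z.1 ^+ 2 + z.2 ^+ 2) @^-1` [set w | w <= r ^+ 2].
  by apply/seteqP; split => -[a b]; [move/discP|move=> h; apply/discP].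
by apply: preimage_closed; [move=> z _; exact: qcont|exact: closed_le].
Qed.

Lemma disc_region : region disc (- r) r (fun X => - wid X) wid.
Proof.
split.
- by have := r0; lra.
- by move=> X; apply: continuousN; exact: wid_cont.
- exact: wid_cont.
- by move=> X _; have := sqrtr_ge0 (r ^+ 2 - X ^+ 2); rewrite -/(wid X); lra.
move=> X Y; split.
  move=> /discP h.
  have hX : `|X| <= r.
    rewrite -(@ler_pXn2r _ 2%N)// ?nnegrE ?(ltW r0)// real_normK ?num_real//.
    by apply: le_trans h; rewrite lerDl sqr_ge0.
  split; first by rewrite -ler_norml.
  rewrite -ler_norml -sqrtr_sqr ler_wsqrtr//.
  by move: h; lra.
move=> [hX]; rewrite -ler_norml => h; apply/discP.
have n : 0 <= r ^+ 2 - X ^+ 2.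
  by rewrite subr_ge0 -[X ^+ 2]real_normK ?num_real// ler_pXn2r ?nnegrE ?(ltW r0)// ler_norml.
move: h; rewrite -(@ler_pXn2r _ 2%N)// ?nnegrE ?sqrtr_ge0// real_normK ?num_real// sqr_sqrtr//; lra.
Qed.

(** The substitution X = - r cos t turns the integral of the half-width [wid] into that of (r sin t)
    ^ 2 over [0, pi], with primitive G. It is carried out on a primitive of [wid], so only
    continuity of the square root is used. *)
Lemma disc_area : (mu \x mu)%E disc = (pi * r ^+ 2)%:E.
Proof.
rewrite (region_area disc_region); congr EFin.
have r1 : - r - 1 <= - r by lra.
have rr : - r <= r by have := r0; lra.
pose P X := integ wid (- r - 1) X.
have e1 : integ wid (- r) r = P r - P (- r).
  by rewrite /P (integ_split wid_cont r1 rr); ring.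
have -> : integ (fun s => wid s - - wid s) (- r) r = 2 * integ wid (- r) r.
  rewrite /integ -RintegralZl//; last exact: continuous_integrable.
  by apply: eq_Rintegral => s _; ring.
have pi0 : 0 <= pi :> R by rewrite ltW// pi_gt0.
pose X (t : R) := - r * cos t.
have dX t : is_derive t 1 X (r * sin t).
  by apply: is_derive_eq; rewrite /GRing.scale/=; ring.
have aX : abs_cont pi X (fun t => r * sin t).
  apply: abs_cont_C1 => //; apply: continuous_subspaceT => t.
  by apply: continuousM; [exact: cvg_cst|exact: continuous_sin].
have aP : abs_cont pi (P \o X) (fun t => wid (X t) * (r * sin t)).
  apply: (@abs_cont_comp _ pi X _ P wid pi0 aX).
    move=> t _; apply: is_derive_primitive; first exact: wid_cont.
    rewrite /X; have := cos_le1 t; have := cos_geN1 t; have := r0; nra.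
  apply: continuous_subspaceT => t; apply: continuous_comp; last exact: wid_cont.
  by apply: continuousM; [exact: cvg_cst|exact: continuous_cos].
have e2 : P r - P (- r) = integ (fun t => wid (X t) * (r * sin t)) 0 pi.
  by rewrite -(abs_contB aP)//= /X cospi cos0; congr (P _ - P _); ring.
pose G (t : R) := r ^+ 2 / 2 * (t - sin t * cos t).
have dG (t : R) : is_derive t 1 G (r ^+ 2 * sin t ^+ 2).
  apply: is_derive_eq; rewrite /GRing.scale/=.
  have -> : sin t ^+ 2 = (1 - cos t ^+ 2 + sin t ^+ 2) / 2 by rewrite -sin2cos2; field.
  by field.
have aG : abs_cont pi G (fun t => r ^+ 2 * sin t ^+ 2).
  apply: abs_cont_C1 => //; apply: continuous_subspaceT => t.
  apply: (@continuousM R R (fun=> r ^+ 2) (fun t => sin t ^+ 2)); first exact: cvg_cst.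
  by apply: (@continuousM R R sin sin); exact: continuous_sin.
have e3 : integ (fun t => wid (X t) * (r * sin t)) 0 pi = G pi - G 0.
  rewrite (abs_contB aG)//; apply: eq_integ => t ht.
  have s0 := sin_ge0_pi ht.
  have -> : wid (X t) = r * sin t.
    rewrite /wid /X; have -> : r ^+ 2 - (- r * cos t) ^+ 2 = (r * sin t) ^+ 2.
      by rewrite [RHS]exprMn sin2cos2; ring.
    by rewrite sqrtr_sqr ger0_norm// mulr_ge0// ltW.
  by ring.
by rewrite e1 e2 e3 /G sinpi sin0; move: (@pi R) => P'; field.
Qed.

Let Ld := 2 * pi * r.
Let d1 := fun s : R => r * cos (s / r).
Let d2 := fun s : R => r * sin (s / r).

Let Ld0 : 0 < Ld. Proof. by rewrite !mulr_gt0// pi_gt0. Qed.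

Let dd1 s : is_derive s 1 d1 (- sin (s / r)).
Proof. by apply: is_derive_eq; rewrite /GRing.scale/=; field. Qed.

Let dd2 s : is_derive s 1 d2 (cos (s / r)).
Proof. by apply: is_derive_eq; rewrite /GRing.scale/=; field. Qed.

Lemma disc_interior X Y : X ^+ 2 + Y ^+ 2 < r ^+ 2 -> interior disc (X, Y).
Proof.
move=> h; have := near_pos (f := fun z : R * R => r ^+ 2 - (z.1 ^+ 2 + z.2 ^+ 2)) (x := (X, Y)).
rewrite /= subr_gt0 h => H.
have /H /(_ isT) : {for (X, Y), continuous (fun z : R * R => r ^+ 2 - (z.1 ^+ 2 + z.2 ^+ 2))}.
  by apply: continuousB; [exact: cvg_cst|exact: qcont].
by apply: filterS => -[a b] /=; rewrite subr_gt0 => /ltW/discP.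
Qed.

(** Scaling the point from the centre by 1 + k leaves the disc, while k is small enough for the
    image to stay within d. *)
Lemma circle_not_interior X Y : X ^+ 2 + Y ^+ 2 = r ^+ 2 -> ~ interior disc (X, Y).
Proof.
move=> e /nbhs_ballP[d /= d0 hd].
pose m := `|X| + `|Y| + 1.
have m0 : 0 < m by rewrite /m ltr_wpDl// addr_ge0.
pose k := d / (2 * m).
have k0 : 0 < k by rewrite divr_gt0// mulr_gt0.
have kd (z : R) : `|z| <= m -> `|z - (1 + k) * z| < d.
  move=> zm; have -> : z - (1 + k) * z = - (k * z) by ring.
  rewrite normrN normrM (gtr0_norm k0) (@le_lt_trans _ _ (k * m))//.
    by rewrite ler_wpM2l// ltW.
  have -> : k * m = d / 2 by rewrite /k; field; exact: lt0r_neq0.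
  by rewrite ltr_pdivrMr//; lra.
have /discP : disc ((1 + k) * X, (1 + k) * Y).
  apply: hd; split; apply: kd; rewrite /m/=.
    by rewrite -addrA lerDl addr_ge0.
  by rewrite addrAC lerDr addr_ge0.
have -> : ((1 + k) * X) ^+ 2 + ((1 + k) * Y) ^+ 2 = (1 + k) ^+ 2 * r ^+ 2 by rewrite -e; ring.
have r2 : 0 < r ^+ 2 by rewrite exprn_gt0.
by rewrite ger_pMl// leNgt => /negP; apply; nra.
Qed.

Lemma disc_bdry : bdry2 disc = [set (d1 s, d2 s) | s in `[0, Ld]].
Proof.
rewrite /bdry2 -((closure_id _).1 disc_closed).
apply/seteqP; split => [[X Y] [/discP le ni]|_ [s _ <-]].
  have e : X ^+ 2 + Y ^+ 2 = r ^+ 2.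
    apply/eqP; rewrite eq_le le/= leNgt; apply/negP => lt; exact: ni (disc_interior lt).
  have e1 : (X / r) ^+ 2 + (Y / r) ^+ 2 = 1.
    by rewrite !expr_div_n -mulrDl e divff// expf_neq0.
  have [th [/andP[h1 h2] c1 s1]] := circle_angle e1.
  exists (r * th).
    rewrite /= in_itv/= mulr_ge0 ?(ltW r0)//= /Ld mulrC ler_pM2r//.
    by apply: (le_trans h2); rewrite le_eqVlt; apply/orP; left; apply/eqP; ring.
  have tr : r * th / r = th by rewrite mulrAC divff// mul1r.
  by rewrite /d1 /d2 tr -c1 -s1; congr pair; field.
have e : d1 s ^+ 2 + d2 s ^+ 2 = r ^+ 2.
  by rewrite /d1 /d2 !exprMn -mulrDr cos2Dsin2 mulr1.
by split; [apply/discP; rewrite e|exact: circle_not_interior].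
Qed.

Let D1 : derive1 d1 = (fun s => - sin (s / r)).
Proof. by apply/funext => s; rewrite derive1E; have [_] := dd1 s. Qed.
Let D2 : derive1 d2 = (fun s => cos (s / r)).
Proof. by apply/funext => s; rewrite derive1E; have [_] := dd2 s. Qed.

Let ddd1 s : is_derive s 1 (fun s : R => - sin (s / r)) (- (cos (s / r) / r)).
Proof. by apply: is_derive_eq; rewrite /GRing.scale/=; field. Qed.
Let ddd2 s : is_derive s 1 (fun s : R => cos (s / r)) (- (sin (s / r) / r)).
Proof. by apply: is_derive_eq; rewrite /GRing.scale/=; field. Qed.

Lemma W1p_bounded (p L M : R) (d h : R -> R) : 0 < p -> 0 <= L -> continuous h ->
  (forall s, `|h s| <= M) -> (forall s : R, is_derive s 1 d (h s)) -> W1p_on p L d.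
Proof.
move=> p0 L0 ch hM dh.
have mh : measurable_fun `[0, L] h.
  by apply: subspace_continuous_measurable_fun => //; exact: continuous_subspaceT.
exists h; split; [by []|split].
- apply: (@le_lt_trans _ _ (\int[mu]_(x in `[0%R, L]) (M `^ p)%:E)%E).
    apply: ge0_le_integral => //.
    + exact: measurable_norm_powR.
    + by move=> x _; rewrite lee_fin ge0_ler_powR ?nnegrE// ?(ltW p0)// (le_trans _ (hM x)).
  by rewrite integral_cst//= lebesgue_measure_itv/=; case: ifP => _; rewrite ?mule0 ?ltry// -EFinD -EFinM ltry.
- have [_ H] : abs_cont L d h.
    by apply: abs_cont_C1 => //; exact: continuous_subspaceT.
  exact: H.
Qed.

Let divc : continuous (fun s : R => s / r).
Proof. by move=> s; apply: (@continuousM R R id (fun=> r^-1)); [exact: cvg_id|exact: cvg_cst]. Qed.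

Lemma disc_W2p (p : R) : 0 < p -> W2p_closed_arclength p Ld d1 d2.
Proof.
move=> p0; have Lge := ltW Ld0.
have per s : (s + Ld) / r = s / r + pi *+ 2 by rewrite /Ld; move: (@pi R) => P; field.
have bnd (w : R) : `|w| <= 1 -> `|- (w / r)| <= r^-1.
  by move=> h; rewrite normrN normrM (gtr0_norm (_ : 0 < r^-1)) ?invr_gt0// ler_piMl// invr_ge0 ltW.
have hc (w : R -> R) : continuous w -> continuous (fun s => - (w (s / r) / r)).
  move=> cw; have -> : (fun s => - (w (s / r) / r)) = (fun s => (- r^-1) * w (s / r)).
    by apply/funext => s; ring.
  move=> s; apply: (@continuousM R R (fun=> - r^-1) (fun s => w (s / r))); first exact: cvg_cst.
  by apply: (@continuous_comp _ _ _ (fun s => s / r) w); [exact: divc|exact: cw].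
split => //.
- split=> s; first by rewrite /d1 /d2 per cosD2pi sinD2pi.
  by split; [have [] := dd1 s|have [] := dd2 s].
- by move=> s; rewrite D1 D2 sqrrN sin2cos2 subrK.
- move=> s t /andP[s0 sL] /andP[t0 tL] [].
  move=> /(mulfI rn) ec /(mulfI rn) es.
  have LE : Ld / r = pi + pi by rewrite /Ld; move: (@pi R) => P; field.
  have bd z : 0 <= z -> z < Ld -> 0 <= z / r /\ z / r < pi + pi.
    by move=> h1 h2; split; [rewrite divr_ge0// ltW|rewrite -LE ltr_pM2r// invr_gt0].
  have [a1 a2] := bd s s0 sL; have [b1 b2] := bd t t0 tL.
  have e : cos (s / r - t / r) = 1 by rewrite cosB ec es -!expr2 cos2Dsin2.
  have : s / r - t / r = 0.
    have [h|h] := leP (t / r) (s / r).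
      by apply: cos_eq1 => //; [rewrite subr_ge0|lra].
    apply: oppr_inj; rewrite oppr0; apply: cos_eq1; [by lra|by lra|by rewrite cosN].
  by move/subr0_eq/(mulIf (invr_neq0 rn)).
- rewrite D1 D2; split.
    apply: (@W1p_bounded p Ld r^-1 _ (fun s => - (cos (s / r) / r))) => //.
      exact: (hc cos (@continuous_cos R)).
    by move=> s; apply: bnd; exact: cos_max.
  apply: (@W1p_bounded p Ld r^-1 _ (fun s => - (sin (s / r) / r))) => //.
    exact: (hc sin (@continuous_sin R)).
  by move=> s; apply: bnd; exact: sin_max.
Qed.

Lemma disc_energy (p : R) : energy p Ld d1 d2 = (2 * pi * r * r^-1 `^ p)%:E.
Proof.
have kE s : curv d1 d2 s = r^-1.
  rewrite /curv D1 D2 !derive1E.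
  have [_ ->] := ddd1 s; have [_ ->] := ddd2 s.
  have -> : - sin (s / r) * - (sin (s / r) / r) - cos (s / r) * - (cos (s / r) / r) =
    (cos (s / r) ^+ 2 + sin (s / r) ^+ 2) / r by ring.
  by rewrite cos2Dsin2 mul1r.
rewrite /energy; under eq_integral do rewrite kE.
rewrite integral_cst//= lebesgue_measure_itv/= lte_fin Ld0 -EFinD -EFinM subr0.
by rewrite gtr0_norm ?invr_gt0// mulrC.
Qed.

Lemma disc_admissible (p : R) : 0 < p -> admissible p (pi * r ^+ 2) disc d1 d2 Ld.
Proof.
move=> p0; split.
- exact: disc_convex.
- exact: disc_bounded.
- by rewrite /area2 -((closure_id _).1 disc_closed) disc_area.
- exact: disc_bdry.
- exact: disc_W2p.
Qed.

End Disc.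

(** * The comparison with the disc *)

Section Scaling.
Variable R : realType.

(** Here q is the radius for the area enclosed by the parametrization, r the one for the prescribed
    area, and J the integral of kap ^ p. The hypothesis gives J >= 2 pi q ^ (1 - p), which decreases
    in q as p > 1; equality therefore forces q = r. *)
Lemma energy_scaling (p q r J : R) : 1 < p -> 0 < q -> q <= r ->
  2 * pi * q <= q `^ p * J ->
  2 * pi * r * r^-1 `^ p <= J /\
  (J = 2 * pi * r * r^-1 `^ p -> q = r /\ q `^ p * J = 2 * pi * q).
Proof.
move=> p1 q0 qr hJ; have r0 : 0 < r by exact: lt_le_trans qr.
have pi2 : 0 < 2 * pi :> R by rewrite mulr_gt0// pi_gt0.
have zE (z : R) : 0 < z -> z * z^-1 `^ p = z^-1 `^ (p - 1).
  move=> z0; have p0 : 0 < p by exact: lt_trans p1.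
  by rewrite -(@mulr_powRB1 R z^-1 p) ?invr_ge0 ?(ltW z0)// mulrA divff ?mul1r// gt_eqF.
have inv (z : R) : 0 < z -> z^-1 `^ p * z `^ p = 1.
  by move=> z0; rewrite -powRM ?invr_ge0 ?(ltW z0)// mulVf ?powR1// gt_eqF.
have J1 : 2 * pi * (q * q^-1 `^ p) <= J.
  have := ler_wpM2l (powR_ge0 q^-1 p) hJ.
  rewrite [leRHS]mulrA inv// mul1r; congr (_ <= _); ring.
have pp : 0 < p - 1 by rewrite subr_gt0.
have mono : r^-1 `^ (p - 1) <= q^-1 `^ (p - 1).
  by apply: ge0_ler_powR; rewrite ?nnegrE ?invr_ge0 ?lef_pV2 ?posrE// ltW.
rewrite -mulrA (zE r r0); rewrite (zE q q0) in J1.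
split; first by apply: le_trans J1; rewrite ler_pM2l.
move=> Jr.
have eqp : r^-1 `^ (p - 1) = q^-1 `^ (p - 1).
  by apply/le_anti; rewrite mono/= -(ler_pM2l pi2) -Jr.
have rq : r^-1 = q^-1 by apply: (powR_injective pp) => //; rewrite nnegrE invr_ge0 ltW.
have <- : r = q by exact: invr_inj.
split=> //; rewrite Jr -(zE r r0).
transitivity (2 * pi * r * (r^-1 `^ p * r `^ p)); first by ring.
by rewrite inv// mulr1.
Qed.

Lemma area_radius (A : R) : 0 < A -> exists2 r, 0 < r & pi * r ^+ 2 = A.
Proof.
have pi0 := pi_gt0 R; move=> A0; exists (Num.sqrt (A / pi)).
  by rewrite sqrtr_gt0 divr_gt0.
by rewrite sqr_sqrtr ?divr_ge0 ?ltW// mulrC divfK// gt_eqF.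
Qed.

End Scaling.

(** * Energy bound and equality case for a counterclockwise boundary *)

Section OrientedCurve.
Variable R : realType.
Notation mu := (@lebesgue_measure R).
Implicit Types (s t X Y c d : R).
Variables (K : set (R * R)) (x0 x1 : R) (l u : R -> R).
Hypothesis KE : region K x0 x1 l u.
Variables (p a L : R) (x y tx ty f1 f2 : R -> R).
Hypothesis p1 : 1 < p.
Hypothesis areaK : integ (fun s => u s - l s) x0 x1 = a.
Hypothesis L0 : 0 < L.
Hypothesis dx : forall s : R, is_derive s 1 x (tx s).
Hypothesis dy : forall s : R, is_derive s 1 y (ty s).
Hypothesis unit : forall s, tx s ^+ 2 + ty s ^+ 2 = 1.
Hypotheses (xL : x L = x 0) (yL : y L = y 0) (txL : tx L = tx 0) (tyL : ty L = ty 0).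
Hypothesis inj : forall s t, 0 <= s < L -> 0 <= t < L -> x s = x t -> y s = y t -> s = t.
Hypothesis txE : abs_cont L tx f1.
Hypothesis tyE : abs_cont L ty f2.
Hypothesis mem : forall s, 0 <= s <= L -> K (x s, y s).
Hypothesis suppK : forall s P, 0 <= s <= L -> K P ->
  0 <= tx s * (P.2 - y s) - ty s * (P.1 - x s).

Let Lge : 0 <= L. Proof. exact: ltW. Qed.

Let supp s t : 0 <= s <= L -> 0 <= t <= L ->
  0 <= tx s * (y t - y s) - ty s * (x t - x s).
Proof. by move=> hs ht; have := suppK hs (mem ht). Qed.

Let xE : abs_cont L x tx.
Proof. by apply: abs_cont_C1 => //; exact: abs_cont_continuous Lge txE. Qed.
Let yE : abs_cont L y ty.
Proof. by apply: abs_cont_C1 => //; exact: abs_cont_continuous Lge tyE. Qed.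

Section Kappa.
Variable kap : R -> R.
Hypothesis kap0 : forall s, 0 <= kap s.
Hypothesis kapi : intble L kap.
Hypothesis txK : abs_cont L tx (fun s => - (kap s * ty s)).
Hypothesis tyK : abs_cont L ty (fun s => kap s * tx s).
Local Notation psi := (turn kap).

Let psiL : psi L = pi + pi.
Proof. exact: (total_turning L0 dx dy unit xL yL txL tyL inj supp kap0 kapi txK tyK). Qed.

(** The tangent makes a full turn; the angle to be reached is the argument of (c, d) rotated back by
    the initial angle [th]. *)
Let tangent_onto c d : c ^+ 2 + d ^+ 2 = 1 -> exists s, [/\ 0 <= s <= L, tx s = c & ty s = d].
Proof.
move=> cd.
have [th [_ c0 s0]] := circle_angle (unit 0).
have ta := tangent_angle Lge kapi txK tyK c0 s0.
have cs1 := cos2Dsin2 th.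
have [|w [/andP[w0 w1] cw sw]] := @circle_angle R (c * cos th + d * sin th) (d * cos th - c * sin th).
  transitivity ((c ^+ 2 + d ^+ 2) * (cos th ^+ 2 + sin th ^+ 2)); first by ring.
  by rewrite cd cs1 mulr1.
have cpsi := abs_cont_continuous Lge (abs_cont_turn kapi).
have psi0 : psi 0 = 0 by rewrite /turn integ_nil.
have hv : Num.min (psi 0) (psi L) <= w <= Num.max (psi 0) (psi L).
  by rewrite ge_min le_max psi0 psiL w0 w1 orbT.
have [s] := IVT Lge cpsi hv; rewrite in_itv/= => hs ps.
exists s; have [-> ->] := ta s hs; split => //; rewrite ps.
  rewrite cosD -cw -sw; transitivity (c * (cos th ^+ 2 + sin th ^+ 2)); first by ring.
  by rewrite cs1 mulr1.
rewrite sinD -cw -sw; transitivity (d * (cos th ^+ 2 + sin th ^+ 2)); first by ring.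
by rewrite cs1 mulr1.
Qed.

(** By [tangent_onto] the curve covers the whole circle. A point beyond the circle would be on the
    wrong side of the tangent in its own direction; a point within lies on a vertical chord whose
    ends belong to K. *)
Lemma circle_region (r ox oy : R) : 0 < r ->
  (forall s, 0 <= s <= L -> x s = ox + r * ty s /\ y s = oy - r * tx s) ->
  K = cdisc (ox, oy) r.
Proof.
move=> r0 circ; have [_ _ _ _ Kdef] := KE.
have onK c d : c ^+ 2 + d ^+ 2 = r ^+ 2 -> K (ox + c, oy + d).
  move=> cd; have [|s [hs e1 e2]] := @tangent_onto (- d / r) (c / r).
    by rewrite !expr_div_n sqrrN -mulrDl addrC cd divff// expf_neq0// gt_eqF.
  have [e3 e4] := circ s hs; have := mem hs; rewrite e3 e4 e1 e2.
  by congr (K (_, _)); field; rewrite gt_eqF.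
apply/seteqP; split => -[X Y]; rewrite /cdisc/=.
  move=> KXY; rewrite leNgt; apply/negP => gt.
  pose v := X - ox; pose w := Y - oy; pose rho := Num.sqrt (v ^+ 2 + w ^+ 2).
  have q0 : 0 <= v ^+ 2 + w ^+ 2 by rewrite addr_ge0 ?sqr_ge0.
  have rho2 : rho ^+ 2 = v ^+ 2 + w ^+ 2 by rewrite sqr_sqrtr.
  have rr : r < rho.
    by rewrite -(@ltr_pXn2r _ 2%N)// ?nnegrE ?sqrtr_ge0 ?(ltW r0)// rho2.
  have rn : rho != 0 by rewrite gt_eqF// (lt_trans r0).
  have [|s [hs e1 e2]] := @tangent_onto (- w / rho) (v / rho).
    by rewrite !expr_div_n sqrrN -mulrDl addrC -rho2 divff// expf_neq0.
  have := suppK hs KXY; have [-> ->] := circ s hs; rewrite /= e1 e2.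
  have -> : - w / rho * (Y - (oy - r * (- w / rho))) - v / rho * (X - (ox + r * (v / rho))) =
    r * ((v ^+ 2 + w ^+ 2) / rho ^+ 2) - (v ^+ 2 + w ^+ 2) / rho.
    by rewrite /v /w; field.
  rewrite -rho2 divff ?expf_neq0// mulr1 expr2 mulfK//; lra.
move=> le; pose v := X - ox; pose w := Num.sqrt (r ^+ 2 - v ^+ 2).
have n : 0 <= r ^+ 2 - v ^+ 2.
  by rewrite subr_ge0 (le_trans _ le)// lerDl sqr_ge0.
have w2 : w ^+ 2 = r ^+ 2 - v ^+ 2 by rewrite sqr_sqrtr.
have K1 : K (X, oy + w).
  by have := @onK v w; rewrite w2 subrKC => /(_ erefl); rewrite /v subrKC.
have K2 : K (X, oy - w).
  by have := @onK v (- w); rewrite sqrrN w2 subrKC => /(_ erefl); rewrite /v subrKC.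
have Yw : `|Y - oy| <= w by rewrite -sqrtr_sqr ler_wsqrtr// lerBrDl.
move: Yw; rewrite ler_norml => /andP[h1 h2].
move/Kdef: K1 => [hX /andP[_ h3]]; move/Kdef: K2 => [_ /andP[h4 _]].
by apply/Kdef; split => //; apply/andP; split; lra.
Qed.

End Kappa.

Lemma oriented_curve_energy (r : R) : 0 < r -> pi * r ^+ 2 = a ->
  let E := (\int[mu]_(s in `[0%R, L]) (`|tx s * f2 s - ty s * f1 s| `^ p)%:E)%E in
  ((2 * pi * r * r^-1 `^ p)%:E <= E)%E /\
  (E = (2 * pi * r * r^-1 `^ p)%:E -> exists c : R * R, K = cdisc c r).
Proof.
move=> r0 ra E.
have p0 : 0 < p by exact: lt_trans p1.
have [kap [kap0 kapi txK tyK kapE]] := curvature_density L0 dx dy unit supp txE tyE.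
have psiL := total_turning L0 dx dy unit xL yL txL tyL inj supp kap0 kapi txK tyK.
have A0 := signed_area_gt0 L0 xE yE txK tyK unit xL yL txL tyL supp.
have Aa := signed_area_le_region KE L0 kap0 kapi xE yE txK tyK unit xL yL psiL mem suppK.
rewrite areaK in Aa.
have nk : (fun s => `|kap s| `^ p) = (fun s => kap s `^ p).
  by apply/funext => s; rewrite ger0_norm.
have EE : E = (\int[mu]_(s in `[0%R, L]) (kap s `^ p)%:E)%E.
  apply: ge0_ae_eq_integral_any => [s|s|]; rewrite ?lee_fin ?powR_ge0//.
  apply: ae_imply (ae_on_itv kapE) => s hs; rewrite /= in_itv/= => /hs <-.
  by rewrite ger0_norm.
move: E EE => E EE; have [Ey|Efin] := eqVneq E +oo%E; first by rewrite Ey leey; split.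
have mk : measurable_fun `[0, L] (EFin \o (fun s => kap s `^ p)).
  rewrite -nk; apply: measurable_norm_powR; apply/measurable_EFinP.
  exact: measurable_int kapi.
have ik : intble L (fun s => kap s `^ p).
  apply/integrableP; split => //.
  under eq_integral => s _ do rewrite /= ger0_norm ?powR_ge0//.
  by rewrite -EE ltey.
have JE (q : R) : 0 < q ->
    integ (fun s => (kap s * q) `^ p) 0 L = q `^ p * integ (fun s => kap s `^ p) 0 L.
  move=> q0; rewrite -(integZ _ ik)//.
  by apply: eq_integ => s _; rewrite powRM ?(ltW q0)// mulrC.
have EJ : E = (integ (fun s => kap s `^ p) 0 L)%:E.
  by rewrite EE /integ /Rintegral fineK//; exact: integrable_fin_num.
have [q q0 qA] := area_radius A0.
have [] := curve_inequality p1 L0 kap0 kapi xE yE txK tyK unit xL yL txL tyL psiL supp q0 qA ik.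
move: (signed_area _ _ _ _ _) qA A0 Aa => A qA A0 Aa.
rewrite (JE q q0); move: (integ _ _ _) EJ => J EJ CI CE.
have qr : q <= r.
  rewrite -(@ler_pXn2r _ 2%N)// ?nnegrE ?(ltW q0) ?(ltW r0)//.
  by rewrite -(ler_pM2l (pi_gt0 R)) qA ra.
have [le eq] := energy_scaling p1 q0 qr CI.
rewrite EJ lee_fin; split=> [|[/eq [qrE /CE [ox [oy circ]]]]]; first exact: le.
exists (ox, oy); rewrite -qrE.
exact: (circle_region kap0 kapi txK tyK q0 circ).
Qed.

End OrientedCurve.

(** * From the Sobolev hypotheses to absolutely continuous tangents *)

Section Reduction.
Variable R : realType.
Notation mu := (@lebesgue_measure R).

(** On a bounded interval the bound |h| <= 1 + |h| ^ p makes a p-integrable density integrable. *)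
Lemma W1p_acon (p L : R) (d : R -> R) : 1 < p -> W1p_on p L d -> exists h, abs_cont L d h.
Proof.
move=> p1 [h [mh [hp dE]]]; exists h; split => //.
pose g s := 1 + `|h s| `^ p.
have mp := measurable_norm_powR p mh.
have ip : intble L (fun s => `|h s| `^ p).
  apply/integrableP; split => //.
  by under eq_integral => s _ do rewrite /= ger0_norm ?powR_ge0//.
have ig : intble L g by apply: intbleD => //; exact: intble_cst.
apply: (le_integrable _ _ _ ig) => //; first exact/measurable_EFinP.
move=> s _ /=; rewrite lee_fin /g [leRHS]ger0_norm ?addr_ge0 ?powR_ge0//.
have [h1|h1] := leP `|h s| 1; first by rewrite (le_trans h1)// lerDl powR_ge0.
by rewrite (@le_trans _ _ (`|h s| `^ p)) ?lerDr// le1r_powR ?ltW.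
Qed.

(** The pointwise second derivatives in [curv] agree almost everywhere with the densities of the
    first derivatives, by Lebesgue differentiation. *)
Lemma energyE (p L : R) (g1 g2 f1 f2 : R -> R) :
  abs_cont L (derive1 g1) f1 -> abs_cont L (derive1 g2) f2 ->
  energy p L g1 g2 = (\int[mu]_(s in `[0%R, L])
    (`|derive1 g1 s * f2 s - derive1 g2 s * f1 s| `^ p)%:E)%E.
Proof.
move=> a1 a2; apply: ge0_ae_eq_integral_any => [s|s|]; rewrite ?lee_fin ?powR_ge0//.
apply: ae_imply (ae_on_itv (_ : ae_on L (fun s => derive1 (derive1 g1) s = f1 s /\ derive1 (derive1 g2) s = f2 s))).
  by move=> s h; rewrite /= in_itv/= => /h [e1 e2]; rewrite /curv e1 e2.
apply: ae_imply (ae_and (abs_cont_derive a1) (abs_cont_derive a2)) => s [h1 h2] hs.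
by rewrite !derive1E; have [_ ->] := h1 hs; have [_ ->] := h2 hs.
Qed.

Lemma region_mirror (K : set (R * R)) (x0 x1 : R) (l u : R -> R) : region K x0 x1 l u ->
  region [set z : R * R | K (z.1, - z.2)] x0 x1 (fun X => - u X) (fun X => - l X).
Proof.
move=> [x01 cl cu lu Kdef]; split => //.
- by move=> X; apply: continuousN; exact: cu.
- by move=> X; apply: continuousN; exact: cl.
- by move=> X /lu; rewrite lerN2.
have e X Y : (l X <= - Y <= u X) = (- u X <= Y <= - l X) by rewrite lerNr lerNl andbC.
by move=> X Y; rewrite -e; exact: Kdef.
Qed.

Lemma derive1_periodic (g : R -> R) (L : R) : (forall s, g (s + L) = g s) ->
  (forall s : R, derivable g s 1) -> derive1 g L = derive1 g 0.
Proof.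
move=> per dg.
have d0 : is_derive (0 : R) 1 g (derive1 g 0) by split; [exact: dg|rewrite derive1E].
have dL : is_derive (0 + L : R) 1 g (derive1 g L).
  by rewrite add0r; split; [exact: dg|rewrite derive1E].
have ds : is_derive (0 : R) 1 (fun s : R => s + L) 1.
  by apply: is_derive_eq; rewrite addr0.
have := @is_derive1_comp R g (fun s => s + L) 0 _ _ dL ds.
have -> : g \o (fun s => s + L) = g by apply/funext => s /=; exact: per.
by rewrite mulr1 => dL'; exact: is_derive_unique dL' d0.
Qed.

Lemma closure_convex_bounded (O : set (R * R)) : bounded2 O -> bounded2 (closure O).
Proof.
move=> [M hM]; exists (M + 1) => P cP.
have [Q [OQ [q1 q2]]] := cP _ (nbhsx_ballx P 1 ltr01).
have [m1 m2] := hM _ OQ.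
have near (b c : R) : `|b - c| < 1 -> `|c| <= M -> `|b| <= M + 1.
  move=> bc cM; rewrite -(subrK c b) (le_trans (ler_normD _ _))//; lra.
by split; [apply: near q1 m1|apply: near q2 m2].
Qed.

End Reduction.

(** Uniqueness concerns the closure, because a convex set that omits some of its boundary points has
    the same area, boundary curve and energy. *)
Theorem theorem1p1 (R : realType) (p a : R) (hp : 1 < p) (ha : 0 < a) :
  let r := Num.sqrt (a / pi) in
  let d1 := fun s : R => r * cos (s / r) in
  let d2 := fun s : R => r * sin (s / r) in
  let Ld := 2 * pi * r in
  admissible p a (cdisc (0, 0) r) d1 d2 Ld /\
  forall (O : set (R * R)) (g1 g2 : R -> R) (L : R),
    admissible p a O g1 g2 L ->
    (energy p Ld d1 d2 <= energy p L g1 g2)%E /\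
    (energy p L g1 g2 = energy p Ld d1 d2 -> exists c : R * R, closure O = cdisc c r).
Proof.
move=> r d1 d2 Ld.
have pi0 := pi_gt0 R.
have r0 : 0 < r by rewrite sqrtr_gt0 divr_gt0.
have ra : pi * r ^+ 2 = a.
  by rewrite sqr_sqrtr ?divr_ge0 ?ltW// mulrC divfK// gt_eqF.
split; first by rewrite -[a in admissible _ a]ra; apply: disc_admissible => //; exact: lt_trans hp.
move=> O g1 g2 L [cO bO aO bdO [L0 [per der] unit inj [w1 w2]]].
have -> : energy p Ld d1 d2 = (2 * pi * r * r^-1 `^ p)%:E by exact: disc_energy.
have Lge := ltW L0.
have per1 s : g1 (s + L) = g1 s by have [] := per s.
have per2 s : g2 (s + L) = g2 s by have [] := per s.
have [f1 a1] := W1p_acon hp w1; have [f2 a2] := W1p_acon hp w2.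
have dx (s : R) : is_derive s 1 g1 (derive1 g1 s).
  by split; [have [] := der s|rewrite derive1E].
have dy (s : R) : is_derive s 1 g2 (derive1 g2 s).
  by split; [have [] := der s|rewrite derive1E].
have tL1 : derive1 g1 L = derive1 g1 0 by apply: derive1_periodic => // s; have [] := der s.
have tL2 : derive1 g2 L = derive1 g2 0 by apply: derive1_periodic => // s; have [] := der s.
have gL1 : g1 L = g1 0 by rewrite -[L]add0r per1.
have gL2 : g2 L = g2 0 by rewrite -[L]add0r per2.
have bd s : 0 <= s <= L -> closure O (g1 s, g2 s) /\ ~ interior O (g1 s, g2 s).
  move=> hs; have : bdry2 O (g1 s, g2 s) by rewrite bdO; exists s => //=; rewrite in_itv.
  by [].
have mem s : 0 <= s <= L -> closure O (g1 s, g2 s) by move=> /bd [].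
have inj' s t : 0 <= s < L -> 0 <= t < L -> g1 s = g1 t -> g2 s = g2 t -> s = t.
  by move=> hs ht e1 e2; apply: inj => //; rewrite e1 e2.
have [x0 [x1 [l [u KE]]]] : exists x0 x1 l u, region (closure O) x0 x1 l u.
  apply: convex_region; first exact: closed_closure.
  - exact: closure_convex_bounded.
  - exact: convex2_closure.
  - by exists (g1 0, g2 0); apply: mem; rewrite lexx Lge.
have areaK : integ (fun s => u s - l s) x0 x1 = a.
  by have := region_area KE; rewrite -/(area2 O) aO => -[].
rewrite (energyE p a1 a2).
have [pos|neg] := orientation cO L0 dx dy unit per1 per2 bd a1 a2.
  exact: (oriented_curve_energy KE hp areaK L0 dx dy unit gL1 gL2 tL1 tL2 inj' a1 a2 mem pos r0 ra).
(* A clockwise curve is mirrored in the horizontal axis. The area is unchanged and the curvature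
   only changes sign, which the absolute value in [energy] does not see. *)
pose K := [set z : R * R | closure O (z.1, - z.2)].
have KE' := region_mirror KE.
have areaK' : integ (fun s => - l s - - u s) x0 x1 = a.
  by rewrite -areaK; apply: eq_integ => s _; ring.
have dy' (s : R) : is_derive s 1 (fun s => - g2 s) (- derive1 g2 s) by exact: is_deriveN.
have unit' s : derive1 g1 s ^+ 2 + (- derive1 g2 s) ^+ 2 = 1 by rewrite sqrrN.
have inj'' s t : 0 <= s < L -> 0 <= t < L -> g1 s = g1 t -> - g2 s = - g2 t -> s = t.
  by move=> hs ht e1 /oppr_inj e2; exact: inj'.
have mem' s : 0 <= s <= L -> K (g1 s, - g2 s) by move=> hs; rewrite /K /= opprK; exact: mem.
have supp' s P : 0 <= s <= L -> K P ->
    0 <= derive1 g1 s * (P.2 - - g2 s) - - derive1 g2 s * (P.1 - g1 s).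
  by move=> hs KP; have := neg s _ hs KP; rewrite /= -oppr_ge0; congr (0 <= _); ring.
have e1 : - g2 L = - g2 0 by rewrite gL2.
have e2 : - derive1 g2 L = - derive1 g2 0 by rewrite tL2.
have := oriented_curve_energy KE' hp areaK' L0 dx dy' unit' gL1 e1 tL1 e2 inj'' a1 (abs_contN a2) mem' supp' r0 ra.
have -> : (fun s => (`|derive1 g1 s * - f2 s - - derive1 g2 s * f1 s| `^ p)%:E) =
  (fun s => (`|derive1 g1 s * f2 s - derive1 g2 s * f1 s| `^ p)%:E).
  apply/funext => s; congr ((_ `^ p)%:E); rewrite -normrN; congr (`|_|); ring.
move=> [h1 h2]; split => // /h2 [c KE2]; exists (c.1, - c.2).
have flip X Y : closure O (X, Y) = K (X, - Y) by rewrite /K /= opprK.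
by apply/funext => -[X Y]; rewrite flip [K]KE2 /cdisc/= -opprD sqrrN opprK.
Qed.
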